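(* (a) For any parameters $\mu_j,\psi_{i,j},\theta_{j,i},w_{i,j},q_{i,j},\lambda_i,\sigma_{i,l}$ of an $n+m$ system satisfying Assumption 2 (stated in the context), there exist continuous continuum parameters $\lambda,\sigma,W_j,\theta_j,Q_j$ ($j=1,\dots,m$) which satisfy the sampling relations $$\theta_j(x,i/n)=\theta_{j,i}(x),\quad W_j(x,i/n)=w_{i,j}(x),\quad Q_j(i/n)=q_{i,j},\quad\lambda(x,i/n)=\lambda_i(x),\quad\sigma(x,i/n,l/n)=\sigma_{i,l}(x)$$ for all $x\in[0,1]$, $i,l=1,\dots,n$, $j=1,\dots,m$, and which, together with the original $\mu_j,\psi_{i,j}$, satisfy Assumption 1 (stated in the context). (b) For any such continuum parameters, the solution $K_i^p,L_{i,j}^p$ ($j=1,\dots,m$, $1\le i\le p\le m$) to the segmented continuum kernel equations (stated in the context) with parameters $\lambda,\mu_j,\sigma,W_j,\theta_j,Q_j,\psi_{i,j}$ and $l^{(1)}_{i,j}=l_{i,j}$ exists, and the following holds. For $n\in\mathbb N$, let $K^n_{i,p},\ell^p_{i,j}$ be the solution to the segmented continuum kernel equations with the parameters $\lambda^n,\sigma^n,W_j^n,\theta_j^n,Q_j^n$ which are the step functions in $y$ (and $\eta$) defined by $$\lambda^n(x,y)=\lambda_i(x),\ \ W^n_j(x,y)=w_{i,j}(x),\ \ \theta^n_j(x,y)=\theta_{j,i}(x),\ \ Q_j^n(y)=q_{i,j}\quad\text{for }y\in((i-1)/n,i/n],$$ $$\sigma^n(x,y,\eta)=\sigma_{i,l}(x)\quad\text{for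 }y\in((i-1)/n,i/n],\ \eta\in((l-1)/n,l/n],$$ where $\lambda_i,w_{i,j},\theta_{j,i},q_{i,j},\sigma_{i,l}$ are given by the sampling relations, and with the same $\mu_j,\psi_{i,j},l_{i,j}$. Then for any $\delta_1>0$ there exists $n_{\delta_1}\in\mathbb N$ such that for all $n\ge n_{\delta_1}$ $$\max_{1\le i\le p\le m}\max_{(x,\xi)\in\mathcal T_i^p}\|K_i^p(x,\xi,\cdot)-K_{i,p}^n(x,\xi,\cdot)\|_{L^2([0,1])}\le\delta_1,$$ $$\max_{j\in\{1,\dots,m\}}\max_{1\le i\le p\le m}\max_{(x,\xi)\in\mathcal T_i^p}|L_{i,j}^p(x,\xi)-\ell_{i,j}^p(x,\xi)|\le\delta_1.$$
   Context: Fix $m\in\mathbb N$. Assumption 1 (continuum parameters). $\mu_j\in C^1([0,1];\mathbb R)$; $\theta_j\in C([0,1];L^2([0,1];\mathbb R))$; $\psi_{i,j}\in C([0,1];\mathbb R)$; $W_j\in C([0,1];L^2([0,1];\mathbb R))$; $Q_j\in L^2([0,1];\mathbb R)$; $\lambda\in C^1([0,1]^2;\mathbb R)$; $\sigma\in C([0,1];L^2([0,1]^2;\mathbb R))$; $\mu_m(x)>0$ and $\lambda(x,y)>0$ uniformly for all $x,y\in[0,1]$; $\min_{x\in[0,1]}\mu_j(x)>\max_{x\in[0,1]}\mu_{j+1}(x)$ for $j=1,\dots,m-1$; $\psi_{j,j}=0$ for all $j$. Assumption 2 ($n+m$ parameters). $\lambda_i,\mu_j\in C^1([0,1])$, $\mu_m(x)>0$,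 $\lambda_i(x)>0$ for all $x\in[0,1]$, $i=1,\dots,n$; $\min_x\mu_j(x)>\max_x\mu_{j+1}(x)$ for $j=1,\dots,m-1$; $\sigma_{i,l},w_{i,j},\theta_{j,i},\psi_{i,j}$ are continuous on $[0,1]$; $q_{i,j}\in\mathbb R$; $\psi_{j,j}=0$ for all $j$. Segments. $\phi_i(x)=\int_0^x\frac{ds}{\mu_i(s)}$; $\rho_i^p(x)=\phi_p^{-1}(\phi_i(x))$ for $1\le i\le p\le m$; $\rho_i^{m+1}=0$; $\mathcal T_i^p=\{(x,\xi)\in[0,1]^2:\rho_i^{p+1}(x)\le\xi\le\rho_i^p(x)\}$. Segmented continuum kernel equations with parameters $\lambda,\mu_j,\sigma,W_j,\theta_j,Q_j,\psi_{i,j},l_{i,j}^{(1)}$. Unknowns $K_i^p\in C(\mathcal T_i^p;L^2([0,1];\mathbb R))$, $L_{i,j}^p\in C(\mathcal T_i^p;\mathbb R)$, $1\le i\le p\le m$, $j=1,\dots,m$, satisfying on $\mathcal T_i^p$ (for a.e. $y\in[0,1]$; $\lambda_\xi$ is the derivative in the first argument; derivatives understood by integration along characteristic curves) $$\mu_i(x)\partial_xK_i^p(x,\xi,y)-\lambda(\xi,y)\partial_\xi K_i^p(x,\xi,y)-\lambda_\xi(\xi,y)K_i^p(x,\xi,y)=\sum_{\ell=1}^mL_{i,\ell}^p(x,\xi)\theta_\ell(\xi,y)+\int_0^1K_i^p(x,\xi,\eta)\sigma(\xi,\eta,y)d\eta,$$ $$\mu_i(x)\partial_xL_{i,j}^p(x,\xi)+\mu_j(\xi)\partial_\xi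 L_{i,j}^p(x,\xi)+\mu_j'(\xi)L_{i,j}^p(x,\xi)=\sum_{\ell=1}^mL_{i,\ell}^p(x,\xi)\psi_{\ell,j}(\xi)+\int_0^1K_i^p(x,\xi,y)W_j(\xi,y)dy,$$ boundary conditions $L^i_{i,j}(x,x)=-\frac{\psi_{i,j}(x)}{\mu_i(x)-\mu_j(x)}$ ($j\ne i$), $K_i^i(x,x,y)=-\frac{\theta_i(x,y)}{\lambda(x,y)+\mu_i(x)}$, $L_{i,j}^m(x,0)=\frac1{\mu_j(0)}\int_0^1K_i^m(x,0,y)\lambda(0,y)Q_j(y)dy$ ($i\le j$), $L^p_{i,j}(1,\xi)=l_{i,j}^{(1)}(\xi)$ for $\xi\in[\rho_i^{p+1}(1),\rho_i^p(1)]$ ($j<i$, $p=i,\dots,m$); and continuity conditions, for $i<p\le m$: $L_{i,j}^{p-1}(x,\rho_i^p(x))=L_{i,j}^p(x,\rho_i^p(x))$ for all $j\ne p$ and $K_i^{p-1}(x,\rho_i^p(x),y)=K_i^p(x,\rho_i^p(x),y)$. Here $l_{i,j}^{(1)}=l_{i,j}$ ($j<i$) are fixed continuous functions with $l_{i,j}(1)=-\frac{\psi_{i,j}(1)}{\mu_i(1)-\mu_j(1)}$. For the step-function parameters the solution $K_{i,p}^n,\ell_{i,j}^p$ is the one obtained from the kernels $k_{i,l}^p,\ell_{i,j}^p$ of the $n+m$ backstepping design by $K_{i,p}^n(x,\xi,y)=k_{i,l}^p(x,\xi)$ for $y\in((l-1)/n,l/n]$. *)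

(* Defs.v *)
From HB Require Import structures.
From mathcomp Require Import all_boot all_order all_algebra.
From mathcomp Require Import all_classical all_reals all_analysis.

Set Implicit Arguments.
Unset Strict Implicit.
Unset Printing Implicit Defensive.

Import Order.TTheory GRing.Theory Num.Theory.
Import numFieldNormedType.Exports.

Local Open Scope classical_set_scope.
Local Open Scope ring_scope.

(* Functions on [0, 1] are total functions on R of which only the values on
   [0, 1] matter; channel indices 1..m and node indices 1..n are 0-based
   ordinals 'I_m and 'I_n. *)

Section FunctionSpaces.
Variable R : realType.

Definition I01 : set R := `[0, 1].

Definition cont01 (f : R -> R) : Prop := {within I01, continuous f}.

Definition cont01_2 (f : R -> R -> R) : Prop :=
  {within I01 `*` I01, continuous (fun z : R * R => f z.1 z.2)}.

Definition cont01_3 (f : R -> R -> R -> R) : Prop :=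
  {within I01 `*` I01 `*` I01,
     continuous (fun z : R * R * R => f z.1.1 z.1.2 z.2)}.

Definition quot (f : R -> R) (x z : R) : R := (f z - f x) / (z - x).

(* [within I01 x^'] makes this the one-sided derivative at 0 and at 1. *)
Definition derive01 (f : R -> R) (x : R) : R :=
  lim (quot f x z @[z --> within I01 x^']).

Definition derivable01 (f : R -> R) (x : R) : Prop :=
  cvg (quot f x z @[z --> within I01 x^']).

Definition C1_01 (f : R -> R) : Prop :=
  (forall x, I01 x -> derivable01 f x) /\ cont01 (derive01 f).

Definition C1_01_2 (f : R -> R -> R) : Prop :=
  [/\ forall x y, I01 x -> I01 y ->
        derivable01 (f ^~ y) x /\ derivable01 (f x) y,
      cont01_2 f,
      cont01_2 (fun x y => derive01 (f ^~ y) x) &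
      cont01_2 (fun x y => derive01 (f x) y)].

Definition L2_on d (T : measurableType d) (nu : {measure set T -> \bar R})
    (D : set T) (f : T -> R) : Prop :=
  f \_ D \in @Lfun d T R nu 2%:E.

Definition L2_norm_on d (T : measurableType d)
    (nu : {measure set T -> \bar R}) (D : set T) (f : T -> R) : R :=
  fine ('N[nu]_(2%:E) [EFin \o (f \_ D)])%E.

(* F is in C(A; L^2(D, nu)). *)
Definition C_L2 (X : topologicalType) (A : set X) d (T : measurableType d)
    (nu : {measure set T -> \bar R}) (D : set T) (F : X -> T -> R) : Prop :=
  (forall a, A a -> L2_on nu D (F a)) /\
  (forall a, A a ->
     L2_norm_on nu D (fun y => F b y - F a y) @[b --> within A (nbhs a)]
       --> (0 : R)).

Definition leb : {measure set (measurableTypeR R) -> \bar R} :=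
  @lebesgue_measure R.

Definition leb2 : {measure set (measurableTypeR R * measurableTypeR R)%type
    -> \bar R} := (@lebesgue_measure R \x @lebesgue_measure R)%E.

Definition norm_L2_01 (f : R -> R) : R := L2_norm_on leb I01 f.

End FunctionSpaces.

Arguments I01 {R}.
Arguments leb {R}.
Arguments leb2 {R}.

Section Coefficients.
Variables (R : realType) (m : nat).

Record continuum_params := ContinuumParams {
  c_lam : R -> R -> R;
  c_mu : 'I_m -> R -> R;
  c_sig : R -> R -> R -> R;
  c_W : 'I_m -> R -> R -> R;
  c_th : 'I_m -> R -> R -> R;
  c_Q : 'I_m -> R -> R;
  c_psi : 'I_m -> 'I_m -> R -> R
}.

Record nm_params (n : nat) := NMParams {
  d_lam : 'I_n -> R -> R;
  d_mu : 'I_m -> R -> R;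
  d_sig : 'I_n -> 'I_n -> R -> R;
  d_w : 'I_n -> 'I_m -> R -> R;
  d_th : 'I_m -> 'I_n -> R -> R;
  d_q : 'I_n -> 'I_m -> R;
  d_psi : 'I_m -> 'I_m -> R -> R
}.

(* min mu_j > max mu_{j+1}, for consecutive channels j and k. *)
Definition mu_ordered (mu : 'I_m -> R -> R) : Prop :=
  forall j k : 'I_m, k = j.+1 :> nat ->
    forall x x', I01 x -> I01 x' -> mu k x' < mu j x.

Definition continuum_assumption (P : continuum_params) : Prop :=
  [/\ (forall j, C1_01 (c_mu P j)) /\ C1_01_2 (c_lam P),
      forall j, C_L2 I01 leb I01 (c_th P j) /\ C_L2 I01 leb I01 (c_W P j),
      (forall j, L2_on leb I01 (c_Q P j)) /\
      C_L2 I01 leb2 (I01 `*` I01) (fun x z => c_sig P x z.1 z.2),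
      (forall i j, cont01 (c_psi P i j)) /\
      (forall j x, I01 x -> c_psi P j j x = 0) &
      [/\ exists2 c : R, 0 < c & forall j : 'I_m, j.+1 = m ->
            forall x, I01 x -> c <= c_mu P j x,
          exists2 c : R, 0 < c &
            forall x y, I01 x -> I01 y -> c <= c_lam P x y &
          mu_ordered (c_mu P)]].

Definition nm_assumption n (D : nm_params n) : Prop :=
  [/\ (forall i, C1_01 (d_lam D i)) /\ (forall j, C1_01 (d_mu D j)),
      (forall j : 'I_m, j.+1 = m -> forall x, I01 x -> 0 < d_mu D j x) /\
      (forall i x, I01 x -> 0 < d_lam D i x),
      mu_ordered (d_mu D),
      [/\ forall i k, cont01 (d_sig D i k),
          forall i j, cont01 (d_w D i j),
          forall j i, cont01 (d_th D j i) &
          forall i j, cont01 (d_psi D i j)] &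
      forall j x, I01 x -> d_psi D j j x = 0].

(* Continuity in all variables jointly, in particular in the ensemble variables
   y and eta; this is what makes the point values at the nodes meaningful. *)
Definition jointly_continuous (P : continuum_params) : Prop :=
  [/\ cont01_2 (c_lam P), cont01_3 (c_sig P),
      forall j, cont01_2 (c_W P j), forall j, cont01_2 (c_th P j) &
      forall j, cont01 (c_Q P j)].

Definition node n (i : 'I_n) : R := i.+1%:R / n%:R.

Definition sampling_relations n (P : continuum_params) (D : nm_params n)
    : Prop :=
  [/\ forall j i x, I01 x -> c_th P j x (node i) = d_th D j i x,
      forall i j x, I01 x -> c_W P j x (node i) = d_w D i j x,
      forall i j, c_Q P j (node i) = d_q D i j,
      forall i x, I01 x -> c_lam P x (node i) = d_lam D i x &
      forall i k x, I01 x -> c_sig P x (node i) (node k) = d_sig D i k x].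

Definition same_mu_psi n (P : continuum_params) (D : nm_params n) : Prop :=
  c_mu P = d_mu D /\ c_psi P = d_psi D.

(* The step function with value [c i] on ((i-1)/n, i/n] (i counted from 1). *)
Definition step_fun n (c : 'I_n -> R) (y : R) : R :=
  \sum_(i < n) c i * \1_(`]i%:R / n%:R, i.+1%:R / n%:R] : set R) y.

Definition step_params n (D : nm_params n) : continuum_params :=
  {| c_lam := fun x => step_fun (fun i => d_lam D i x);
     c_mu := d_mu D;
     c_sig := fun x y eta =>
       step_fun (fun i => step_fun (fun k => d_sig D i k x) eta) y;
     c_W := fun j x => step_fun (fun i => d_w D i j x);
     c_th := fun j x => step_fun (fun i => d_th D j i x);
     c_Q := fun j => step_fun (fun i => d_q D i j);
     c_psi := d_psi D |}.

End Coefficients.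

Section Segments.
Variables (R : realType) (m : nat) (mu : 'I_m -> R -> R).

Definition phi (i : 'I_m) (x : R) : R :=
  \int[@lebesgue_measure R]_(s in `[0, x]) (mu i s)^-1.

(* Total in the index p : for p an index of a channel this is
   phi_p^{-1} (phi_i x), and past the last channel it is 0. *)
Definition rho (i : 'I_m) (p : nat) (x : R) : R :=
  if insub p is Some q then 'pinv_(fun=> 0) I01 (phi q) (phi i x) else 0.

Definition Tseg (i p : 'I_m) : set (R * R) :=
  [set z | [/\ I01 z.1, I01 z.2 & rho i p.+1 z.1 <= z.2 <= rho i p z.1]].

End Segments.

Section KernelEquations.
Variables (R : realType) (m : nat).

(* s |-> (X s, Xi s), s in [a, b], is a characteristic curve, staying in T,
   of the operator f(x) d/dx + g(xi) d/dxi. *)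
Definition char_curve (T : set (R * R)) (f g : R -> R) (a b : R)
    (X Xi : R -> R) : Prop :=
  [/\ {within `[a, b], continuous X}, {within `[a, b], continuous Xi},
      forall s, s \in `[a, b] -> T (X s, Xi s),
      forall s, s \in `]a, b[ -> is_derive s (1 : R) X (f (X s)) &
      forall s, s \in `]a, b[ -> is_derive s (1 : R) Xi (g (Xi s))].

(* f(x) du/dx + g(xi) du/dxi = F on T, integrated along characteristics. *)
Definition transport (T : set (R * R)) (f g : R -> R)
    (u F : R -> R -> R) : Prop :=
  forall (a b : R) (X Xi : R -> R), a <= b -> char_curve T f g a b X Xi ->
    (@lebesgue_measure R).-integrable `[a, b]
      (EFin \o (fun s => F (X s) (Xi s))) /\
    u (X b) (Xi b) - u (X a) (Xi a) =
      \int[@lebesgue_measure R]_(s in `[a, b]) F (X s) (Xi s).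

(* [K i p x xi y] and [L i j p x xi] are relevant for i <= p only. *)
Definition kernelK := 'I_m -> 'I_m -> R -> R -> R -> R.
Definition kernelL := 'I_m -> 'I_m -> 'I_m -> R -> R -> R.

Variables (P : continuum_params R m) (l : 'I_m -> 'I_m -> R -> R).
Variables (K : kernelK) (L : kernelL).

Let mu := c_mu P.
Let lam := c_lam P.
Let T (i p : 'I_m) := Tseg mu i p.

Definition kernels_continuous : Prop :=
  forall i p : 'I_m, (i <= p)%N ->
    C_L2 (T i p) leb I01 (fun z => K i p z.1 z.2) /\
    forall j, {within T i p, continuous (fun z : R * R => L i j p z.1 z.2)}.

Definition K_rhs (i p : 'I_m) (y x xi : R) : R :=
  derive01 (lam ^~ y) xi * K i p x xi y
  + \sum_(k < m) L i k p x xi * c_th P k xi y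
  + \int[@lebesgue_measure R]_(eta in `[0, 1])
      (K i p x xi eta * c_sig P xi eta y).

Definition L_rhs (i j p : 'I_m) (x xi : R) : R :=
  - (derive01 (mu j) xi * L i j p x xi)
  + \sum_(k < m) L i k p x xi * c_psi P k j xi
  + \int[@lebesgue_measure R]_(y in `[0, 1])
      (K i p x xi y * c_W P j xi y).

(* The conditions on K i p _ _ y, for a fixed ensemble variable y. *)
Definition K_equations_at (y : R) : Prop :=
  [/\ forall i p : 'I_m, (i <= p)%N ->
        transport (T i p) (mu i) (fun xi => - lam xi y)
          (fun x xi => K i p x xi y) (K_rhs i p y),
      forall (i : 'I_m) x, I01 x ->
        K i i x x y = - (c_th P i x y / (lam x y + mu i x)) &
      forall i p p' : 'I_m, (i <= p')%N -> p = p'.+1 :> nat ->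
        forall x, I01 x ->
          K i p' x (rho mu i p x) y = K i p x (rho mu i p x) y].

Definition L_equations : Prop :=
  [/\ forall i j p : 'I_m, (i <= p)%N ->
        transport (T i p) (mu i) (mu j) (L i j p) (L_rhs i j p),
      forall i j : 'I_m, j != i -> forall x, I01 x ->
        L i j i x x = - (c_psi P i j x / (mu i x - mu j x)),
      forall i j p : 'I_m, p.+1 = m -> (i <= j)%N -> forall x, I01 x ->
        L i j p x 0 = (mu j 0)^-1 * \int[@lebesgue_measure R]_(y in `[0, 1])
                        (K i p x 0 y * lam 0 y * c_Q P j y),
      forall i j p : 'I_m, (j < i <= p)%N ->
        forall xi, rho mu i p.+1 1 <= xi <= rho mu i p 1 ->
          L i j p 1 xi = l i j xi &
      forall i j p p' : 'I_m, (i <= p')%N -> p = p'.+1 :> nat -> j != p ->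
        forall x, I01 x ->
          L i j p' x (rho mu i p x) = L i j p x (rho mu i p x)].

(* [K i p x xi] represents an element of L^2([0, 1]); the exceptional null set
   of y is common to all (x, xi), because the characteristics of K depend on y,
   so that its restrictions to them make no sense for a null set varying
   with (x, xi). *)
Definition segmented_solution : Prop :=
  [/\ kernels_continuous,
      {ae @lebesgue_measure R, forall y, I01 y -> K_equations_at y} &
      L_equations].

Definition admissible_l : Prop :=
  forall i j : 'I_m, (j < i)%N ->
    cont01 (l i j) /\ l i j 1 = - (c_psi P i j 1 / (mu i 1 - mu j 1)).

End KernelEquations.

(* The kernel that is piecewise constant in y with the values [k i p q] of a
   kernel of the n+m system. *)
Definition step_kernel (R : realType) (m n : nat)
    (k : 'I_m -> 'I_m -> 'I_n -> R -> R -> R) : kernelK R m :=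
  fun i p x xi => step_fun (fun q => k i p q x xi).

(* Main.v *)
(* For each row i the kernel equations decouple, and in the coordinates
   t = phi_i x the segment boundaries become curves xi = phi_p^{-1} t. Every
   component is an integral along its characteristics, from the diagonal, from
   xi = 0 or from x = 1; on the way there t - kappa xi decreases at a positive
   rate for a suitable kappa, because max mu_i < min mu_{i-1}. With the weight
   exp (gamma (t - kappa xi)) and gamma large the system is therefore a
   contraction.

   The step parameters are the continuum parameters with the ensemble variables
   read through nu_n y = ceil (n y) / n. For kernels K (x, xi, nu_n y) the
   equations become a system with the same characteristics and coefficients for
   every n, in which only the averages over the ensemble variable use nu_n. So the
   contraction gives solutions continuous in all variables, and their uniform
   dependence on nu; as nu_n tends to the identity uniformly, the step solutions
   converge. Uniqueness in the class of L^2-valued solutions, from the same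
   weights applied to the difference of two solutions, transfers this to the
   given solutions.

   Interpolation by squared Lagrange polynomials gives part (a). *)
Require Import Defs.
From HB Require Import structures.
From mathcomp Require Import all_boot all_order all_algebra.
From mathcomp Require Import all_classical all_reals all_analysis.
From mathcomp Require Import measurable_realfun ring lra.
Import Order.TTheory GRing.Theory Num.Theory.
Import numFieldNormedType.Exports.
Local Open Scope classical_set_scope.
Local Open Scope ring_scope.

(** * Continuity and integration on the line *)

(** L_j may jump across xi = phi_j^{-1} t, so a row is not one continuous system. Each L_j is
    therefore split into two branches, each continuous on its own region and extended by a
    retraction onto it. The sources then jump, but harmlessly: characteristics of the other
    components meet the jump curve at most once, because the speeds are strictly ordered, and along
    those of L_j the jump of L_j is multiplied by psi_{j,j} = 0.

    The constant kappa separates speeds. Following L_j to its data means decreasing t for j >= i and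
    increasing t for j < i, so kappa mu_j must be below 1 in the first case and above 1 in the
    second.

    An arbitrary solution is merely L^2 in y and given segment by segment, hence not a state of the
    fixed-point problem. Its equations are integrated for almost every single y, where the term with
    K itself is not controlled by an average; a Gronwall estimate absorbs it, and only then are L^1
    norms in y taken. The estimates pass from segment to segment through the interfaces, and no
    characteristic uses the missing continuity condition j = p. *)

Section Continuity.
Context {R : realType}.

Lemma cont_pair (T U V : topologicalType) (f : T -> U) (g : T -> V) :
  continuous f -> continuous g -> continuous (fun x => (f x, g x)).
Proof. by move=> cf cg x; apply: cvg_pair; [exact: cf|exact: cg]. Qed.

Lemma cont_comp (T U V : topologicalType) (f : T -> U) (g : U -> V) :
  continuous g -> continuous f -> continuous (fun x => g (f x)).
Proof. by move=> cg cf x; apply: continuous_comp; [exact: cf|exact: cg]. Qed.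

Lemma cont_cst (T U : topologicalType) (a : U) : continuous (fun _ : T => a).
Proof. by move=> x; exact: cvg_cst. Qed.

Lemma cont_id (T : topologicalType) : continuous (fun x : T => x).
Proof. by move=> x; exact: cvg_id. Qed.

Lemma cont_fst (T U V : topologicalType) (f : T -> U * V) :
  continuous f -> continuous (fun x => (f x).1).
Proof. by move=> cf x; apply: cvg_comp; [exact: cf|exact: cvg_fst]. Qed.

Lemma cont_snd (T U V : topologicalType) (f : T -> U * V) :
  continuous f -> continuous (fun x => (f x).2).
Proof. by move=> cf x; apply: cvg_comp; [exact: cf|exact: cvg_snd]. Qed.

Context {T : topologicalType}.
Implicit Types f g : T -> R.

Lemma contD f g : continuous f -> continuous g -> continuous (fun x => f x + g x).
Proof. by move=> cf cg x; apply: cvgD; [exact: cf|exact: cg]. Qed.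

Lemma contN f : continuous f -> continuous (fun x => - f x).
Proof. by move=> cf x; apply: cvgN; exact: cf. Qed.

Lemma contB f g : continuous f -> continuous g -> continuous (fun x => f x - g x).
Proof. by move=> cf cg x; apply: cvgB; [exact: cf|exact: cg]. Qed.

Lemma contM f g : continuous f -> continuous g -> continuous (fun x => f x * g x).
Proof. by move=> cf cg x; apply: cvgM; [exact: cf|exact: cg]. Qed.

Lemma contV f : continuous f -> (forall x, f x != 0) -> continuous (fun x => (f x)^-1).
Proof. by move=> cf f0 x; apply: cvgV; [exact: f0|exact: cf]. Qed.

Lemma contmax f g : continuous f -> continuous g ->
  continuous (fun x => Num.max (f x) (g x)).
Proof. by move=> cf cg x; apply: continuous_max; [exact: cf|exact: cg]. Qed.

Lemma contmin f g : continuous f -> continuous g ->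
  continuous (fun x => Num.min (f x) (g x)).
Proof. by move=> cf cg x; apply: continuous_min; [exact: cf|exact: cg]. Qed.

Lemma cont_sum (I : Type) (s : seq I) (F : I -> T -> R) :
  (forall i, continuous (F i)) -> continuous (fun x => \sum_(i <- s) F i x).
Proof.
move=> cF; elim: s => [|i s IH].
  by rewrite (_ : (fun _ => _) = fun=> 0); [exact: cont_cst|apply/funext => x; rewrite big_nil].
rewrite (_ : (fun _ => _) = fun x => F i x + \sum_(j <- s) F j x).
  exact: contD.
by apply/funext => x; rewrite big_cons.
Qed.

(** Used with clampings as [h]: it replaces continuity on a subspace by continuity on the whole
    space. *)
Lemma within_comp (U V : topologicalType) (A : set U) (f : U -> V) (h : T -> U) :
  {within A, continuous f} -> continuous h -> (forall x, A (h x)) ->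
  continuous (fun x => f (h x)).
Proof.
move=> /subspace_continuousP cf ch Ah x.
apply: (cvg_comp _ _ _ (cf _ (Ah x))) => B.
rewrite /within/= => nB.
have := ch x _ nB; rewrite /fmap/=.
by apply: (@filterS _ (nbhs x)) => y; apply; exact: Ah.
Qed.

(** Composition with this retraction onto [0, 1] turns functions of which only the values on [0, 1]
    matter into continuous functions on the line. *)
Definition cl (x : R) : R := Num.max 0 (Num.min 1 x).

Lemma clE x : cl x = if 1 <= x then 1 else if 0 <= x then x else 0.
Proof.
rewrite /cl; case: (lerP 1 x) => h; first by rewrite max_r.
by case: (lerP 0 x).
Qed.

Lemma cl01 x : 0 <= cl x <= 1.
Proof.
by rewrite clE; case: (lerP 1 x) => ?; last case: (lerP 0 x) => ?; apply/andP; split; lra.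
Qed.

Lemma clI x : I01 (cl x).
Proof. by rewrite /I01/= in_itv/= cl01. Qed.

Lemma cl_id x : 0 <= x <= 1 -> cl x = x.
Proof. by move=> /andP[? ?]; rewrite /cl min_r// max_r. Qed.

Lemma cl_mono x y : x <= y -> cl x <= cl y /\ cl y - cl x <= y - x.
Proof.
move=> ?; rewrite !clE; case: (lerP 1 x) => ?; case: (lerP 1 y) => ?;
  case: (lerP 0 x) => ?; case: (lerP 0 y) => ?; split; lra.
Qed.

Lemma I01E x : (@I01 R x) = (0 <= x <= 1).
Proof. by rewrite /I01/= in_itv. Qed.

End Continuity.

Lemma cont_cl (R : realType) : continuous (@cl R).
Proof. by apply: contmax; [exact: cont_cst|apply: contmin; [exact: cont_cst|exact: cont_id]]. Qed.

Section Integrals.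
Context {R : realType}.
Notation mu := (@lebesgue_measure R).

Lemma bounded_integrable (a b B : R) (f : R -> R) :
  measurable_fun `[a, b] f -> (forall x, a <= x <= b -> `|f x| <= B) ->
  mu.-integrable `[a, b] (EFin \o f).
Proof.
move=> mf fB; apply: measurable_bounded_integrable => //.
  have := lebesgue_measure_itv `[a, b]%R; rewrite /= => ->.
  by case: ifP => _; rewrite ?ltry// -EFinB ltry.
exists B; split; first exact: num_real.
move=> x Bx y; rewrite /= in_itv/= => xab.
by rewrite (le_trans (fB _ xab))// ltW.
Qed.

Lemma Rintegral_bound (a b B : R) (f : R -> R) : a <= b ->
  measurable_fun `[a, b] f -> (forall x, a <= x <= b -> `|f x| <= B) ->
  `|\int[mu]_(x in `[a, b]) f x| <= B * (b - a).
Proof.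
move=> ab mf fB.
have If := bounded_integrable _ _ _ _ mf fB.
apply: (le_trans (le_normr_Rintegral _ If)) => //.
have Ic : mu.-integrable `[a, b] (EFin \o (fun=> B)).
  by apply: (@bounded_integrable _ _ `|B|).
apply: (@le_trans _ _ (\int[mu]_(x in `[a, b]) B)).
  by apply: le_Rintegral => //; exact: (integrable_norm If).
rewrite Rintegral_cst//.
have := lebesgue_measure_itv `[a, b]%R; rewrite /= => ->.
rewrite lte_fin; have [ba|ba] := ltP a b; first by rewrite -EFinB.
by have -> : b = a; [lra|rewrite subrr].
Qed.

End Integrals.

Section Integrals2.
Context {R : realType}.
Notation mu := (@lebesgue_measure R).

(** If convergence fails, the balls of radius 1/(n+1) around [z0] contain points with error at least
    [e], and dominated convergence along this sequence is contradicted. The set [N] takes up the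
    instants at which an integrand jumps. *)
Lemma cvg_dominated (T : pseudoMetricType R) (F : T -> R -> R) (a b B : R)
    (N : set R) (z0 : T) :
  (forall z, measurable_fun `[a, b] (F z)) ->
  (forall z s, a <= s <= b -> `|F z s| <= B) ->
  mu.-negligible N ->
  (forall s, a <= s <= b -> ~ N s -> F z s @[z --> z0] --> F z0 s) ->
  \int[mu]_(s in `[a, b]) F z s @[z --> z0] --> \int[mu]_(s in `[a, b]) F z0 s.
Proof.
move=> mF FB nN cF; apply/cvgrPdist_lt => e e0; apply: contrapT => H.
have {}H (n : nat) : exists z, ball z0 (n.+1%:R^-1) z /\
    e <= `|\int[mu]_(s in `[a, b]) F z0 s - \int[mu]_(s in `[a, b]) F z s|.
  apply: contrapT => Hn; apply: H.
  apply/nbhs_ballP; exists (n.+1%:R^-1) => //=.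
  by move=> z bz; rewrite ltNge; apply/negP => ?; apply: Hn; exists z.
have [u /all_and2[bu eu]] := choice H.
have cu : u @ \oo --> z0.
  apply/cvg_ballP => d d0; near=> n.
  apply: le_ball (bu n); near: n.
  by apply: filterS (near_infty_natSinv_lt (PosNum d0)) => n /ltW.
have IF z : mu.-integrable `[a,
  b] (EFin \o F z) by apply: (@bounded_integrable _ a b B) => // s; exact: FB.
have [| | | | |_ _ /= C] := @dominated_convergence _ (measurableTypeR R) R mu `[a,
  b]%classic (measurable_itv _)
  (fun n s => (F (u n) s)%:E) (fun s => (F z0 s)%:E) (fun=> B%:E).
- by move=> n; apply/measurable_EFinP; exact: mF.
- by apply/measurable_EFinP; exact: mF.
- move: nN; apply: negligibleS => s /= /not_implyP[]; rewrite in_itv/= => sab nc.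
  apply: contrapT => Ns; apply: nc; apply: cvg_EFin; first exact: nearW.
  exact: (cvg_comp _ _ cu (cF s sab Ns)).
- by apply: (@bounded_integrable _ a b `|B| (fun=> B)) => //.
- by apply/aeW => s n; rewrite /= in_itv/= => /FB; rewrite lee_fin.
have /cvgrPdist_lt/(_ e e0) : \int[mu]_(s in `[a, b]) F (u n) s @[n --> \oo]
    --> \int[mu]_(s in `[a, b]) F z0 s.
  apply: (@fine_cvg _ _ _ _ (fun n => \int[mu]_(s in `[a, b]) (F (u n) s)%:E)%E).
  by rewrite fineK; [exact: C|exact: (integrable_fin_num _ (IF z0))].
by case=> n _ /(_ n (leqnn n)) /=; rewrite ltNge eu.
Unshelve. all: by end_near. Qed.

Lemma Rintegral_shift (a b c : R) (G : R -> R) : a <= b -> continuous G ->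
  \int[mu]_(s in `[a, b]) G (s + c) = \int[mu]_(r in `[a + c, b + c]) G r.
Proof.
move=> ab cG; congr fine.
have dF (x : R) : is_derive x (1 : R) (fun s => s + c) 1.
  by apply: is_derive_eq; rewrite addr0.
have F1 : derive1 (fun s : R => s + c) = fun=> 1.
  by apply/funext => x; rewrite derive1E (@derive_val _ _ _ _ _ _ _ (dF x)).
rewrite (@integration_by_substitution_increasing _ (fun s => s + c) G a b)//.
- by apply: eq_integral => x _; rewrite F1 /= mulr1.
- by move=> x y _ _; rewrite ltrD2r.
- by rewrite F1 => x _; exact: cst_continuous.
- by rewrite F1; exact: is_cvg_cst.
- by rewrite F1; exact: is_cvg_cst.
- split.
  + by move=> x _; have [] := dF x.
  + apply: cvg_at_right_filter; apply: cvgD; [exact: cvg_id|exact: cvg_cst].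
  + apply: cvg_at_left_filter; apply: cvgD; [exact: cvg_id|exact: cvg_cst].
- exact: continuous_subspaceT.
Qed.

Lemma Rintegral_expR (k p a b : R) : k != 0 -> a <= b ->
  \int[mu]_(r in `[a, b]) expR (k * (r - p)) =
  (expR (k * (b - p)) - expR (k * (a - p))) / k.
Proof.
move=> k0; rewrite le_eqVlt => /predU1P[<-|ab].
  by rewrite set_itv1 Rintegral_set1 subrr mul0r.
pose F (r : R) := expR (k * (r - p)) / k.
have dF (x : R) : is_derive x (1 : R) F (expR (k * (x - p))).
  apply: is_derive_eq; rewrite /GRing.scale/= subr0 mulr0 add0r.
  by field.
have cF : continuous F.
  move=> x; apply: differentiable_continuous; apply/derivable1_diffP.
  by have [] := dF x.
rewrite /Rintegral (@continuous_FTC2 _ _ F)//.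
- by rewrite -EFinB/= /F -mulrBl.
- apply: continuous_subspaceT; apply: cont_comp; first exact: continuous_expR.
  by apply: contM; [exact: cont_cst|apply: contB; [exact: cont_id|exact: cont_cst]].
- split; [by move=> x _; have [] := dF x|exact/cvg_at_right_filter/cF|exact/cvg_at_left_filter/cF].
- by move=> x _; rewrite derive1E (@derive_val _ _ _ _ _ _ _ (dF x)).
Qed.

End Integrals2.

(** * Growth estimates with exponential weights *)

Section Growth.
Context {R : realType}.
Notation mu := (@lebesgue_measure R).

(** A contraction with factor 1/2 halves every bound; in this way a crude a priori bound becomes
    arbitrarily small. *)
Lemma halving (P : R -> Prop) (M : R) : 0 <= M -> P M ->
  (forall N, 0 <= N -> P N -> P (N / 2)) ->
  forall e, 0 < e -> exists2 N, 0 <= N <= e & P N.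
Proof.
move=> M0 PM H e e0.
have Pn n : P (M / 2 ^+ n).
  elim: n => [|n IH]; first by rewrite expr0 divr1.
  by rewrite exprSr invfM mulrA; apply: H => //; rewrite divr_ge0// exprn_ge0.
pose n := (Num.bound (M / e)).+1; exists (M / 2 ^+ n) => //.
rewrite divr_ge0 ?exprn_ge0//= ler_pdivrMr ?exprn_gt0//.
rewrite mulrC -ler_pdivrMr//.
have /ltW/le_trans := archi_boundP (divr_ge0 M0 (ltW e0)); apply.
by rewrite -natrX ler_nat; apply: leq_trans (ltnW (ltn_expl _ _)) => //; rewrite /n leqnSn.
Qed.

(* The exponent [g] of the weight falls at rate at least [eps] when moving away
   from [t], so the integral of the weight over the path is at most
   [1 / (gam * eps)] times its decrease from [t] to [s]. *)
Lemma growth_step (lo hi t s gam eps A B v : R) (g h : R -> R) :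
  0 < gam -> 0 < eps -> lo <= hi ->
  (t = hi /\ s = lo) \/ (t = lo /\ s = hi) ->
  (forall r, lo <= r <= hi -> g r <= g t - eps * `|t - r|) ->
  measurable_fun `[lo, hi] h ->
  (forall r, lo <= r <= hi -> `|h r| <= B * expR (gam * g r)) ->
  0 <= B -> B <= A * (gam * eps) ->
  `|v| <= A * expR (gam * g s) ->
  `|v| + `|\int[mu]_(r in `[lo, hi]) h r| <= A * expR (gam * g t).
Proof.
move=> gam0 eps0 lohi ts gt mh hB B0 BA vA.
set k := gam * eps in BA; have k0 : 0 < k by rewrite mulr_gt0.
have A0 : 0 <= A by rewrite -(pmulr_lge0 _ k0) (le_trans B0).
have slohi : lo <= s <= hi by case: ts => -[_ ->]; rewrite lexx lohi.
have Eg r : lo <= r <= hi ->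
    expR (gam * g r) <= expR (gam * g t) * expR (- (k * `|t - r|)).
  move=> rlh; rewrite -expRD ler_expR -mulrA -mulrBr ler_pM2l//.
  exact: gt.
(* On the path |t - r| is linear in r. The slope [k'] is k or -k according to which end [t] is, and
   the weight becomes an exponential that is integrated explicitly. *)
have [k' [k'0 kE kk]] : exists k', [/\ k' != 0,
    (forall r, lo <= r <= hi -> - (k * `|t - r|) = k' * (r - t)) &
    (expR (k' * (hi - t)) - expR (k' * (lo - t))) / k' =
    (1 - expR (- (k * `|t - s|))) / k].
  case: ts => -[-> ->]; [exists k|exists (- k)]; (split; [by rewrite ?oppr_eq0 gt_eqF| |]).
  - by move=> r /andP[? ?]; rewrite ger0_norm; [ring|lra].
  - rewrite subrr mulr0 expR0 ger0_norm; last lra.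
    by congr ((1 - expR _) / _); ring.
  - by move=> r /andP[? ?]; rewrite ler0_norm; [ring|lra].
  - rewrite subrr mulr0 expR0 ler0_norm; last lra.
    by rewrite invrN mulrN -mulNr opprB; congr ((1 - expR _) / _); ring.
have mE : continuous (fun r => B * (expR (gam * g t) * expR (k' * (r - t)))).
  apply: contM; first exact: cont_cst.
  apply: contM; first exact: cont_cst.
  apply: (cont_comp _ _ _ _ _ (@continuous_expR R)).
  by apply: contM; [exact: cont_cst|apply: contB; [exact: cont_id|exact: cont_cst]].
have hE r : lo <= r <= hi ->
    `|h r| <= B * (expR (gam * g t) * expR (k' * (r - t))).
  move=> rlh; apply: (le_trans (hB _ rlh)); rewrite ler_wpM2l// -kE//.
  exact: Eg.
have iE : mu.-integrable `[lo, hi] (EFin \o (fun r => expR (k' * (r - t)))).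
  apply: continuous_compact_integrable; first exact: segment_compact.
  apply: continuous_subspaceT; apply: (cont_comp _ _ _ _ _ (@continuous_expR R)).
  by apply: contM; [exact: cont_cst|apply: contB; [exact: cont_id|exact: cont_cst]].
have ih : mu.-integrable `[lo, hi] (EFin \o h).
  apply: (@bounded_integrable _ _ _ (B * expR (gam * g t))) => // r rlh.
  apply: (le_trans (hB _ rlh)); rewrite ler_wpM2l// ler_expR ler_pM2l//.
  by apply: (le_trans (gt _ rlh)); rewrite gerBl mulr_ge0// ltW.
have Ih : `|\int[mu]_(r in `[lo, hi]) h r| <=
    B * expR (gam * g t) * ((1 - expR (- (k * `|t - s|))) / k).
  apply: (le_trans (le_normr_Rintegral _ ih)) => //.
  rewrite -kk -Rintegral_expR// -RintegralZl//.
  apply: le_Rintegral => //; first exact: (integrable_norm ih).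
    apply: continuous_compact_integrable; first exact: segment_compact.
    apply: continuous_subspaceT; move: mE.
    by rewrite (_ : (fun _ => _) = (fun r => B * expR (gam * g t) * expR (k' * (r - t))))//;
      apply/funext => r; rewrite mulrA.
  by move=> r; rewrite /= in_itv/= => /hE; rewrite mulrA.
have Ev := Eg s slohi.
set E := expR (- _) in Ev Ih; set G := expR (gam * g t) in Ev Ih *.
have E1 : E <= 1 by rewrite -expR0 ler_expR oppr_le0 mulr_ge0// ltW.
have G0 : 0 < G by exact: expR_gt0.
have h1 : `|v| <= A * (G * E) by apply: (le_trans vA); rewrite ler_wpM2l.
have h2 : B * G * ((1 - E) / k) <= A * G * (1 - E).
  rewrite mulrA ler_pdivrMr//.
  have -> : A * G * (1 - E) * k = (A * k) * (G * (1 - E)) by ring.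
  by rewrite -mulrA ler_wpM2r// mulr_ge0 ?subr_ge0// ltW.
(* Of the allowed [A * G], the starting value uses the fraction [E] and the integral the rest, since
   [B / k <= A]. *)
rewrite (_ : A * G = A * (G * E) + A * G * (1 - E)); last by ring.
exact: lerD h1 (le_trans Ih h2).
Qed.

(** The bound on [F] contains [D] itself, so [growth_step] does not apply at once. But a constant
    [A + N] for [D] yields a bound on [F], and [growth_step] improves the constant to [A + N / 2]:
    half of [gam * eps] covers [B], the other half covers [C]. *)
Lemma gronwall (lo hi gam eps A B C : R) (g D F : R -> R) :
  0 < gam -> 0 < eps -> lo <= hi ->
  (forall r r', lo <= r -> r <= r' -> r' <= hi -> g r <= g r' - eps * (r' - r)) ->
  mu.-integrable `[lo, hi] (EFin \o F) ->
  (forall r, lo <= r <= hi -> D r = D lo + \int[mu]_(s in `[lo, r]) F s) ->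
  (forall r, lo <= r <= hi -> `|F r| <= C * `|D r| + B * expR (gam * g r)) ->
  0 <= B -> 0 <= C -> 2 * B <= A * (gam * eps) -> 2 * C <= gam * eps ->
  `|D lo| <= A * expR (gam * g lo) ->
  forall r, lo <= r <= hi -> `|D r| <= A * expR (gam * g r).
Proof.
move=> gam0 eps0 lohi gmono iF DF FB B0 C0 BA Ck Dlo.
have k0 : 0 < gam * eps by rewrite mulr_gt0.
have A0 : 0 <= A by rewrite -(pmulr_lge0 _ k0) (le_trans _ BA)// mulr_ge0.
have iFs r : lo <= r <= hi -> mu.-integrable `[lo, r] (EFin \o F).
  move=> /andP[? ?]; apply: integrableS iF => //.
  by apply: subset_itvl; rewrite bnd_simp.
have mF r : lo <= r <= hi -> measurable_fun `[lo, r] F.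
  by move=> /iFs/measurable_int/measurable_EFinP.
pose Q (N : R) := forall r, lo <= r <= hi -> `|D r| <= (A + N) * expR (gam * g r).
(* The weight is smallest at [lo], so dividing a bound for [D] by its value there gives a first
   constant. *)
pose M := (`|D lo| + \int[mu]_(s in `[lo, hi]) `|F s|) / expR (gam * g lo).
have IF0 : 0 <= \int[mu]_(s in `[lo, hi]) `|F s| by exact: Rintegral_ge0.
have M0 : 0 <= M by rewrite divr_ge0// ?addr_ge0// expR_ge0.
have QM : Q M.
  move=> r rlh; have /andP[lr rh] := rlh.
  have h1 : `|D r| <= M * expR (gam * g lo).
    rewrite divfK ?gt_eqF ?expR_gt0// DF//; apply: (le_trans (ler_normD _ _)).
    rewrite lerD2l; apply: (le_trans (le_normr_Rintegral _ (iFs _ rlh))) => //.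
    rewrite /Rintegral fine_le//.
    - by apply: (integrable_fin_num _ (integrable_norm (iFs _ rlh))).
    - by apply: (integrable_fin_num _ (integrable_norm iF)).
    - apply: ge0_subset_integral => //.
      + by have /integrableP[] := integrable_norm iF.
      + by apply: subset_itvl; rewrite bnd_simp.
  apply: (le_trans h1); rewrite ler_pM ?expR_ge0 ?lerDr// ler_expR ler_pM2l//.
  have := gmono _ _ (lexx lo) lr rh; have := mulr_ge0 (ltW eps0) (_ : 0 <= r - lo).
  by rewrite subr_ge0 => /(_ lr); lra.
have Qhalf N : 0 <= N -> Q N -> Q (N / 2).
  move=> N0 QN r rlh; have /andP[lr rh] := rlh.
  rewrite DF//; apply: (le_trans (ler_normD _ _)).
  apply: (@growth_step lo r r lo gam eps (A + N / 2) (C * (A + N) + B)) => //.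
  - by left.
  - move=> s /andP[ls sr]; rewrite ger0_norm ?subr_ge0//; exact: gmono.
  - exact: mF.
  - move=> s /andP[ls sr].
    have slh : lo <= s <= hi by rewrite ls (le_trans sr).
    apply: (le_trans (FB _ slh)); rewrite mulrDl lerD2r -mulrA ler_wpM2l//.
    exact: QN.
  - by rewrite addr_ge0// mulr_ge0// addr_ge0.
  - have : C * (A + N) <= (gam * eps) / 2 * (A + N).
      by rewrite ler_wpM2r ?addr_ge0//; lra.
    by lra.
  - by apply: (le_trans Dlo); rewrite ler_wpM2r ?expR_ge0// lerDl divr_ge0.
move=> r rlh; apply/ler_addgt0Pr => e e0.
have [N /andP[N0 Ne] QN] := halving _ _ M0 QM Qhalf _ (divr_gt0 e0 (expR_gt0 (gam * g r))).
apply: (le_trans (QN _ rlh)); rewrite mulrDl lerD2l.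
by rewrite -ler_pdivlMr ?expR_gt0.
Qed.

End Growth.

(** * Inverse functions and primitives *)

Section Tools.
Context {R : realType}.
Notation mu := (@lebesgue_measure R).

Lemma unif_cont_compact (X : pseudoMetricType R) (K : set X) (f : X -> R) (e : R) :
  compact K -> continuous f -> 0 < e ->
  exists2 d : R, 0 < d & forall x y, K x -> ball x d y -> `|f x - f y| < e.
Proof.
move=> cK cf e0.
have /compact_near_coveringP/(_ R (0^'+) (fun d x => forall y, ball x d y ->
  `|f x - f y| < e)) := cK.
move=> /(_ _)[|d' /= d'0 Hd].
  move=> x Kx; have e20 : 0 < e / 2 by rewrite divr_gt0.
  have /cvgrPdist_lt/(_ _ e20)/nbhs_ballP[r /= r0 Hr] := cf x.
  exists (ball x (r / 2), [set d | 0 < d < r / 2]).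
    split=> /=; first by apply: nbhsx_ballx; rewrite divr_gt0.
    exists (r / 2) => /=; first by rewrite divr_gt0.
    by move=> d /=; rewrite sub0r normrN => + d0; rewrite gtr0_norm// d0.
  case=> z d /= [xz /andP[d0 dr]] y zy.
  have h1 := Hr z (le_ball _ xz).
  have xy : ball x r y.
    rewrite (splitr r); apply: ball_triangle xz _; apply: le_ball zy; exact: ltW.
  have h2 := Hr y xy.
  have {}h1 : `|f x - f z| < e / 2 by apply: h1; rewrite ler_pdivrMr// ler_peMr ?ler1n// ltW.
  rewrite (splitr e) (_ : f z - f y = (f x - f y) - (f x - f z)); last ring.
  by apply: (le_lt_trans (ler_normB _ _)); exact: ltrD.
exists (d' / 2); first by rewrite divr_gt0.
move=> x y Kx; apply: Hd => //=; last by rewrite divr_gt0.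
rewrite sub0r normrN gtr0_norm ?divr_gt0// ltr_pdivrMr// ltr_pMr//.
by rewrite ltr1n.
Qed.

(** The lower bound [c] on the slopes makes every [H y] a bijection with 1/c-Lipschitz inverse.
    Joint continuity then needs only the continuity of [H] in y at one fixed [z0], because the
    Lipschitz bound estimates G y v - z0 by v - H y z0. *)
Lemma inverse_family (T : topologicalType) (H : T -> R -> R) (c : R) : 0 < c ->
  (forall y, continuous (H y)) -> (forall z, continuous (H ^~ z)) ->
  (forall y a b, a <= b -> c * (b - a) <= H y b - H y a) ->
  exists G : T -> R -> R, [/\ forall y v, H y (G y v) = v,
    forall y z, G y (H y z) = z & continuous (fun p : T * R => G p.1 p.2)].
Proof.
move=> c0 cH cHy slope.
have ex y v : exists z, H y z = v.
  (* A radius over which [H y] moves at least as far as from [H y 0] to [v]. *)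
  pose r := `|v - H y 0| / c.
  have r0 : 0 <= r by rewrite divr_ge0// ltW.
  have cr : c * r = `|v - H y 0| by rewrite /r mulrC divfK// gt_eqF.
  have [] := @IVT R (H y) (- r) r v.
  - lra.
  - exact: continuous_subspaceT.
  - have h1 := slope y 0 r r0.
    have h2 := slope y (- r) 0 (_ : - r <= 0).
    have {}h2 := h2 ltac:(lra).
    have := ler_norm (v - H y 0); have := ler_norm (- (v - H y 0)).
    rewrite normrN => n1 n2.
    by rewrite ge_min le_max; apply/andP; split; apply/orP; [left|right]; lra.
  by move=> z _ Hz; exists z.
have [G HG] := choice (fun p : T * R => ex p.1 p.2).
have inj y a b : `|b - a| <= `|H y b - H y a| / c.
  rewrite ler_pdivlMr// mulrC; case: (leP a b) => ab.
    rewrite (ger0_norm (_ : 0 <= b - a)) ?subr_ge0//.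
    exact: le_trans (slope y _ _ ab) (ler_norm _).
  have ab' := ltW ab.
  rewrite (distrC b a) (distrC (H y b)) (ger0_norm (_ : 0 <= a - b)) ?subr_ge0//.
  exact: (le_trans (slope y b a ab') (ler_norm _)).
exists (fun y v => G (y, v)); split => [y v|y z|].
- by rewrite (HG (y, v)).
- apply/eqP; rewrite -subr_eq0 -normr_eq0 eq_le normr_ge0 andbT.
  by apply: (le_trans (inj y _ _)); rewrite (HG (y, H y z)) subrr normr0 mul0r.
- move=> [y0 v0]; apply/cvgrPdist_lt => e e0 /=.
  set z0 := G (y0, v0).
  have : (fun p : T * R => p.2 - H p.1 z0) @ (y0, v0) --> v0 - H y0 z0.
    apply: contB; first exact: cont_snd (@cont_id _).
    exact: (cont_comp _ _ _ _ _ (cHy z0) (cont_fst _ _ _ _ (@cont_id _))).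
  rewrite {2}/z0 (HG (y0, v0)) subrr => /cvgrPdist_lt/(_ (e * c)).
  move=> /(_ (mulr_gt0 e0 c0)); apply: filterS => -[y v] /=; rewrite sub0r normrN.
  move=> h; rewrite distrC; apply: (le_lt_trans (inj y _ _)).
  by rewrite ltr_pdivrMr// (HG (y, v)).
Qed.

Lemma Rintegral_cst_itv (a b c : R) : a <= b -> \int[mu]_(s in `[a, b]) c = c * (b - a).
Proof.
move=> ab; rewrite Rintegral_cst//.
have := lebesgue_measure_itv `[a, b]%R; rewrite /= => ->.
rewrite lte_fin; have [ba|ba] := ltP a b; first by rewrite -EFinB.
by have -> : b = a; [lra|rewrite subrr].
Qed.

(* A primitive of [w] on [0, 1], continued with slope [w 0] so that primitives of
   positive functions are bijections of the line. *)
Definition prim (w : R -> R) (x : R) : R :=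
  \int[mu]_(s in `[0, cl x]) w s + (x - cl x) * w 0.

Lemma cont_integrable (w : R -> R) (a b : R) : continuous w ->
  mu.-integrable `[a, b] (EFin \o w).
Proof.
move=> cw; apply: continuous_compact_integrable; first exact: segment_compact.
exact: continuous_subspaceT.
Qed.

Lemma prim0 w : prim w 0 = 0.
Proof.
by rewrite /prim cl_id ?lexx ?ler01// set_itv1 Rintegral_set1 subrr mul0r addr0.
Qed.

Lemma prim_lin (a b : R) (v w : R -> R) x : continuous v -> continuous w ->
  prim (fun s => a * v s + b * w s) x = a * prim v x + b * prim w x.
Proof.
move=> cv cw; rewrite /prim RintegralD// ?RintegralZl//; try exact: cont_integrable.
- ring.
- by apply: cont_integrable; apply: contM => //; exact: cont_cst.
- by apply: cont_integrable; apply: contM => //; exact: cont_cst.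
Qed.

Lemma Rintegral_split (w : R -> R) (a b c : R) : mu.-integrable `[a, c] (EFin \o w) ->
  a <= b -> b <= c ->
  \int[mu]_(s in `[a, c]) w s = \int[mu]_(s in `[a, b]) w s + \int[mu]_(s in `[b, c]) w s.
Proof.
move=> iw ab bc.
have := @Rintegral_itvB R w (BLeft a) (BRight c) b iw.
rewrite !bnd_simp => /(_ ab bc) /eqP; rewrite subr_eq => /eqP ->; rewrite addrC.
congr (_ + _); apply: Rintegral_itv_obnd_cbnd.
by apply: integrableS iw => //; apply: subset_itv; rewrite bnd_simp.
Qed.

Lemma prim_ge (w : R -> R) (c : R) : continuous w ->
  (forall x, 0 <= x <= 1 -> c <= w x) ->
  forall a b, a <= b -> c * (b - a) <= prim w b - prim w a.
Proof.
move=> cw wc a b ab; have [cab dab] := cl_mono _ _ ab.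
have /andP[a0 a1] := cl01 a; have /andP[b0 b1] := cl01 b.
have h1 : c * (cl b - cl a) <= \int[mu]_(s in `[cl a, cl b]) w s.
  apply: (@le_trans _ _ (\int[mu]_(s in `[cl a, cl b]) c)).
    by rewrite Rintegral_cst_itv.
  apply: le_Rintegral => //; try exact: cont_integrable.
    by apply: cont_integrable; exact: cont_cst.
  move=> x; rewrite /= in_itv/= => /andP[? ?]; apply: wc.
  by rewrite (le_trans a0)//= (le_trans _ b1).
have h2 : c * ((b - cl b) - (a - cl a)) <= w 0 * ((b - cl b) - (a - cl a)).
  by rewrite ler_wpM2r ?wc ?lexx ?ler01//; lra.
rewrite /prim (Rintegral_split w 0 (cl a) (cl b))//; last exact: cont_integrable.
have -> : c * (b - a) = c * (cl b - cl a) + c * ((b - cl b) - (a - cl a)) by ring.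
have -> : \int[mu]_(s in `[0, cl a]) w s + \int[mu]_(s in `[cl a, cl b]) w s +
   (b - cl b) * w 0 - (\int[mu]_(s in `[0, cl a]) w s + (a - cl a) * w 0) =
   \int[mu]_(s in `[cl a, cl b]) w s + w 0 * ((b - cl b) - (a - cl a)) by ring.
exact: lerD.
Qed.

Lemma prim_le (w : R -> R) (c : R) : continuous w ->
  (forall x, 0 <= x <= 1 -> w x <= c) ->
  forall a b, a <= b -> prim w b - prim w a <= c * (b - a).
Proof.
move=> cw wc a b ab.
(* The integrand is -w, written as a combination so that [prim_lin] applies. *)
have h := @prim_ge (fun s => (-1) * w s + 0 * w s) (- c) _ _ _ _ ab.
have {}h : - c * (b - a) <= prim (fun s => (-1) * w s + 0 * w s) b -
                          prim (fun s => (-1) * w s + 0 * w s) a.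
  apply: h.
    by apply: contD; apply: contM => //; exact: cont_cst.
  by move=> x /wc; lra.
by move: h; rewrite !prim_lin//; lra.
Qed.

Lemma lipschitz_cont (f : R -> R) (M : R) :
  (forall a b, a <= b -> `|f b - f a| <= M * (b - a)) -> continuous f.
Proof.
move=> Lf x.
have {}Lf a b : `|f b - f a| <= `|M| * `|b - a|.
  case: (leP a b) => ab.
    rewrite (ger0_norm (_ : 0 <= b - a)) ?subr_ge0//.
    by apply: le_trans (Lf _ _ ab) _; rewrite ler_wpM2r ?subr_ge0// ler_norm.
  have ab' := ltW ab.
  rewrite distrC (distrC b) (ger0_norm (_ : 0 <= a - b)) ?subr_ge0//.
  by apply: le_trans (Lf _ _ ab') _; rewrite ler_wpM2r ?subr_ge0// ler_norm.
apply/cvgrPdist_lt => e e0.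
have M0 : 0 < `|M| + 1 by rewrite ltr_wpDl.
near=> y; apply: (le_lt_trans (Lf _ _)).
apply: (@le_lt_trans _ _ ((`|M| + 1) * `|x - y|)); first by rewrite ler_wpM2r// lerDl.
rewrite mulrC -ltr_pdivlMr//; near: y.
have e3 : 0 < e / (`|M| + 1) by rewrite divr_gt0.
by have /cvgrPdist_lt/(_ _ e3) := @cont_id R x.
Unshelve. all: by end_near. Qed.

Lemma prim_lip (w : R -> R) (M : R) : continuous w ->
  (forall x, 0 <= x <= 1 -> `|w x| <= M) ->
  forall a b, a <= b -> `|prim w b - prim w a| <= M * (b - a).
Proof.
move=> cw wM a b ab; rewrite ler_norml -mulNr.
rewrite prim_ge//=; last by move=> x /wM; rewrite ler_norml => /andP[].
by rewrite prim_le// => x /wM; rewrite ler_norml => /andP[].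
Qed.

Lemma itv_bounded (w : R -> R) : continuous w ->
  exists M, forall x, 0 <= x <= 1 -> `|w x| <= M.
Proof.
move=> cw.
have /(continuous_compact (continuous_subspaceT cw))/compact_bounded[M [_ HM]] :=
  @segment_compact R 0 1.
exists (M + 1) => x x01; apply: (HM (M + 1)); first by rewrite ltrDl.
by exists x => //; rewrite /= in_itv.
Qed.

Lemma prim_cont w : continuous w -> continuous (prim w).
Proof.
by move=> cw; have [M HM] := itv_bounded _ cw; apply: lipschitz_cont (prim_lip _ _ cw HM).
Qed.

Lemma prim_derive (w : R -> R) (x : R) : continuous w -> 0 < x < 1 ->
  is_derive x (1 : R) (prim w) (w x).
Proof.
move=> cw /andP[x0 x1].
have [] := @continuous_FTC1_closed R w 0 x 1 x1 (cont_integrable _ _ _ cw) x0 (cw x).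
set F := fun _ => _ => dF; rewrite derive1E => FE.
have dF' : is_derive x (1 : R) F (w x) by apply: DeriveDef.
apply: (@near_eq_is_derive _ _ _ F).
near=> z; rewrite /prim /F cl_id ?subrr ?mul0r ?addr0//.
apply/andP; split; near: z.
  by apply: filterS (lt_nbhsr x0) => ? /ltW.
by apply: filterS (lt_nbhsl x1) => ? /ltW.
Unshelve. all: by end_near. Qed.

(** Continuity in the first variable is dominated convergence; in the second there is a Lipschitz
    bound [B] uniform in the first, and the two together give joint continuity. *)
Lemma prim_family (W : R -> R -> R) (B : R) :
  continuous (fun p : R * R => W p.1 p.2) -> (forall y s, `|W y s| <= B) ->
  continuous (fun p : R * R => prim (W p.1) p.2).
Proof.
move=> cW WB.
have cWy y : continuous (W y).
  exact: (cont_comp _ _ _ _ _ cW (cont_pair _ _ _ _ _ (@cont_cst _ _ y) (@cont_id _))).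
have cWs s : continuous (W ^~ s).
  exact: (cont_comp _ _ _ _ _ cW (cont_pair _ _ _ _ _ (@cont_id _) (@cont_cst _ _ s))).
have cy x : continuous (fun y => prim (W y) x).
  apply: contD; last by apply: contM; [exact: cont_cst|exact: cWs].
  move=> y0; apply: (@cvg_dominated _ _ W 0 (cl x) B set0).
  - by move=> y; apply: measurable_funTS; exact: continuous_measurable_fun.
  - by move=> *; exact: WB.
  - exact: negligible_set0.
  - by move=> s _ _; exact: cWs.
move=> [y0 x0]; apply/cvgrPdist_lt => e e0 /=.
have B0 : 0 <= B := le_trans (normr_ge0 _) (WB 0 0).
have B1 : 0 < B + 1 by rewrite ltr_wpDl.
have e20 : 0 < e / 2 by rewrite divr_gt0.
near=> p.
have -> : prim (W y0) x0 - prim (W p.1) p.2 =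
  (prim (W y0) x0 - prim (W p.1) x0) + (prim (W p.1) x0 - prim (W p.1) p.2) by ring.
rewrite (splitr e); apply: (le_lt_trans (ler_normD _ _)); apply: ltrD.
  near: p; have /cvgrPdist_lt/(_ _ e20) :=
    cont_comp _ _ _ _ _ (cy x0) (cont_fst _ _ _ _ (@cont_id _)) (y0, x0).
  by [].
have L a b : `|prim (W p.1) b - prim (W p.1) a| <= B * `|b - a|.
  case: (leP a b) => ab.
    by rewrite (ger0_norm (_ : 0 <= b - a)) ?subr_ge0//; apply: prim_lip.
  have ab' := ltW ab.
  rewrite distrC (distrC b) (ger0_norm (_ : 0 <= a - b)) ?subr_ge0//.
  exact: prim_lip.
apply: (le_lt_trans (L _ _)); apply: (@le_lt_trans _ _ ((B + 1) * `|x0 - p.2|)).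
  by rewrite ler_wpM2r// lerDl.
rewrite mulrC -ltr_pdivlMr//; near: p.
have e3 : 0 < e / 2 / (B + 1) by rewrite divr_gt0.
by have /cvgrPdist_lt/(_ _ e3) := cont_snd _ _ _ _ (@cont_id _) (y0, x0).
Unshelve. all: by end_near. Qed.

End Tools.

(** * Fixed points in a weighted norm *)

Section WeightedBanach.
Context {R : realType} (U : Type) (Cl : (U -> R) -> Prop) (w : U -> R)
  (Phi : (U -> R) -> U -> R).
Hypothesis w0 : forall x, 0 < w x.
Hypothesis wW : exists W, forall x, w x <= W.
Hypothesis Cl0 : Cl (fun=> 0).
Hypothesis ClPhi : forall u, Cl u -> Cl (Phi u).
Hypothesis Cllim : forall (un : nat -> U -> R) u, (forall n, Cl (un n)) ->
  (forall e : R, 0 < e -> exists n, forall x, `|un n x - u x| <= e) -> Cl u.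
Hypothesis contr : forall u v (M : R), 0 <= M -> Cl u -> Cl v ->
  (forall x, `|u x - v x| <= M * w x) ->
  forall x, `|Phi u x - Phi v x| <= M / 2 * w x.

(** Banach's iteration from 0, with the limit taken pointwise on the line instead of in a complete
    function space. The errors are geometric relative to [w]; as [w] is bounded they are uniformly
    small, so [Cl] passes to the limit. *)
Lemma weighted_fixpoint (M0 : R) : (forall x, `|Phi (fun=> 0) x| <= M0 * w x) ->
  exists2 u, Cl u & forall x, Phi u x = u x.
Proof.
move=> PM0.
have [[x0]|noU] := pselect (inhabited U); last first.
  by exists (fun=> 0) => // x; case: noU.
have M00 : 0 <= M0.
  by rewrite -(pmulr_lge0 _ (w0 x0)); exact: le_trans (PM0 x0).
pose un n := iter n Phi (fun=> 0).
have Cun n : Cl (un n) by elim: n => //= n; exact: ClPhi.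
have pow0 n : 0 < 2 ^+ n :> R by rewrite exprn_gt0.
have dn n x : `|un n.+1 x - un n x| <= M0 / 2 ^+ n * w x.
  elim: n x => [|n IH] x; first by rewrite /un/= subr0 expr0 divr1.
  rewrite exprSr invfM mulrA.
  by apply: (contr (un n.+1) (un n)) => //; rewrite divr_ge0// ltW.
pose c x := 2 * M0 * w x.
have c0 : forall y, 0 <= c y.
  move=> y; rewrite /c mulr_ge0 ?mulr_ge0//; exact: ltW.
(* The increment at step n is at most half of the margin [c x / 2 ^+ n]; hence [a] increases, [b]
   decreases, and the supremum of [a] is the limit. *)
pose a n x := un n x - c x / 2 ^+ n.
pose b n x := un n x + c x / 2 ^+ n.
have cS : forall n x, c x / 2 ^+ n.+1 = M0 / 2 ^+ n * w x.
  by move=> n x; rewrite /c exprS; field; rewrite gt_eqF.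
have c2 : forall n x, c x / 2 ^+ n = 2 * (c x / 2 ^+ n.+1).
  by move=> n x; rewrite exprS; field; rewrite gt_eqF.
have a_nd x n k : a n x <= a (n + k)%N x.
  elim: k => [|k IH]; first by rewrite addn0.
  apply: (le_trans IH); rewrite addnS /a; have := dn (n + k)%N x.
  by rewrite (c2 (n + k)%N) cS ler_norml => /andP[]; lra.
have b_ni x n k : b (n + k)%N x <= b n x.
  elim: k => [|k IH]; first by rewrite addn0.
  apply: le_trans IH; rewrite addnS /b; have := dn (n + k)%N x.
  by rewrite (c2 (n + k)%N) cS ler_norml => /andP[]; lra.
have ab x n m : a n x <= b m x.
  apply: (le_trans (a_nd x n m)); apply: le_trans (b_ni x m n).
  by rewrite addnC /a /b; have := divr_ge0 (c0 x) (ltW (pow0 (m + n)%N)); lra.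
pose u x := sup (range (a ^~ x)).
have hs x : has_sup (range (a ^~ x)).
  by split; [exists (a 0%N x); exists 0%N|exists (b 0%N x) => _ [n _ <-]].
have uun n x : `|u x - un n x| <= c x / 2 ^+ n.
  have h1 : a n x <= u x by apply: sup_ubound; [case: (hs x)|exists n].
  have h2 : u x <= b n x.
    by apply: ge_sup; [case: (hs x)|move=> _ [k _ <-]].
  by rewrite /a /b in h1 h2; rewrite ler_norml; apply/andP; split; lra.
have [W HW] := wW.
have W0 : 0 <= W := le_trans (ltW (w0 x0)) (HW x0).
have uunif e : 0 < e -> exists n, forall x, `|un n x - u x| <= e.
  move=> e0; have B0 : 0 <= 2 * M0 * W by rewrite !mulr_ge0.
  exists (Num.bound (2 * M0 * W / e)) => x; set n := Num.bound _.
  rewrite distrC; apply: (le_trans (uun n x)).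
  rewrite ler_pdivrMr//; apply: (@le_trans _ _ (2 * M0 * W)).
    by rewrite /c ler_wpM2l// mulr_ge0.
  rewrite [e * _]mulrC -ler_pdivrMr//.
  have /ltW/le_trans := archi_boundP (divr_ge0 B0 (ltW e0)); apply.
  by rewrite -natrX ler_nat ltnW// ltn_expl.
have Cu : Cl u by apply: (Cllim un).
exists u => // x; apply/eqP; rewrite -subr_eq0 -normr_eq0 eq_le normr_ge0 andbT.
apply/ler_addgt0Pr => e e0; rewrite add0r.
have c4 : 0 < e / (2 * c x + 1).
  by rewrite divr_gt0// ltr_wpDl// mulr_ge0.
pose n := Num.bound (2 * c x / e).
have h1 : `|Phi u x - un n.+1 x| <= 2 * M0 / 2 ^+ n / 2 * w x.
  apply: (contr u (un n)) => //; first by rewrite divr_ge0 ?mulr_ge0// ltW.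
  by move=> y; apply: (le_trans (uun n y)); rewrite /c; lra.
have h2 := uun n.+1 x.
have h3 : 2 * c x / 2 ^+ n <= e.
  rewrite ler_pdivrMr// [e * _]mulrC -ler_pdivrMr//.
  have B0 : 0 <= 2 * c x by rewrite mulr_ge0.
  have /ltW/le_trans := archi_boundP (divr_ge0 B0 (ltW e0)); apply.
  by rewrite -natrX ler_nat ltnW// ltn_expl.
rewrite (_ : Phi u x - u x = (Phi u x - un n.+1 x) - (u x - un n.+1 x)); last ring.
apply: (le_trans (ler_normB _ _)); apply: le_trans h3.
have h4 : 0 <= c x / 2 ^+ n by rewrite divr_ge0// ltW.
rewrite (_ : 2 * M0 / 2 ^+ n / 2 * w x = c x / 2 ^+ n / 2) in h1; last first.
  by rewrite /c; field; rewrite gt_eqF.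
have := c2 n x; move: h1 h2 h4.
rewrite -!mulrA; lra.
Qed.

(** From a constant [2 * eta + N] the contraction gives half of it for [Phi u - v], and [Phi u - u]
    adds [eta]: together [2 * eta + N / 2]. So the excess [N] halves. Later [u] is the fixed point
    for another averaging, hence only an approximate one for [Phi]. *)
Lemma fixpoint_stability (u v : U -> R) (eta M0 : R) : Cl u -> Cl v ->
  (forall x, Phi v x = v x) -> 0 <= eta ->
  (forall x, `|Phi u x - u x| <= eta * w x) ->
  0 <= M0 -> (forall x, `|u x - v x| <= M0 * w x) ->
  forall x, `|u x - v x| <= 2 * eta * w x.
Proof.
move=> Cu Cv Pv eta0 Pu M00 uv x.
apply/ler_addgt0Pr => e e0.
have [N /andP[N0 Ne] QN] := @halving _
  (fun N => forall x, `|u x - v x| <= (2 * eta + N) * w x) M0 M00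
  (fun x => ltac:(abstract (by apply: (le_trans (uv x));
    rewrite ler_wpM2r ?(ltW (w0 _))// lerDr mulr_ge0)))
  (fun N N0 QN x => ltac:(abstract (
    have h := contr u v _ (addr_ge0 (mulr_ge0 (ler0n _ 2) eta0) N0) Cu Cv QN x;
    have h' := Pu x; rewrite Pv in h;
    rewrite (_ : u x - v x = (Phi u x - v x) - (Phi u x - u x)); [|ring];
    apply: (le_trans (ler_normB _ _)); apply: le_trans (lerD h h') _;
    by rewrite -mulrDl ler_wpM2r ?(ltW (w0 _))//; lra)))
  (e / w x) (divr_gt0 e0 (w0 x)).
apply: (le_trans (QN x)); rewrite mulrDl lerD2l.
by rewrite -ler_pdivlMr.
Qed.

End WeightedBanach.

(** * Averages over the ensemble variable *)

Section AveragingFunctional.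
Context {R : realType}.
Notation mu := (@lebesgue_measure R).

Definition avg (nu : R -> R) (f : R -> R) : R := \int[mu]_(s in `[0, 1]) f (nu s).

(** Where [a] and [b] differ, the test is locally constant. *)
Lemma cvg_if_le (T : topologicalType) (a b f g : T -> R) (z0 : T) :
  a z @[z --> z0] --> a z0 -> b z @[z --> z0] --> b z0 ->
  f z @[z --> z0] --> f z0 -> g z @[z --> z0] --> g z0 -> a z0 != b z0 ->
  (if a z <= b z then f z else g z) @[z --> z0] -->
    (if a z0 <= b z0 then f z0 else g z0).
Proof.
move=> ca cb cf cg ab.
have cab : (b z - a z) @[z --> z0] --> b z0 - a z0 by exact: cvgB.
have [h|h] := leP (a z0) (b z0).
  have p0 : 0 < b z0 - a z0 by rewrite subr_gt0 lt_neqAle ab.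
  apply: cvg_trans cf; apply: near_eq_cvg; near=> z.
  rewrite ifT//; rewrite -subr_ge0; near: z.
  have /cvgrPdist_lt/(_ _ p0) := cab.
  by apply: filterS => z /=; rewrite ltr_norml => /andP[_]; lra.
have p0 : 0 < a z0 - b z0 by rewrite subr_gt0.
apply: cvg_trans cg; apply: near_eq_cvg; near=> z.
rewrite ifF//; apply/negbTE; rewrite -ltNge -subr_lt0; near: z.
have /cvgrPdist_lt/(_ _ p0) := cab.
by apply: filterS => z /=; rewrite ltr_norml => /andP[+ _]; lra.
Unshelve. all: by end_near. Qed.

(** Serves for the jump curves, each of which a transversal characteristic meets at no more than one
    instant. *)
Lemma subsingleton_negligible (N : set R) :
  (forall x y, N x -> N y -> x = y) -> mu.-negligible N.
Proof.
move=> H; have [[x Nx]|N0] := pselect (exists x, N x).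
  have h : mu.-negligible [set x] by exists [set x]; split => //; exact: lebesgue_measure_set1.
  by apply: negligibleS h => y Ny; exact: H.
have h : mu.-negligible set0 by exact: negligible_set0.
by apply: negligibleS h => y Ny; exfalso; apply: N0; exists y.
Qed.

Lemma avg_le (nu : R -> R) (f : R -> R) (B : R) : measurable_fun setT nu ->
  (forall s, 0 <= nu s <= 1) -> continuous f ->
  (forall s, 0 <= s <= 1 -> `|f s| <= B) -> `|avg nu f| <= B.
Proof.
move=> mnu nu01 cf fB; rewrite /avg.
have := @Rintegral_bound R 0 1 B (f \o nu) ler01 _ _.
rewrite subr0 mulr1; apply.
  apply: measurable_funTS; apply: measurableT_comp => //.
  exact: continuous_measurable_fun.
by move=> s _; exact: fB.
Qed.

Lemma avg_integrable (nu : R -> R) (f : R -> R) : measurable_fun setT nu ->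
  (forall s, 0 <= nu s <= 1) -> continuous f ->
  mu.-integrable `[0, 1] (EFin \o (f \o nu)).
Proof.
move=> mnu nu01 cf; have [B HB] := itv_bounded _ cf.
apply: (@bounded_integrable _ 0 1 B).
  apply: measurable_funTS; apply: measurableT_comp => //.
  exact: continuous_measurable_fun.
by move=> s _; exact: HB.
Qed.

Lemma avgB (nu : R -> R) (f g : R -> R) : measurable_fun setT nu ->
  (forall s, 0 <= nu s <= 1) -> continuous f -> continuous g ->
  avg nu f - avg nu g = avg nu (fun s => f s - g s).
Proof.
by move=> mnu nu01 cf cg; rewrite /avg -RintegralB//; exact: avg_integrable.
Qed.

Lemma avg_cont (T : pseudoMetricType R) (nu : R -> R) (G : T * R -> R) (B : R) :
  measurable_fun setT nu -> continuous G -> (forall p, `|G p| <= B) ->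
  continuous (fun z => avg nu (fun s => G (z, s))).
Proof.
move=> mnu cG GB z0.
apply: (@cvg_dominated R T (fun z s => G (z, nu s)) 0 1 B set0).
- move=> z; apply: measurable_funTS;
  apply: (@measurableT_comp _ _ _ _ _ _ (fun s => G (z, s))) => //.
  apply: continuous_measurable_fun; apply: (cont_comp _ _ _ _ _ cG).
  by apply: cont_pair; [exact: cont_cst|exact: cont_id].
- by move=> *; exact: GB.
- exact: negligible_set0.
- move=> s _ _; apply: (cont_comp _ _ _ _ _ cG).
  by apply: cont_pair; [exact: cont_id|exact: cont_cst].
Qed.

End AveragingFunctional.

(** * Systems of integral equations along characteristics *)

Section CharacteristicSystems.
Context {R : realType} {m : nat}.

(* [None] indexes the kernel K; [Some (j, true)] and [Some (j, false)] index the
   two continuous branches of L_j, below and above the curve across which L_j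
   may jump. *)
Definition channel := option ('I_m * bool).

(* Points are triples (t, xi, y), where t = phi_i x is the travel time of channel
   i. On the characteristic of channel q through such a point, [invar] is
   constant, [flow q (c, y, r)] is the position xi at time r, and data are
   prescribed at time [start q (c, y)]: before t if [forward q], after t
   otherwise; they contain an integral of the kernel K at xi = 0 if [bottom q].
   [front l xi <= t] is the region of the lower branch of L_l. The quantity
   t - slant * xi decreases at speed [rate] on the way from a point to the start
   of its characteristic. *)
Record characteristics := Characteristics {
  dom : channel -> R * R * R -> Prop;
  proj : channel -> R * R * R -> R * R * R;
  invar : channel -> R * R * R -> R;
  flow : channel -> R * R * R -> R;
  start : channel -> R * R -> R;
  forward : channel -> bool;
  bottom : channel -> bool;
  front : 'I_m -> R -> R;
  horizon : R;
  slant : R;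
  rate : R
}.

Definition between (a b r : R) : Prop := a <= r <= b \/ b <= r <= a.

(** The L-components do not depend on y and are read at y = 0, whence [dom_lower] and [dom_upper].
    In a [bottom] channel the invariant is minus the time at which the characteristic meets xi = 0;
    [bottom_rate] says that t - slant * xi does not grow on passing from its start to the points of
    K that supply the data. *)
Record char_axioms (G : characteristics) : Prop := CharAxioms {
  proj_dom : forall q z, dom G q (proj G q z);
  proj_id : forall q z, dom G q z -> proj G q z = z;
  proj_cont : forall q, continuous (proj G q);
  invar_cont : forall q, continuous (invar G q);
  flow_cont : forall q, continuous (flow G q);
  start_cont : forall q, continuous (start G q);
  front_cont : forall l, continuous (front G l);
  slant_ge0 : 0 <= slant G;
  rate_gt0 : 0 < rate G;
  dom_bounds : forall q t xi y, dom G q (t, xi, y) ->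
    [/\ 0 <= t <= horizon G, 0 <= xi <= 1 & 0 <= y <= 1];
  dom_None : forall q t xi y eta, dom G q (t, xi, y) -> 0 <= eta <= 1 ->
    dom G None (t, xi, eta);
  dom_lower : forall q l t xi y, dom G q (t, xi, y) -> front G l xi <= t ->
    dom G (Some (l, true)) (t, xi, 0);
  dom_upper : forall q l t xi y, dom G q (t, xi, y) -> t < front G l xi ->
    dom G (Some (l, false)) (t, xi, 0);
  flow_invar : forall q t xi y, dom G q (t, xi, y) ->
    flow G q (invar G q (t, xi, y), y, t) = xi;
  start_bounds : forall q t xi y, dom G q (t, xi, y) ->
    0 <= start G q (invar G q (t, xi, y), y) <= horizon G;
  start_side : forall q t xi y, dom G q (t, xi, y) ->
    if forward G q then start G q (invar G q (t, xi, y), y) <= t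
    else t <= start G q (invar G q (t, xi, y), y);
  flow_dom : forall q t xi y r, dom G q (t, xi, y) ->
    between (start G q (invar G q (t, xi, y), y)) t r ->
    dom G q (r, flow G q (invar G q (t, xi, y), y, r), y) /\
    invar G q (r, flow G q (invar G q (t, xi, y), y, r), y) = invar G q (t, xi, y);
  flow_rate : forall q t xi y r, dom G q (t, xi, y) ->
    between (start G q (invar G q (t, xi, y), y)) t r ->
    r - slant G * flow G q (invar G q (t, xi, y), y, r) <=
    t - slant G * xi - rate G * `|t - r|;
  bottom_None : bottom G None = false;
  bottom_dom : forall q t xi y eta, bottom G q -> dom G q (t, xi, y) ->
    0 <= eta <= 1 -> dom G None (- invar G q (t, xi, y), 0, eta);
  bottom_rate : forall q t xi y, bottom G q -> dom G q (t, xi, y) ->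
    let c := invar G q (t, xi, y) in
    - c <= start G q (c, y) - slant G * flow G q (c, y, start G q (c, y))
}.

(** In the source of channel q, [cZ] multiplies the component itself, [cA] the components L_l, and
    [cS] is averaged against K. The initial value is [cb] plus, in a [bottom] channel, the average
    of K against [cB]. *)
Record coefficients := Coefficients {
  cZ : channel -> R * R -> R;
  cA : channel -> 'I_m -> R * R -> R;
  cS : channel -> R * R * R -> R;
  cB : channel -> R -> R;
  cb : channel -> R * R -> R
}.

(** By [transversal], either channel q does not see L_l or its characteristics meet the jump curve
    of L_l at most once; a source then has finitely many discontinuities along a characteristic. *)
Record coef_axioms (G : characteristics)
    (C : coefficients) (M : R) : Prop := CoefAxioms {
  cZ_cont : forall q, continuous (cZ C q);
  cA_cont : forall q l, continuous (cA C q l);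
  cS_cont : forall q, continuous (cS C q);
  cB_cont : forall q, continuous (cB C q);
  cb_cont : forall q, continuous (cb C q);
  cZ_le : forall q p, `|cZ C q p| <= M;
  cA_le : forall q l p, `|cA C q l p| <= M;
  cS_le : forall q p, `|cS C q p| <= M;
  cB_le : forall q p, `|cB C q p| <= M;
  cb_le : forall q p, `|cb C q p| <= M;
  transversal : forall q l, (forall p, cA C q l p = 0) \/
    (forall c y r r', front G l (flow G q (c, y, r)) - r =
                      front G l (flow G q (c, y, r')) - r' -> r = r')
}.

End CharacteristicSystems.

Section System.
Context {R : realType} {m : nat} (G : @characteristics R m) (C : @coefficients R m) (M : R).
Hypothesis GA : char_axioms G.
Hypothesis CA : coef_axioms G C M.
Variable nu : R -> R.
Hypothesis mnu : measurable_fun setT nu.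
Hypothesis nu01 : forall s, 0 <= nu s <= 1.
Notation mu := (@lebesgue_measure R).
Notation state := (@channel m * (R * R * R) -> R).

Definition branch (u : state) (l : 'I_m) (t xi : R) : R :=
  if front G l xi <= t then u (Some (l, true), (t, xi, 0))
  else u (Some (l, false), (t, xi, 0)).

Definition source (u : state) (q : @channel m) (t xi y : R) : R :=
  cZ C q (xi, y) * u (q, (t, xi, y)) +
  \sum_(l < m) branch u l t xi * cA C q l (xi, y) +
  avg nu (fun eta => u (None, (t, xi, eta)) * cS C q (xi, eta, y)).

Definition initial (u : state) (q : @channel m) (c y : R) : R :=
  cb C q (c, y) + (if bottom G q then
    avg nu (fun eta => u (None, (- c, 0, eta)) * cB C q eta) else 0).

Definition path_left q c y t := if forward G q then start G q (c, y) else t.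
Definition path_right q c y t := if forward G q then t else start G q (c, y).

Definition along (u : state) q c y (r : R) := source u q r (flow G q (c, y, r)) y.

(** The integral runs over an interval without orientation; the sign accounts for data prescribed
    after [t]. *)
Definition transported (u : state) (q : @channel m) (t xi y : R) : R :=
  let c := invar G q (t, xi, y) in
  initial u q c y + (-1) ^+ (~~ forward G q) *
    \int[mu]_(r in `[path_left q c y t, path_right q c y t]) along u q c y r.

(** With the retraction [proj] the result is a function on the whole space, continuous there and
    determined by its values on the domain. *)
Definition evolve (u : state) (qz : @channel m * (R * R * R)) : R :=
  let z := proj G qz.1 qz.2 in transported u qz.1 z.1.1 z.1.2 z.2.

Definition regular (u : state) : Prop :=
  [/\ forall q, continuous (fun z => u (q, z)),
      exists B, forall x, `|u x| <= B &
      forall q z, u (q, z) = u (q, proj G q z)].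

Lemma M_ge0 : 0 <= M. Proof. exact: le_trans (normr_ge0 _) (cZ_le _ _ _ CA None (0, 0)). Qed.

Lemma avg_source_cont (u : state) q : regular u ->
  continuous (fun z : R * R * R => avg nu (fun eta =>
    u (None, (z.1.1, z.1.2, eta)) * cS C q (z.1.2, eta, z.2))).
Proof.
move=> [cu [B uB] _].
apply: (@avg_cont _ (R * R * R)%type nu (fun p => u (None, (p.1.1.1, p.1.1.2, p.2)) *
  cS C q (p.1.1.2, p.2, p.1.2)) (B * M)) => //.
  have c1 : continuous (fun p : R * R * R * R => p.1) by exact: cont_fst (@cont_id _).
  apply: contM.
    apply: (cont_comp _ _ _ (fun p : R * R * R * R => (p.1.1.1, p.1.1.2, p.2)) _ (cu None)).
    apply: cont_pair; last exact: cont_snd (@cont_id _).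
    by apply: cont_pair; [exact: cont_fst (cont_fst _ _ _ _ c1)|exact: cont_snd (cont_fst _ _ _
      _ c1)].
  apply: (cont_comp _ _ _ (fun p : R * R * R * R => (p.1.1.2, p.2, p.1.2)) _ (cS_cont _ _ _ CA q)).
  apply: cont_pair; last exact: cont_snd c1.
  by apply: cont_pair; [exact: cont_snd (cont_fst _ _ _ _ c1)|exact: cont_snd (@cont_id _)].
by move=> p; rewrite normrM ler_pM//; exact: cS_le _ _ _ CA _ _.
Qed.

(** The constant [m.+2] counts the own term, the m couplings and the average. *)
Lemma source_le (u : state) B q t xi y : regular u -> (forall x, `|u x| <= B) ->
  `|source u q t xi y| <= (m.+2)%:R * (M * B).
Proof.
move=> [cu _ _] uB; rewrite /source.
have B0 : 0 <= B := le_trans (normr_ge0 _) (uB (None, (0, 0, 0))).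
have M0 := M_ge0.
have h1 : `|cZ C q (xi, y) * u (q, (t, xi, y))| <= M * B.
  by rewrite normrM ler_pM//; exact: cZ_le _ _ _ CA _ _.
have h2 : `|\sum_(l < m) branch u l t xi * cA C q l (xi, y)| <= m%:R * (M * B).
  apply: (le_trans (ler_norm_sum _ _ _)).
  rewrite (_ : m%:R * (M * B) = \sum_(l < m) M * B); last first.
    by rewrite sumr_const card_ord mulr_natl.
  apply: ler_sum => l _; rewrite normrM mulrC ler_pM//; first exact: cA_le _ _ _ CA _ _ _.
  by rewrite /branch; case: ifP.
have h3 : `|avg nu (fun eta => u (None, (t, xi, eta)) * cS C q (xi, eta, y))| <= M * B.
  apply: avg_le => //.
    apply: contM.
      apply: (cont_comp _ _ _ (fun s => (t, xi, s)) _ (cu None)).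
      by apply: cont_pair; [exact: cont_cst|exact: cont_id].
    apply: (cont_comp _ _ _ (fun s => (xi, s, y)) _ (cS_cont _ _ _ CA q)).
    apply: cont_pair; last exact: cont_cst.
    by apply: cont_pair; [exact: cont_cst|exact: cont_id].
  by move=> s _; rewrite normrM mulrC ler_pM//; exact: cS_le _ _ _ CA _ _.
apply: (le_trans (ler_normD _ _)); apply: (@le_trans _ _ (M * B + m%:R * (M * B) + M * B)).
  by rewrite lerD// (le_trans (ler_normD _ _))// lerD.
by rewrite -addn2 natrD; lra.
Qed.

Lemma path_cont q : continuous (fun p : R * R * R => (p.2, flow G q p, p.1.2)).
Proof.
apply: cont_pair; last exact: cont_snd (cont_fst _ _ _ _ (@cont_id _)).
by apply: cont_pair; [exact: cont_snd (@cont_id _)|exact: flow_cont _ GA q].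
Qed.

Lemma branch_pt_cont (u : state) q (b : bool) l : regular u ->
  continuous (fun p : R * R * R => u (Some (l, b), (p.2, flow G q p, 0))).
Proof.
move=> [cu _ _]; apply: (cont_comp _ _ _ _ _ (cu _)).
apply: cont_pair; last exact: cont_cst.
by apply: cont_pair; [exact: cont_snd (@cont_id _)|exact: flow_cont _ GA q].
Qed.

Lemma measurable_along (u : state) q c y : regular u ->
  measurable_fun setT (along u q c y).
Proof.
move=> ru; have [cu _ _] := ru.
have cp : continuous (fun r : R => (c, y, r)).
  by apply: cont_pair; [exact: cont_cst|exact: cont_id].
have cfl : continuous (fun r : R => flow G q (c, y, r)).
  exact: cont_comp (flow_cont _ GA q) cp.
have cxy : continuous (fun r : R => (flow G q (c, y, r), y)).
  by apply: cont_pair => //; exact: cont_cst.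
apply: measurable_funD; first apply: measurable_funD.
- apply: continuous_measurable_fun; apply: contM.
    exact: cont_comp (cZ_cont _ _ _ CA q) cxy.
  exact: cont_comp (cu q) (cont_comp _ _ _ _ _ (path_cont q) cp).
- apply: measurable_sum => l; apply: measurable_funM; last first.
    apply: continuous_measurable_fun.
    exact: cont_comp (cA_cont _ _ _ CA q l) cxy.
  apply: measurable_fun_ifT.
  + apply: measurable_fun_ler; apply: continuous_measurable_fun; last exact: cont_id.
    exact: cont_comp (front_cont _ GA l) cfl.
  + apply: continuous_measurable_fun.
    exact: cont_comp (branch_pt_cont u q true l ru) cp.
  + apply: continuous_measurable_fun.
    exact: cont_comp (branch_pt_cont u q false l ru) cp.
- apply: continuous_measurable_fun.
  exact: cont_comp (avg_source_cont u q ru) (cont_comp _ _ _ _ _ (path_cont q) cp).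
Qed.

Lemma integrable_along (u : state) q c y a b : regular u ->
  mu.-integrable `[a, b] (EFin \o along u q c y).
Proof.
move=> ru; have [_ [B uB] _] := ru.
apply: (@bounded_integrable _ _ _ (m.+2%:R * (M * B))).
  by apply: measurable_funTS; exact: measurable_along.
by move=> r _; exact: source_le.
Qed.

(** At a fixed time the integrand depends continuously on the characteristic, unless that
    characteristic is just then on a jump curve it is coupled to. *)
Lemma along_cvg (u : state) q (p0 : R * R) (r : R) : regular u ->
  (forall l, (forall p, cA C q l p = 0) \/ front G l (flow G q (p0.1, p0.2, r)) != r) ->
  along u q p.1 p.2 r @[p --> p0] --> along u q p0.1 p0.2 r.
Proof.
move=> ru trv; have [cu _ _] := ru.
have cp : continuous (fun p : R * R => (p.1, p.2, r)).
  apply: cont_pair; last exact: cont_cst.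
  by apply: cont_pair; [exact: cont_fst (@cont_id _)|exact: cont_snd (@cont_id _)].
have cfl : continuous (fun p : R * R => flow G q (p.1, p.2, r)).
  exact: cont_comp (flow_cont _ GA q) cp.
have cxy : continuous (fun p : R * R => (flow G q (p.1, p.2, r), p.2)).
  by apply: cont_pair => //; exact: cont_snd (@cont_id _).
apply: cvgD; first apply: cvgD.
- apply: cvgM.
    exact: (cont_comp _ _ _ _ _ (cZ_cont _ _ _ CA q) cxy).
  exact: (cont_comp _ _ _ _ _ (cu q) (cont_comp _ _ _ _ _ (path_cont q) cp)).
- apply: (@cvg_big _ _ +%R) => [|l _]; first exact: add_continuous.
  have [A0|fr] := trv l.
    rewrite A0 mulr0 (_ : (fun _ => _) = (fun=> 0)); first exact: cvg_cst.
    by apply/funext => p; rewrite A0 mulr0.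
  apply: cvgM; last exact: (cont_comp _ _ _ _ _ (cA_cont _ _ _ CA q l) cxy).
  apply: (@cvg_if_le _ _ (fun p : R * R => front G l (flow G q (p.1, p.2, r)))
    (fun=> r) (fun p => u (Some (l, true), (r, flow G q (p.1, p.2, r), 0)))
    (fun p => u (Some (l, false), (r, flow G q (p.1, p.2, r), 0)))).
  + exact: (cont_comp _ _ _ _ _ (front_cont _ GA l) cfl).
  + exact: cvg_cst.
  + exact: (cont_comp _ _ _ _ _ (branch_pt_cont u q true l ru) cp).
  + exact: (cont_comp _ _ _ _ _ (branch_pt_cont u q false l ru) cp).
  + exact: fr.
- exact: (cont_comp _ _ _ _ _ (avg_source_cont u q ru) (cont_comp _ _ _ _ _ (path_cont q) cp)).
Qed.

End System.

Section Evolution.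
Context {R : realType} {m : nat} (G : @characteristics R m) (C : @coefficients R m) (M : R).
Hypothesis GA : char_axioms G.
Hypothesis CA : coef_axioms G C M.
Notation mu := (@lebesgue_measure R).
Notation state := (@channel m * (R * R * R) -> R).
Notation Regular := (regular G).

(** With the moving end points put into the integrand, dominated convergence applies on a fixed
    interval. *)
Lemma Rintegral_cut (h : R -> R) (a b T : R) : 0 <= a -> b <= T ->
  \int[mu]_(r in `[a, b]) h r =
  \int[mu]_(r in `[0, T]) (if a <= r then if r <= b then h r else 0 else 0).
Proof.
move=> a0 bT; rewrite Rintegral_mkcond [RHS]Rintegral_mkcond; congr fine.
apply: eq_integral => r _; congr EFin; rewrite !patchE.
rewrite !mem_setE !in_itv/=.
case: (leP a r) => ar; last by case: ifP.
case: (leP r b) => rb; last by case: ifP.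
by rewrite (le_trans a0 ar) (le_trans rb bT).
Qed.

Section FixedAveraging.
Variable nu : R -> R.
Hypothesis mnu : measurable_fun setT nu.
Hypothesis nu01 : forall s, 0 <= nu s <= 1.

Notation Along := (along G C nu).
Notation Evolve := (evolve G C nu).
Notation Source := (source G C nu).
Notation Initial := (initial G C nu).
Notation Transported := (transported G C nu).

Lemma path_sides q t xi y : dom G q (t, xi, y) ->
  let c := invar G q (t, xi, y) in
  [/\ 0 <= path_left G q c y t, path_left G q c y t <= path_right G q c y t &
      path_right G q c y t <= horizon G].
Proof.
move=> Dq c; have [/andP[t0 tT] _ _] := dom_bounds _ GA _ _ _ _ Dq.
have /andP[s0 sT] := start_bounds _ GA _ _ _ _ Dq.
have := start_side _ GA _ _ _ _ Dq.
by rewrite /path_left /path_right -/c; case: ifP.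
Qed.

Lemma evolve_dom (u : state) q t xi y : dom G q (t, xi, y) ->
  Evolve u (q, (t, xi, y)) = Transported u q t xi y.
Proof. by move=> Dq; rewrite /evolve /= (proj_id _ GA _ _ Dq). Qed.

Lemma avg_bottom_cont (u : state) q : Regular u ->
  continuous (fun c : R => avg nu (fun eta => u (None, (- c, 0, eta)) * cB C q eta)).
Proof.
move=> [cu [B uB] _].
apply: (@avg_cont R R nu (fun p => u (None, (- p.1, 0, p.2)) * cB C q p.2) (B * M)) => //.
  apply: contM.
    apply: (cont_comp _ _ _ (fun p : R * R => (- p.1, 0, p.2)) _ (cu None)).
    apply: cont_pair; last exact: cont_snd (@cont_id _).
    by apply: cont_pair; [apply: contN; exact: cont_fst (@cont_id _)|exact: cont_cst].
  exact: (cont_comp _ _ _ _ _ (cB_cont _ _ _ CA q) (cont_snd _ _ _ _ (@cont_id _))).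
by move=> p; rewrite normrM ler_pM//; exact: cB_le _ _ _ CA _ _.
Qed.

(** Continuity of the path integral is dominated convergence: the integrand converges except at the
    two end points of the limiting path and at its meetings with the jump curves, at most one for
    each. *)
Lemma evolve_regular (u : state) : Regular u -> Regular (Evolve u).
Proof.
move=> ru; have [cu [B uB] pu] := ru.
have B0 : 0 <= B := le_trans (normr_ge0 _) (uB (None, (0, 0, 0))).
have M0 : 0 <= M := M_ge0 _ _ _ CA.
split.
- move=> q.
  pose z' z := proj G q z.
  have cz' : continuous z' := proj_cont _ GA q.
  have Dz z : dom G q (z' z) := proj_dom _ GA q z.
  pose c z := invar G q (z' z); pose y z := (z' z).2; pose t z := (z' z).1.1.
  have cc : continuous c := cont_comp _ _ _ _ _ (invar_cont _ GA q) cz'.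
  have cy : continuous y := cont_snd _ _ _ _ cz'.
  have ct : continuous t := cont_fst _ _ _ _ (cont_fst _ _ _ _ cz').
  have Dz3 z : dom G q (t z, (z' z).1.2, y z).
    by have := Dz z; rewrite /t /y; case: (z' z) => -[].
  have cE z : invar G q (t z, (z' z).1.2, y z) = c z.
    by rewrite /c /t /y; case: (z' z) => -[].
  have ccy : continuous (fun z => (c z, y z)) by exact: cont_pair.
  have cs : continuous (fun z => start G q (c z, y z)) :=
    cont_comp _ _ _ _ _ (start_cont _ GA q) ccy.
  pose pl z := path_left G q (c z) (y z) (t z).
  pose prr z := path_right G q (c z) (y z) (t z).
  have cpl : continuous pl by rewrite /pl /path_left; case: (forward G q).
  have cpr : continuous prr by rewrite /prr /path_right; case: (forward G q).
  have sides z := path_sides _ _ _ _ (Dz3 z).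
  have evE z : Evolve u (q, z) = Initial u q (c z) (y z) + (-1) ^+ (~~ forward G q) *
    \int[mu]_(r in `[0, horizon G]) (if pl z <= r then if r <= prr z then Along u q (c z) (y z)
      r else 0 else 0).
    rewrite /evolve /transported /= cE -Rintegral_cut//; by have := sides z; rewrite cE => -[].
  rewrite (_ : (fun z => _) = (fun z => Initial u q (c z) (y z) + (-1) ^+ (~~ forward G q) *
    \int[mu]_(r in `[0, horizon G]) (if pl z <= r then if r <= prr z then Along u q (c z) (y z)
      r else 0 else 0))); last exact/funext.
  apply: contD.
    apply: contD; first exact: (cont_comp _ _ _ _ _ (cb_cont _ _ _ CA q) ccy).
    case: (bottom G q); last exact: cont_cst.
    exact: (cont_comp _ _ _ _ _ (avg_bottom_cont u q ru) cc).
  apply: contM; first exact: cont_cst.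
  move=> z0.
  pose bad (l : 'I_m) r := ~ (forall p, cA C q l p = 0) /\ front G l (flow G q (c z0, y z0, r)) = r.
  pose N : set R := [set pl z0] `|` [set prr z0] `|`
    \bigcup_k [set r | exists l : 'I_m, l = k :> nat /\ bad l r].
  apply: (@cvg_dominated R _ _ 0 (horizon G) (m.+2%:R * (M * B)) N).
  + move=> z; apply: measurable_funTS.
    apply: measurable_fun_ifT; [exact: measurable_fun_ler| |exact: measurable_cst].
    apply: measurable_fun_ifT; [exact: measurable_fun_ler| |exact: measurable_cst].
    exact: (measurable_along _ _ _ GA CA nu mnu).
  + move=> z s _; have h0 : 0 <= m.+2%:R * (M * B) by rewrite !mulr_ge0.
    case: ifP => _; last by rewrite normr0.
    case: ifP => _; last by rewrite normr0.
    exact: (source_le _ _ _ CA nu mnu nu01).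
  + apply: negligibleU; first by apply: negligibleU; apply: subsingleton_negligible => ? ? /= -> ->.
    apply: negligible_bigcup => k; apply: subsingleton_negligible => r r' /= [l [lk [nA e1]]]
      [l' [lk' [_ e2]]].
    have ll' : l = l' by apply/val_inj; rewrite /= lk lk'.
    rewrite -{}ll' in e2; have [//|] := transversal _ _ _ CA q l.
    by move=> H; apply: (H (c z0) (y z0)); rewrite e1 e2 !subrr.
  + move=> r _ Nr.
    have npl : pl z0 != r by apply/eqP => e; apply: Nr; left; left.
    have npr : r != prr z0 by apply/eqP => e; apply: Nr; left; right.
    apply: (@cvg_if_le _ _ pl (fun=> r)) => //; [exact: cpl|exact: cvg_cst| |exact: cvg_cst].
    apply: (@cvg_if_le _ _ (fun=> r) prr) => //; [exact: cvg_cst|exact: cpr| |exact: cvg_cst].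
    apply: (cvg_comp (fun z => (c z, y z)) (fun p => Along u q p.1 p.2 r)); first exact: ccy.
    apply: (along_cvg _ _ _ GA CA nu mnu u q (c z0, y z0) r ru) => l.
    have [?|nA] := pselect (forall p, cA C q l p = 0); [by left|right].
    by apply/eqP => e; apply: Nr; right; exists (l : nat) => //; exists l.
- exists (M + M * B + m.+2%:R * (M * B) * horizon G) => -[q z].
  rewrite /evolve /=; set z' := proj G q z.
  have Dz : dom G q (z'.1.1, z'.1.2, z'.2).
    by have := proj_dom _ GA q z; rewrite -/z'; case: (z') => -[].
  have [h1 h2 h3] := path_sides _ _ _ _ Dz; rewrite /transported.
  set c := invar G q _ in h1 h2 h3 *.
  apply: (le_trans (ler_normD _ _)); apply: lerD.
    apply: (le_trans (ler_normD _ _)); apply: lerD; first exact: cb_le _ _ _ CA _ _.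
    case: ifP => _; last by rewrite normr0 mulr_ge0.
    apply: avg_le => //.
      apply: contM; last exact: cB_cont _ _ _ CA q.
      apply: (cont_comp _ _ _ (fun s => (- c, 0, s)) _ (cu None)).
      by apply: cont_pair; [exact: cont_cst|exact: cont_id].
    by move=> s _; rewrite normrM mulrC ler_pM//; exact: cB_le _ _ _ CA _ _.
  rewrite normrM normrX normrN1 expr1n mul1r.
  apply: (le_trans (@Rintegral_bound R _ _ (m.+2%:R * (M * B)) _ h2 _ _)).
  + by apply: measurable_funTS; exact: (measurable_along _ _ _ GA CA nu mnu).
  + by move=> r _; exact: (source_le _ _ _ CA nu mnu nu01).
  + by rewrite ler_wpM2l ?mulr_ge0//; lra.
- by move=> q z; rewrite /evolve /= (proj_id _ GA _ _ (proj_dom _ GA q z)).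
Qed.

End FixedAveraging.
End Evolution.

(** * Contraction in the weighted norm *)

Section FixedPoint.
Context {R : realType} {m : nat} (G : @characteristics R m) (C : @coefficients R m) (M : R).
Hypothesis GA : char_axioms G.
Hypothesis CA : coef_axioms G C M.
Notation mu := (@lebesgue_measure R).
Notation state := (@channel m * (R * R * R) -> R).
Notation Regular := (regular G).

(* The L-components carry a larger weight than K because their values at xi = 0
   are integrals of K, where no factor is gained along a path. *)
Let Theta : R := 2 * M + 1.
Let gam : R := (2 * m.+2%:R * M * Theta + 1) / rate G.

Definition level (q : @channel m) : R := if q is None then 1 else Theta.
Definition weight (x : @channel m * (R * R * R)) : R :=
  level x.1 * expR (gam * ((proj G x.1 x.2).1.1 - slant G * (proj G x.1 x.2).1.2)).

Lemma Theta_ge1 : 1 <= Theta.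
Proof. by rewrite /Theta lerDr mulr_ge0//; exact: M_ge0 CA. Qed.

Lemma level_ge1 q : 1 <= level q.
Proof. by case: q => [a|] /=; [exact: Theta_ge1|exact: lexx]. Qed.

Lemma level_le q : level q <= Theta.
Proof. by case: q => [a|] /=; [exact: lexx|exact: Theta_ge1]. Qed.

Lemma gam_rate : gam * rate G = 2 * m.+2%:R * M * Theta + 1.
Proof. by rewrite /gam divfK// gt_eqF// (rate_gt0 _ GA). Qed.

Lemma gam_gt0 : 0 < gam.
Proof.
rewrite /gam divr_gt0 ?(rate_gt0 _ GA)// ltr_wpDl// !mulr_ge0//; first exact: M_ge0 CA.
exact: le_trans ler01 Theta_ge1.
Qed.

Lemma weight_dom q t xi y : dom G q (t, xi, y) ->
  weight (q, (t, xi, y)) = level q * expR (gam * (t - slant G * xi)).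
Proof. by move=> Dq; rewrite /weight /= (proj_id _ GA _ _ Dq). Qed.

Lemma weight_gt0 x : 0 < weight x.
Proof. by rewrite mulr_gt0 ?expR_gt0// (lt_le_trans ltr01)// level_ge1. Qed.

Lemma proj_bounds q z : let z' := proj G q z in
  [/\ 0 <= z'.1.1 <= horizon G, 0 <= z'.1.2 <= 1 & 0 <= z'.2 <= 1].
Proof.
by have := proj_dom _ GA q z => /=; case: (proj G q z) => -[t xi] y /(dom_bounds _ GA).
Qed.

Lemma weight_le : exists W, forall x, weight x <= W.
Proof.
exists (Theta * expR (gam * horizon G)) => -[q z].
have [/andP[t0 tT] /andP[x0 x1] _] := proj_bounds q z.
rewrite /weight /= ler_pM ?expR_ge0 ?(le_trans ler01) ?level_ge1 ?level_le//.
rewrite ler_expR ler_pM2l ?gam_gt0//.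
by have := mulr_ge0 (slant_ge0 _ GA) x0; lra.
Qed.

Lemma weight_ge x : expR (- (gam * slant G)) <= weight x.
Proof.
case: x => q z; have [/andP[t0 tT] /andP[x0 x1] _] := proj_bounds q z.
rewrite /weight /= -[leLHS]mul1r ler_pM ?expR_ge0 ?level_ge1//.
rewrite ler_expR -mulrN ler_pM2l ?gam_gt0//.
by have := ler_wpM2l (slant_ge0 _ GA) x1; lra.
Qed.

Section FixedAveraging.
Variable nu : R -> R.
Hypothesis mnu : measurable_fun setT nu.
Hypothesis nu01 : forall s, 0 <= nu s <= 1.

Notation Along := (along G C nu).
Notation Evolve := (evolve G C nu).
Notation Source := (source G C nu).
Notation Initial := (initial G C nu).
Notation Transported := (transported G C nu).

Lemma cont_slice (u : state) q (t xi : R) : Regular u -> continuous (fun s => u (q, (t, xi, s))).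
Proof.
move=> [cu _ _]; apply: (cont_comp _ _ _ (fun s => (t, xi, s)) _ (cu q)).
by apply: cont_pair; [exact: cont_cst|exact: cont_id].
Qed.

Lemma cont_cS (q : @channel m) (xi y : R) : continuous (fun s => cS C q (xi, s, y)).
Proof.
apply: (cont_comp _ _ _ (fun s => (xi, s, y)) _ (cS_cont _ _ _ CA q)).
apply: cont_pair; last exact: cont_cst.
by apply: cont_pair; [exact: cont_cst|exact: cont_id].
Qed.

(** Up to the level, the weight depends on t and xi only. Averaging over y and passing to another
    channel therefore cost no more than the factor [Theta]. *)
Lemma source_diff (u v : state) (N : R) q t xi y : Regular u -> Regular v -> 0 <= N ->
  (forall x, `|u x - v x| <= N * weight x) -> dom G q (t, xi, y) ->
  `|Source u q t xi y - Source v q t xi y| <=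
    m.+2%:R * M * Theta * N * expR (gam * (t - slant G * xi)).
Proof.
move=> ru rv N0 uv Dq; have M0 := M_ge0 _ _ _ CA.
have [_ _ y01] := dom_bounds _ GA _ _ _ _ Dq.
set E := expR _; have E0 : 0 < E by exact: expR_gt0.
have T1 := Theta_ge1.
have wD q' y' : dom G q' (t, xi, y') ->
    `|u (q', (t, xi, y')) - v (q', (t, xi, y'))| <= Theta * N * E.
  move=> D'; apply: (le_trans (uv _)); rewrite weight_dom// mulrCA mulrA.
  by rewrite ler_wpM2r ?(ltW E0)// ler_wpM2r// level_le.
have TNE : 0 <= Theta * N * E by rewrite !mulr_ge0 ?(ltW E0)// (le_trans ler01).
rewrite /source.
set a1 := cZ C q _ * u _; set a2 := \sum_(l < m) branch _ u _ _ _ * _; set a3 := avg nu _.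
set b1 := cZ C q _ * v _; set b2 := \sum_(l < m) branch _ v _ _ _ * _; set b3 := avg nu _.
have h1 : `|a1 - b1| <= M * (Theta * N * E).
  by rewrite -mulrBr normrM ler_pM//; [exact: cZ_le _ _ _ CA _ _|exact: (wD _ _ Dq)].
have h2 : `|a2 - b2| <= m%:R * (M * (Theta * N * E)).
  rewrite -sumrB; apply: (le_trans (ler_norm_sum _ _ _)).
  rewrite (_ : m%:R * _ = \sum_(l < m) M * (Theta * N * E)); last first.
    by rewrite sumr_const card_ord mulr_natl.
  apply: ler_sum => l _; rewrite -mulrBl normrM mulrC ler_pM//; first exact: cA_le _ _ _ CA _ _ _.
  rewrite /branch; case: (leP (front G l xi) t) => fr; apply: wD.
    exact: dom_lower _ GA _ _ _ _ _ Dq fr.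
  exact: dom_upper _ GA _ _ _ _ _ Dq fr.
have h3 : `|a3 - b3| <= M * (Theta * N * E).
  have cc (w : state) : Regular w ->
    continuous (fun eta => w (None, (t, xi, eta)) * cS C q (xi, eta, y)).
    by move=> rw; apply: contM; [exact: cont_slice|exact: cont_cS].
  rewrite /a3 /b3 avgB//; [|exact: cc|exact: cc].
  apply: avg_le => //; first by apply: contB; exact: cc.
  move=> s s01; rewrite -mulrBl normrM mulrC ler_pM//; first exact: cS_le _ _ _ CA _ _.
  by apply: wD; exact: dom_None _ GA _ _ _ _ _ Dq s01.
rewrite (_ : a1 + a2 + a3 - _ = (a1 - b1) + (a2 - b2) + (a3 - b3)); last ring.
apply: (le_trans (ler_normD _ _)); apply: (le_trans (lerD (ler_normD _ _) h3)).
rewrite (_ : m.+2%:R * M * Theta * N * E = M * (Theta * N * E) + m%:R * (M * (Theta * N * E)) +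
  M * (Theta * N * E)).
  by rewrite lerD// lerD.
by rewrite -addn2 natrD; ring.
Qed.

Lemma evolve_contract (u v : state) (N : R) : 0 <= N -> Regular u -> Regular v ->
  (forall x, `|u x - v x| <= N * weight x) ->
  forall x, `|Evolve u x - Evolve v x| <= N / 2 * weight x.
Proof.
move=> N0 ru rv uv [q z]; have M0 := M_ge0 _ _ _ CA.
have wE : weight (q, z) = weight (q, proj G q z).
  by rewrite /weight /= (proj_id _ GA _ _ (proj_dom _ GA q z)).
rewrite wE /evolve /=; have := proj_dom _ GA q z.
case: (proj G q z) => -[t xi] y Dq /=; rewrite weight_dom// /transported.
set c := invar G q _.
have T1 := Theta_ge1; have T0 : 0 <= Theta := le_trans ler01 T1.
have [h1 h2 h3] := path_sides _ GA _ _ _ _ Dq; rewrite -/c in h1 h2 h3.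
have ip w : Regular w -> mu.-integrable `[path_left G q c y t,
  path_right G q c y t] (EFin \o Along w q c y).
  by move=> rw; exact: (integrable_along _ _ _ GA CA nu mnu nu01).
set I1 := \int[mu]_(r in _) Along u q c y r; set I2 := \int[mu]_(r in _) Along v q c y r.
set i1 := Initial u q c y; set i2 := Initial v q c y.
have -> : i1 + (-1) ^+ (~~ forward G q) * I1 - (i2 + (-1) ^+ (~~ forward G q) * I2) =
  (i1 - i2) + (-1) ^+ (~~ forward G q) * (I1 - I2) by ring.
apply: (le_trans (ler_normD _ _)).
rewrite normrM normrX normrN1 expr1n mul1r /I1 /I2 -RintegralB//; [|exact: ip|exact: ip].
rewrite [leRHS]mulrA.
have xiE := flow_invar _ GA _ _ _ _ Dq; rewrite -/c in xiE.
rewrite (_ : t - slant G * xi = t - slant G * flow G q (c, y, t)); last by rewrite xiE.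
apply: (@growth_step R (path_left G q c y t) (path_right G q c y t) t (start G q (c,
  y)) gam (rate G) (N / 2 * level q)
  (m.+2%:R * M * Theta * N) (i1 - i2) (fun r => r - slant G * flow G q (c, y, r))
  (fun r => Along u q c y r - Along v q c y r)) => //.
- exact: gam_gt0.
- exact: rate_gt0 GA.
- by rewrite /path_left /path_right; case: (forward G q); [left|right].
- move=> r rb; rewrite xiE.
  apply: (flow_rate _ GA _ _ _ _ _ Dq).
  by move: rb; rewrite /path_left /path_right -/c; case: (forward G q) => ?; [left|right].
- apply: measurable_funTS; apply: measurable_funB; exact: (measurable_along _ _ _ GA CA nu mnu).
- move=> r rb; have [|Dr _] := flow_dom _ GA _ _ _ _ r Dq.
    by move: rb; rewrite /path_left /path_right -/c; case: (forward G q) => ?; [left|right].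
  exact: source_diff.
- by rewrite !mulr_ge0.
(* Here [gam] is calibrated: half of [gam * rate G] exceeds [m.+2%:R * M * Theta], the constant of
   [source_diff], and levels are at least 1. *)
- rewrite gam_rate; apply: (@le_trans _ _ (N / 2 * 1 * (2 * m.+2%:R * M * Theta + 1))).
    rewrite (_ : N / 2 * 1 * _ = m.+2%:R * M * Theta * N + N / 2); last by field.
    by rewrite lerDl divr_ge0.
  rewrite ler_wpM2r//; last by rewrite ler_wpM2l ?divr_ge0// level_ge1.
  by rewrite addr_ge0// !mulr_ge0.
- rewrite /i1 /i2 /initial.
  have [bq|_] := boolP (bottom G q); last first.
    by rewrite addr0 subrr normr0 !mulr_ge0 ?expR_ge0 ?divr_ge0// (le_trans ler01)// level_ge1.
  have levq : level q = Theta by move: bq; case: (q) => //; rewrite (bottom_None _ GA).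
  have cc (w : state) : Regular w -> continuous (fun eta => w (None, (- c, 0, eta)) * cB C q eta).
    by move=> rw; apply: contM; [exact: cont_slice|exact: cB_cont _ _ _ CA q].
  rewrite (_ : forall a b d : R, a + b - (a + d) = b - d); last by move=> *; ring.
  rewrite avgB//; [|exact: cc|exact: cc].
  apply: avg_le => //; first by apply: contB; exact: cc.
  (* K has level 1 and this channel level 2 M + 1, so the factor M of the pairing fits into N / 2 *
     Theta; the exponential does not grow by [bottom_rate]. *)
  move=> s s01; rewrite -mulrBl normrM levq.
  have Db := bottom_dom _ GA _ _ _ _ s bq Dq s01; rewrite -/c in Db.
  apply: (le_trans (ler_pM _ _ (uv _) (cB_le _ _ _ CA _ _))) => //.
  rewrite weight_dom//= mul1r mulr0 subr0 mulrAC.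
  apply: ler_pM; rewrite ?mulr_ge0 ?expR_ge0//.
    by rewrite -mulrA ler_wpM2l// /Theta; lra.
  rewrite ler_expR ler_pM2l ?gam_gt0//.
  exact: bottom_rate _ GA _ _ _ _ bq Dq.
Qed.

Lemma regular_limit (un : nat -> state) (u : state) : (forall n, Regular (un n)) ->
  (forall e : R, 0 < e -> exists n, forall x, `|un n x - u x| <= e) -> Regular u.
Proof.
move=> run lim; split.
- move=> q z; apply/cvgrPdist_lt => e e0.
  have e30 : 0 < e / 3 by rewrite divr_gt0.
  have [n Hn] := lim _ e30; have [cu _ _] := run n.
  have /cvgrPdist_lt/(_ _ e30) := cu q z.
  apply: filterS => z' h; have a := Hn (q, z); have b := Hn (q, z').
  rewrite (_ : u (q, z) - u (q, z') = - (un n (q, z) - u (q, z)) +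
    (un n (q, z) - un n (q, z')) + (un n (q, z') - u (q, z'))); last ring.
  apply: (le_lt_trans (ler_normD _ _)); apply: (le_lt_trans (lerD (ler_normD _ _) (lexx _))).
  by rewrite normrN; lra.
- have [n Hn] := lim 1 ltr01; have [_ [B uB] _] := run n.
  exists (B + 1) => x; rewrite (_ : u x = un n x - (un n x - u x)); last ring.
  by apply: (le_trans (ler_normB _ _)); exact: lerD.
- move=> q z; apply/eqP; rewrite -subr_eq0 -normr_eq0 eq_le normr_ge0 andbT.
  apply/ler_addgt0Pr => e e0; rewrite add0r.
  have e20 : 0 < e / 2 by rewrite divr_gt0.
  have [n Hn] := lim _ e20; have [_ _ pu] := run n.
  have a := Hn (q, z); have b := Hn (q, proj G q z).
  rewrite (_ : u (q, z) - u (q, proj G q z) = - (un n (q, z) - u (q, z)) +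
    (un n (q, proj G q z) - u (q, proj G q z))); last by rewrite (pu q z); ring.
  by apply: (le_trans (ler_normD _ _)); rewrite normrN; lra.
Qed.

Lemma regular0 : Regular (fun=> 0).
Proof.
split => //; first by move=> q; exact: cont_cst.
by exists 0 => x; rewrite normr0.
Qed.

Lemma fixed_state : exists2 u : state, Regular u & forall x, Evolve u x = u x.
Proof.
have [_ [B HB] _] := evolve_regular _ _ _ GA CA nu mnu nu01 _ regular0.
apply: (@weighted_fixpoint R _ Regular weight Evolve weight_gt0 weight_le regular0 _ regular_limit
  evolve_contract (B / expR (- (gam * slant G)))).
  by move=> u; exact: evolve_regular _ _ _ GA CA nu mnu nu01 u.
move=> x; apply: (le_trans (HB x)).
have B0 : 0 <= B := le_trans (normr_ge0 _) (HB x).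
rewrite -[leLHS]mulr1 -mulrA ler_wpM2l//.
by rewrite mulrC ler_pdivlMr ?expR_gt0// mul1r; exact: weight_ge.
Qed.

Lemma state_stability (u v : state) (eta : R) : Regular u -> Regular v ->
  (forall x, Evolve v x = v x) -> 0 <= eta ->
  (forall x, `|Evolve u x - u x| <= eta * weight x) ->
  forall x, `|u x - v x| <= 2 * eta * weight x.
Proof.
move=> ru rv Pv eta0 Pu.
have [_ [B HB] _] := ru; have [_ [B' HB'] _] := rv.
have B0 : 0 <= B := le_trans (normr_ge0 _) (HB (None, (0, 0, 0))).
have B'0 : 0 <= B' := le_trans (normr_ge0 _) (HB' (None, (0, 0, 0))).
apply: (@fixpoint_stability R _ Regular weight Evolve weight_gt0 evolve_contract u v eta
  ((B + B') / expR (- (gam * slant G)))) => //.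
  by rewrite divr_ge0 ?expR_ge0// addr_ge0.
move=> x; apply: (@le_trans _ _ (B + B')).
  by apply: (le_trans (ler_normB _ _)); exact: lerD.
rewrite -[leLHS]mulr1 -mulrA ler_wpM2l ?addr_ge0//.
by rewrite mulrC ler_pdivlMr ?expR_gt0// mul1r; exact: weight_ge.
Qed.

(** Points with the same invariant start from the same data, which cancel in the difference. *)
Lemma state_increment (u : state) q r1 r2 xi1 xi2 y : Regular u ->
  (forall x, Evolve u x = u x) -> dom G q (r1, xi1, y) -> dom G q (r2, xi2, y) ->
  r1 <= r2 -> invar G q (r1, xi1, y) = invar G q (r2, xi2, y) ->
  u (q, (r2, xi2, y)) - u (q, (r1, xi1, y)) =
  \int[mu]_(r in `[r1, r2]) Along u q (invar G q (r1, xi1, y)) y r.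
Proof.
move=> ru fu D1 D2 r12 cE.
rewrite -!fu !evolve_dom// /transported -cE; set c := invar G q _.
have s1 := start_side _ GA _ _ _ _ D1; have s2 := start_side _ GA _ _ _ _ D2.
rewrite -cE -/c in s1 s2; rewrite -/c in s1.
have ip a b : mu.-integrable `[a, b] (EFin \o Along u q c y).
  exact: (integrable_along _ _ _ GA CA nu mnu nu01).
rewrite /path_left /path_right; move: s1 s2; case: (forward G q) => s1 s2 /=.
  by rewrite expr0 !mul1r (Rintegral_split _ _ r1 r2)//; ring.
by rewrite expr1 !mulN1r (Rintegral_split _ r1 r2 (start G q (c, y)))//; ring.
Qed.

Lemma state_start (u : state) q t xi y : (forall x, Evolve u x = u x) ->
  dom G q (t, xi, y) -> t = start G q (invar G q (t, xi, y), y) ->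
  u (q, (t, xi, y)) = Initial u q (invar G q (t, xi, y)) y.
Proof.
move=> fu Dq tE; rewrite -fu evolve_dom// /transported /path_left /path_right.
by rewrite -tE if_same set_itv1 Rintegral_set1 mulr0 addr0.
Qed.

End FixedAveraging.
End FixedPoint.

(** * Characteristics in travel-time coordinates *)

Section Geometry.
Context {R : realType} {m : nat} (i : 'I_m).
Variables (f : 'I_m -> R -> R) (Lam : R -> R -> R) (kap eps c0 : R).
Hypothesis c0_gt0 : 0 < c0.
Hypothesis eps_gt0 : 0 < eps.
Hypothesis eps_le1 : eps <= 1.
Hypothesis kap_ge0 : 0 <= kap.
Hypothesis f0 : forall j, f j 0 = 0.
Hypothesis fcont : forall j, continuous (f j).
Hypothesis fslope : forall j (a b : R), a <= b -> c0 * (b - a) <= f j b - f j a.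
Hypothesis fdslope : forall j l : 'I_m, (j < l)%N -> forall a b : R, a <= b ->
  c0 * (b - a) <= (f l b - f j b) - (f l a - f j a).
Hypothesis Lamcont : continuous (fun p : R * R => Lam p.1 p.2).
Hypothesis Lamslope : forall y (a b : R), a <= b -> c0 * (b - a) <= Lam y b - Lam y a.
Hypothesis slow : forall j : 'I_m, (i <= j)%N -> forall a b : R, a <= b ->
  kap * (b - a) <= (1 - eps) * (f j b - f j a).
Hypothesis fast : forall j : 'I_m, (j < i)%N -> forall a b : R, a <= b ->
  (1 + eps) * (f j b - f j a) <= kap * (b - a).
Variables (finv : 'I_m -> R -> R) (Laminv : R -> R -> R) (zK : R -> R -> R)
  (zd : 'I_m -> R -> R).
Hypothesis finvK : forall j v, f j (finv j v) = v.
Hypothesis fK : forall j z, finv j (f j z) = z.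
Hypothesis finv_cont : forall j, continuous (finv j).
Hypothesis LaminvK : forall y v, Lam y (Laminv y v) = v.
Hypothesis LamK : forall y z, Laminv y (Lam y z) = z.
Hypothesis Laminv_cont : continuous (fun p : R * R => Laminv p.1 p.2).
Hypothesis zKE : forall y c, f i (zK y c) + Lam y (zK y c) = c.
Hypothesis zK_cont : continuous (fun p : R * R => zK p.1 p.2).
Hypothesis zdE : forall j : 'I_m, j != i -> forall c, f j (zd j c) - f i (zd j c) = c.
Hypothesis zd_cont : forall j : 'I_m, j != i -> continuous (zd j).

Let tau := f i 1.

(** [KL] is L_j below its jump curve for j >= i, entering at xi = 0; [KR] is L_j for j < i, followed
    forward in time to the diagonal or to x = 1; [KU] is L_j above its jump curve for j > i,
    entering from the diagonal. *)
Variant kind := KK | KL of 'I_m | KR of 'I_m | KU of 'I_m.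

(** For j <= i no point of the triangle lies above the jump curve of L_j; this channel is a
    placeholder with the geometry of K. *)
Definition kind_of (q : @channel m) : kind :=
  match q with
  | None => KK
  | Some (j, true) => if (i <= j)%N then KL j else KR j
  | Some (j, false) => if (i < j)%N then KU j else KK
  end.

Definition tri (t xi y : R) : Prop := [/\ 0 <= xi <= 1, f i xi <= t <= tau & 0 <= y <= 1].

(** Along K the quantity t + Lam xi is conserved, along L_j the quantity f_j xi - t; [zK] and [zd]
    find the diagonal point with a given invariant. In [KR] the start is whichever of the diagonal
    and x = 1 comes first. For the regions f_j xi <= t, [proj] first lowers xi to at most
    [finv j tau], so that some t <= tau remains. *)
Definition geo : @characteristics R m := {|
  dom := fun q z => tri z.1.1 z.1.2 z.2 /\
    match kind_of q with
    | KK => True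
    | KL j | KR j => f j z.1.2 <= z.1.1
    | KU j => z.1.1 <= f j z.1.2
    end;
  proj := fun q z =>
    match kind_of q with
    | KK => let xi := cl z.1.2 in (Num.min tau (Num.max z.1.1 (f i xi)), xi, cl z.2)
    | KL j | KR j => let xi := Num.min (cl z.1.2) (finv j tau) in
        (Num.min tau (Num.max z.1.1 (Num.max (f i xi) (f j xi))), xi, cl z.2)
    | KU j => let xi := cl z.1.2 in
        (Num.min (Num.min tau (f j xi)) (Num.max z.1.1 (f i xi)), xi, cl z.2)
    end;
  invar := fun q z =>
    match kind_of q with
    | KK => Lam z.2 z.1.2 + z.1.1
    | KL j | KR j | KU j => f j z.1.2 - z.1.1
    end;
  flow := fun q p =>
    match kind_of q with
    | KK => Laminv p.1.2 (p.1.1 - p.2)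
    | KL j | KR j | KU j => finv j (p.1.1 + p.2)
    end;
  start := fun q p =>
    match kind_of q with
    | KK => f i (zK p.2 p.1)
    | KL j => - p.1
    | KR j => Num.min (f i (zd j p.1)) tau
    | KU j => f i (zd j p.1)
    end;
  forward := fun q => if kind_of q is KR _ then false else true;
  bottom := fun q => if kind_of q is KL _ then true else false;
  front := f;
  horizon := tau;
  slant := kap;
  rate := eps |}.

Lemma kind_ofP q : match kind_of q with
  | KK => True | KL j => (i <= j)%N /\ q = Some (j, true)
  | KR j => (j < i)%N /\ q = Some (j, true) | KU j => (i < j)%N /\ q = Some (j, false) end.
Proof.
by case: q => [[j []]|] //=; case: ifP => //; rewrite ltnNge => ->.
Qed.

Lemma fle j a b : (f j a <= f j b) = (a <= b).
Proof.
apply/idP/idP => ab.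
  rewrite leNgt; apply/negP => ba; have := fslope j _ _ (ltW ba).
  have := mulr_gt0 c0_gt0 (_ : 0 < a - b); rewrite subr_gt0 => /(_ ba); lra.
have := fslope j _ _ ab; have := mulr_ge0 (ltW c0_gt0) (_ : 0 <= b - a).
by rewrite subr_ge0 => /(_ ab); lra.
Qed.

Lemma Lamle y a b : (Lam y a <= Lam y b) = (a <= b).
Proof.
apply/idP/idP => ab.
  rewrite leNgt; apply/negP => ba; have := Lamslope y _ _ (ltW ba).
  have := mulr_gt0 c0_gt0 (_ : 0 < a - b); rewrite subr_gt0 => /(_ ba); lra.
have := Lamslope y _ _ ab; have := mulr_ge0 (ltW c0_gt0) (_ : 0 <= b - a).
by rewrite subr_ge0 => /(_ ab); lra.
Qed.

Lemma fdle (j l : 'I_m) a b : (j < l)%N -> (f l a - f j a <= f l b - f j b) = (a <= b).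
Proof.
move=> jl; apply/idP/idP => ab.
  rewrite leNgt; apply/negP => ba; have := fdslope _ _ jl _ _ (ltW ba).
  have := mulr_gt0 c0_gt0 (_ : 0 < a - b); rewrite subr_gt0 => /(_ ba); lra.
have := fdslope _ _ jl _ _ ab; have := mulr_ge0 (ltW c0_gt0) (_ : 0 <= b - a).
by rewrite subr_ge0 => /(_ ab); lra.
Qed.

Lemma fle_index (j l : 'I_m) x : (j <= l)%N -> 0 <= x -> f j x <= f l x.
Proof.
rewrite leq_eqVlt => /orP[/eqP/val_inj -> //|jl] x0.
by have := fdle j l 0 x jl; rewrite !f0 x0; lra.
Qed.

Lemma tau_ge0 : 0 <= tau.
Proof. by rewrite -(f0 i) fle. Qed.

(** Towards its start, K moves to smaller t and larger xi, so t - kap * xi falls at least as fast as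
    t. [KL] and [KU] move to smaller t and xi, and by [slow] the decrease of t wins; [KR] moves to
    larger t and xi, and by [fast] the increase of kap * xi wins. In [KR] and [KU] the path does not
    cross the diagonal before its start because f_j - f_i is monotone. *)
Lemma geo_path q t xi y (c := invar geo q (t, xi, y)) (s := start geo q (c, y)) :
  dom geo q (t, xi, y) ->
  [/\ flow geo q (c, y, t) = xi, 0 <= s <= tau,
      if forward geo q then s <= t else t <= s &
      forall r, between s t r ->
        [/\ dom geo q (r, flow geo q (c, y, r), y),
            invar geo q (r, flow geo q (c, y, r), y) = c &
            r - kap * flow geo q (c, y, r) <= t - kap * xi - eps * `|t - r|]].
Proof.
have btw (a b r : R) : a <= b -> between a b r -> a <= r <= b.
  by move=> ab [//|/andP[h1 h2]]; apply/andP; split; lra.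
have btw' (a b r : R) : b <= a -> between a b r -> b <= r <= a.
  by move=> ab [|//] /andP[h1 h2]; apply/andP; split; lra.
rewrite {}/s {}/c => -[[/andP[x0 x1] /andP[h1 h2] y01]].
rewrite /= in x0 x1 h1 h2 y01 *; have kP := kind_ofP q.
have t0 : 0 <= t by rewrite (le_trans _ h1)// -(f0 i) fle.
case: (kind_of q) kP => [|j|j|j] kP /= H.
- set c := Lam y xi + t; set zz := zK y c.
  have zE : f i zz + Lam y zz = c := zKE _ _.
  have xz : xi <= zz.
    rewrite leNgt; apply/negP => zx.
    have := Lamslope y _ _ (ltW zx); have : f i zz <= f i xi by rewrite fle ltW.
    have : 0 < c0 * (xi - zz) by rewrite mulr_gt0// subr_gt0.
    by rewrite /c in zE; lra.
  have Lxz : Lam y xi <= Lam y zz by rewrite Lamle.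
  have st : f i zz <= t by rewrite /c in zE; lra.
  have s0 : 0 <= f i zz by rewrite -(f0 i) fle; lra.
  have z1 : zz <= 1 by rewrite -(fle i) -/tau; lra.
  split.
  + by rewrite /c addrK LamK.
  + by rewrite s0; lra.
  + by [].
  + move=> r /(btw _ _ _ st)/andP[r1 r2]; set z := Laminv y (c - r).
    have zE' : Lam y z = c - r := LaminvK _ _.
    have xz' : xi <= z by rewrite -(Lamle y) zE' /c; lra.
    have zz' : z <= zz by rewrite -(Lamle y) zE'; lra.
    have fzz : f i z <= f i zz by rewrite fle.
    split.
    * by split => //; split => //; apply/andP; split; lra.
    * by rewrite zE'; ring.
    * rewrite ger0_norm ?subr_ge0//.
      have := ler_wpM2l kap_ge0 xz'; have : eps * (t - r) <= 1 * (t - r).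
        by rewrite ler_wpM2r ?subr_ge0.
      by lra.
- have [ij _] := kP; set c := f j xi - t.
  have fx0 : 0 <= f j xi by rewrite -(f0 j) fle.
  have st : - c <= t by rewrite /c; lra.
  split.
  + by rewrite /c subrK fK.
  + by rewrite /c; apply/andP; split; lra.
  + by [].
  + move=> r /(btw _ _ _ st)/andP[r1 r2]; set z := finv j (c + r).
    have zE : f j z = c + r := finvK _ _.
    have zx : z <= xi by rewrite -(fle j) zE /c; lra.
    have z0 : 0 <= z by rewrite -(fle j) zE f0; lra.
    have fij := fle_index _ _ _ ij z0.
    split.
    * split; last by rewrite zE /c; lra.
      by split => //; apply/andP; split; rewrite /c in zE; lra.
    * by rewrite zE; ring.
    * rewrite ger0_norm ?subr_ge0//; have := slow _ ij _ _ zx.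
      by rewrite zE /c; lra.
- have [ji _] := kP; set c := f j xi - t; set zz := zd j c.
  have nji : j != i by apply/eqP => e; move: ji; rewrite e ltnn.
  have zE : f j zz - f i zz = c := zdE _ nji _.
  have xz : xi <= zz by rewrite -(fdle _ _ _ _ ji) /c in zE *; lra.
  have fxz : f j xi <= f j zz by rewrite fle.
  have st : t <= Num.min (f i zz) tau by rewrite le_min h2 andbT; rewrite /c in zE; lra.
  split.
  + by rewrite /c subrK fK.
  + by rewrite (le_trans t0 st) ge_min lexx orbT.
  + by [].
  + move=> r /(btw' _ _ _ st)/andP[r1]; rewrite le_min => /andP[r2 r3].
    set z := finv j (c + r); have zE' : f j z = c + r := finvK _ _.
    have xz' : xi <= z by rewrite -(fle j) zE' /c; lra.
    have zz' : z <= zz by rewrite -(fle j) zE'; lra.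
    have fz : f i z <= r.
      by have : f i z - f j z <= f i zz - f j zz; [rewrite fdle|lra].
    have z1 : z <= 1 by rewrite -(fle i) -/tau; lra.
    have z0 : 0 <= z by lra.
    have fij := fle_index _ _ _ (ltnW ji) z0.
    split.
    * split; last by lra.
      by split => //; apply/andP; split; lra.
    * by rewrite zE'; ring.
    * rewrite ler0_norm ?subr_le0//; have := fast _ ji _ _ xz'.
      by rewrite zE' /c; lra.
- have [ij _] := kP; set c := f j xi - t; set zz := zd j c.
  have nji : j != i by apply/eqP => e; move: ij; rewrite e ltnn.
  have zE : f j zz - f i zz = c := zdE _ nji _.
  have zx : zz <= xi by rewrite -(fdle _ _ _ _ ij) /c in zE *; lra.
  have z0 : 0 <= zz by rewrite -(fdle _ _ _ _ ij) !f0 subrr zE /c; lra.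
  have fzx : f j zz <= f j xi by rewrite fle.
  have st : f i zz <= t by rewrite /c in zE; lra.
  have s0 : 0 <= f i zz by rewrite -(f0 i) fle; lra.
  split.
  + by rewrite /c subrK fK.
  + by apply/andP; split; lra.
  + by [].
  + move=> r /(btw _ _ _ st)/andP[r1 r2]; set z := finv j (c + r).
    have zE' : f j z = c + r := finvK _ _.
    have zx' : z <= xi by rewrite -(fle j) zE' /c; lra.
    have zz' : zz <= z by rewrite -(fle j) zE'; lra.
    have fz : f i z <= r.
      by have : f j zz - f i zz <= f j z - f i z; [rewrite fdle|lra].
    split.
    * split; last by rewrite zE' /c; lra.
      by split => //; apply/andP; split; lra.
    * by rewrite zE'; ring.
    * rewrite ger0_norm ?subr_ge0//; have := slow _ (ltnW ij) _ _ zx'.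
      by rewrite zE' /c; lra.
Qed.

Lemma geo_axioms : char_axioms geo.
Proof.
have t0 := tau_ge0.
have trid t xi y : tri t xi y ->
    [/\ cl xi = xi, cl y = y, Num.max t (f i xi) = t & Num.min tau t = t].
  by move=> [h1 /andP[h2 h3] h4]; rewrite !cl_id// max_l// min_r.
split.
- move=> q [[t xi] y] /=; have kP := kind_ofP q.
  have /andP[x0 x1] := cl01 xi.
  have fx1 : f i (cl xi) <= tau by rewrite fle.
  case: (kind_of q) kP => [|j|j|j] kP /=.
  + split => //; split; rewrite ?cl01//.
    by rewrite le_min ge_min le_max lexx fx1 !orbT lexx.
  + set xi' := Num.min (cl _) _; have x'0 : 0 <= xi'.
      by rewrite /xi' le_min x0 -(fle j) finvK f0.
    have x'1 : xi' <= 1 by rewrite /xi' ge_min x1.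
    have fj : f j xi' <= tau by rewrite -(finvK j tau) fle /xi' ge_min lexx orbT.
    have fi : f i xi' <= tau by rewrite fle.
    split; first split; rewrite ?cl01 ?x'0//.
      by rewrite le_min fi ge_min lexx !le_max lexx !orbT.
    by rewrite le_min fj !le_max lexx !orbT.
  + set xi' := Num.min (cl _) _; have x'0 : 0 <= xi'.
      by rewrite /xi' le_min x0 -(fle j) finvK f0.
    have x'1 : xi' <= 1 by rewrite /xi' ge_min x1.
    have fj : f j xi' <= tau by rewrite -(finvK j tau) fle /xi' ge_min lexx orbT.
    have fi : f i xi' <= tau by rewrite fle.
    split; first split; rewrite ?cl01 ?x'0//.
      by rewrite le_min fi ge_min lexx !le_max lexx !orbT.
    by rewrite le_min fj !le_max lexx !orbT.
  + have fij : f i (cl xi) <= f j (cl xi) by apply: fle_index => //; exact: ltnW (proj1 kP).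
    split; first split; rewrite ?cl01//.
      by rewrite !le_min fx1 fij !ge_min le_max !lexx !orbT.
    by rewrite !ge_min lexx !orbT.
- move=> q [[t xi] y] /= [T]; have [-> -> tm tn] := trid _ _ _ T.
  have [/andP[x0 x1] /andP[fx tt] _] := T.
  case: (kind_of q) => [|j|j|j] /= H.
  + by rewrite tm tn.
  + have -> : Num.min xi (finv j tau) = xi.
      by rewrite min_l// -(fle j) finvK (le_trans H).
    by rewrite maxA tm max_l// tn.
  + have -> : Num.min xi (finv j tau) = xi.
      by rewrite min_l// -(fle j) finvK (le_trans H).
    by rewrite maxA tm max_l// tn.
  + by rewrite tm minAC tn min_l.
- have c1 : continuous (fun z : R * R * R => z.1.1) :=
  cont_fst _ _ _ _ (cont_fst _ _ _ _ (@cont_id _)).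
  have c2 : continuous (fun z : R * R * R => cl z.1.2).
    exact: (cont_comp _ _ _ _ _ (@cont_cl R) (cont_snd _ _ _ _ (cont_fst _ _ _ _ (@cont_id _)))).
  have c3 : continuous (fun z : R * R * R => cl z.2).
    exact: (cont_comp _ _ _ _ _ (@cont_cl R) (cont_snd _ _ _ _ (@cont_id _))).
  have cf (g : R * R * R -> R) j : continuous g -> continuous (fun z => f j (g z)).
    by move=> cg; exact: (cont_comp _ _ _ _ _ (fcont j) cg).
  have cc : continuous (fun _ : R * R * R => tau) by exact: cont_cst.
  have cm j : continuous (fun z : R * R * R => Num.min (cl z.1.2) (finv j tau)).
    by apply: contmin => //; exact: cont_cst.
  move=> q; rewrite /=; case: (kind_of q) => [|j|j|j];
    (apply: cont_pair => //; apply: cont_pair => //; apply: contmin => //;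
     repeat (first [assumption | exact: cont_cst | apply: contmax | apply: contmin | apply: cf])).
- move=> q /=; have c1 : continuous (fun z : R * R * R => z.1.1) :=
  cont_fst _ _ _ _ (cont_fst _ _ _ _ (@cont_id _)).
  have c2 : continuous (fun z : R * R * R => z.1.2) :=
    cont_snd _ _ _ _ (cont_fst _ _ _ _ (@cont_id _)).
  have c3 : continuous (fun z : R * R * R => z.2) := cont_snd _ _ _ _ (@cont_id _).
  case: (kind_of q) => [|j|j|j]; [|by apply: contB => //;
    exact: (cont_comp _ _ _ _ _ (fcont j) c2)..].
  by apply: contD => //; exact: (cont_comp _ _ _ (fun z : R * R * R => (z.2,
    z.1.2)) _ Lamcont (cont_pair _ _ _ _ _ c3 c2)).
- move=> q /=; have c1 : continuous (fun z : R * R * R => z.1.1) :=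
  cont_fst _ _ _ _ (cont_fst _ _ _ _ (@cont_id _)).
  have c2 : continuous (fun z : R * R * R => z.1.2) :=
    cont_snd _ _ _ _ (cont_fst _ _ _ _ (@cont_id _)).
  have c3 : continuous (fun z : R * R * R => z.2) := cont_snd _ _ _ _ (@cont_id _).
  case: (kind_of q) => [|j|j|j]; [|by apply: (cont_comp _ _ _ _ _ (finv_cont j)); exact: contD..].
  apply: (cont_comp _ _ _ (fun z : R * R * R => (z.1.2, z.1.1 - z.2)) _ Laminv_cont).
  by apply: cont_pair => //; exact: contB.
- move=> q /=; have kP := kind_ofP q.
  have c1 : continuous (fun z : R * R => z.1) := cont_fst _ _ _ _ (@cont_id _).
  have c2 : continuous (fun z : R * R => z.2) := cont_snd _ _ _ _ (@cont_id _).
  case: (kind_of q) kP => [|j|j|j] kP.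
  + apply: (cont_comp _ _ _ _ _ (fcont i)).
    exact: (cont_comp _ _ _ (fun z : R * R => (z.2, z.1)) _ zK_cont (cont_pair _ _ _ _ _ c2 c1)).
  + exact: contN.
  + apply: contmin; last exact: cont_cst.
    apply: (cont_comp _ _ _ _ _ (fcont i)); apply: (cont_comp _ _ _ _ _ (zd_cont j _)) => //.
    by apply/eqP => ji; move: kP => []; rewrite ji ltnn.
  + apply: (cont_comp _ _ _ _ _ (fcont i)); apply: (cont_comp _ _ _ _ _ (zd_cont j _)) => //.
    by apply/eqP => ji; move: kP => []; rewrite ji ltnn.
- exact: fcont.
- exact: kap_ge0.
- exact: eps_gt0.
- move=> q t xi y /= [[/andP[x0 x1] /andP[h1 h2] h3] _]; split => //; last by rewrite x0.
  by rewrite h2 andbT (le_trans _ h1)// -(f0 i) fle.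
- by move=> q t xi y eta /= [[h1 h2 _] _] h3.
- move=> q l t xi y /= [[h1 h2 h3] _] fr.
  by split; [split; rewrite ?lexx ?ler01|case: ifP].
- move=> q l t xi y /= [[h1 h2 h3] _] fr.
  by split; [split; rewrite ?lexx ?ler01|case: ifP => // _; exact: ltW].
- by move=> q t xi y /geo_path[].
- by move=> q t xi y /geo_path[].
- by move=> q t xi y /geo_path[].
- by move=> q t xi y r /geo_path[_ _ _ H] /H[].
- by move=> q t xi y r /geo_path[_ _ _ H] /H[].
- by [].
- move=> q t xi y eta /=; have kP := kind_ofP q.
  case: (kind_of q) kP => // j [ij _] _ [[/andP[x0 x1] /andP[h1 h2] y01] H] eta01.
  rewrite /= in x0 x1 h1 h2 H *; have : 0 <= f j xi by rewrite -(f0 j) fle.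
  by move=> ?; split => //; split; rewrite ?lexx ?ler01 ?f0//; apply/andP; split; lra.
- move=> q t xi y /=; case: (kind_of q) => // j _ _.
  by rewrite addrN -(f0 j) fK mulr0 subr0.
Qed.

(** On a characteristic of L_j, f_l xi - r equals (f_l - f_j) xi up to a constant, where for l != j
    both f_l - f_j and the dependence of xi on r are strictly monotone. On a characteristic of K, xi
    falls as r grows. The case l = j is left to psi_{j,j} = 0. *)
Lemma flow_transversal q l : (exists b, q = Some (l, b)) \/
  forall c y r r', f l (flow geo q (c, y, r)) - r = f l (flow geo q (c, y, r')) - r' -> r = r'.
Proof.
have Linj y a b : Lam y a = Lam y b -> a = b by move=> /(congr1 (Laminv y)); rewrite !LamK.
have finj j a b : f j a = f j b -> a = b by move=> /(congr1 (finv j)); rewrite !fK.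
have aux j c r r' : f l (finv j (c + r)) - r = f l (finv j (c + r')) - r' -> l != j -> r = r'.
  move=> E lj; set a := finv j (c + r) in E; set b := finv j (c + r') in E.
  have ea : f j a = c + r := finvK _ _; have eb : f j b = c + r' := finvK _ _.
  have ab : a = b.
    have [jl|lj'|e] := ltngtP j l; last by rewrite (val_inj e) eqxx in lj.
      by apply/eqP; rewrite eq_le -(fdle _ _ a b jl) -(fdle _ _ b a jl); apply/andP; split; lra.
    by apply/eqP; rewrite eq_le -(fdle _ _ a b lj') -(fdle _ _ b a lj'); apply/andP; split; lra.
  by rewrite ab eb in ea; lra.
rewrite /=; have kP := kind_ofP q.
have [->|nl] := eqVneq q (Some (l, true)); first by left; exists true.
have [->|nl'] := eqVneq q (Some (l, false)); first by left; exists false.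
right => c y r r'; case: (kind_of q) kP => [|j|j|j] kP /=.
- have mono s s' : s <= s' -> f l (Laminv y (c - s)) - s = f l (Laminv y (c - s')) - s' -> s = s'.
    move=> ss' E; have : f l (Laminv y (c - s')) <= f l (Laminv y (c - s)).
      by rewrite fle -(Lamle y) !LaminvK; lra.
    by lra.
  by move=> E; have [/mono|/ltW/mono] := leP r r'; [exact|move=> H; exact: esym (H (esym E))].
- move=> E; apply: (aux j c _ _ E); apply/eqP => lj; move: nl.
  by case: kP => _ ->; rewrite lj eqxx.
- move=> E; apply: (aux j c _ _ E); apply/eqP => lj; move: nl.
  by case: kP => _ ->; rewrite lj eqxx.
- move=> E; apply: (aux j c _ _ E); apply/eqP => lj; move: nl'.
  by case: kP => _ ->; rewrite lj eqxx.
Qed.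

End Geometry.

(** * Travel times of the continuum parameters *)

Section OneSidedDerivative.
Context {R : realType}.

Lemma fmap_near_eq (T U : Type) (F : set_system T) (f g : T -> U) : Filter F ->
  (\forall x \near F, f x = g x) -> f @ F = g @ F.
Proof.
move=> FF fg; apply/seteqP; split => B; rewrite /fmap/= => FB.
  by apply: filterS2 FB fg => z /= + <-.
by apply: filterS2 FB fg => z /= + ->.
Qed.

Lemma derive01_ext (f g : R -> R) (x : R) : (forall z, I01 z -> f z = g z) -> I01 x ->
  derive01 f x = derive01 g x.
Proof.
move=> fg x01; rewrite /derive01; congr (lim _); apply: fmap_near_eq.
by rewrite /prop_near1 nbhs_filterE /within/=; apply: filterE => z z01; rewrite /quot !fg.
Qed.

Lemma derivable01_cont (f : R -> R) : (forall x, I01 x -> derivable01 f x) -> cont01 f.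
Proof.
move=> df; apply/subspace_continuousP => x x01; apply/cvgrPdist_lt => e e0.
have /cvg_ex[/= l /cvgrPdist_lt/(_ 1 ltr01) Hq0] := df x x01.
have Hq : \forall z \near nbhs x, z != x -> I01 z -> `|l - quot f x z| < 1 by exact: Hq0.
have L0 : 0 < `|l| + 1 by rewrite ltr_wpDl.
have e1 : 0 < e / (`|l| + 1) by rewrite divr_gt0.
have Hd : \forall z \near nbhs x, `|x - z| < e / (`|l| + 1).
  by have /cvgrPdist_lt/(_ _ e1) := @cont_id R x.
suff : \forall z \near nbhs x, I01 z -> `|f x - f z| < e by [].
apply: filterS2 Hq Hd => z Hq Hd z01.
have [->|zx] := eqVneq z x; first by rewrite subrr normr0.
have {}Hq : `|l - quot f x z| < 1 by apply: Hq.
have -> : f x - f z = quot f x z * (x - z).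
  by rewrite /quot; field; rewrite subr_eq0.
rewrite normrM.
have hq : `|quot f x z| <= `|l| + 1.
  rewrite (_ : quot f x z = l - (l - quot f x z)); last ring.
  by apply: (le_trans (ler_normB _ _)); rewrite lerD2l ltW.
apply: (le_lt_trans (ler_wpM2r (normr_ge0 _) hq)).
by rewrite mulrC -ltr_pdivlMr.
Qed.

Lemma itv_gt0_min (g : R -> R) : continuous g -> (forall x, 0 <= x <= 1 -> 0 < g x) ->
  exists2 c, 0 < c & forall x, 0 <= x <= 1 -> c <= g x.
Proof.
move=> cg g0; have [x x01 Hx] := @EVT_min R g 0 1 ler01 (continuous_subspaceT cg).
rewrite in_itv/= in x01; exists (g x); first exact: g0.
by move=> y y01; apply: Hx; rewrite in_itv.
Qed.

Lemma fin_common (I : finType) (Q : I -> R -> Prop) :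
  (forall i, exists2 c, 0 < c & Q i c) ->
  (forall i (c c' : R), c' <= c -> Q i c -> Q i c') ->
  exists2 c, 0 < c & forall i, Q i c.
Proof.
move=> H mono.
suff [c c0 Hc] : exists2 c, 0 < c & forall i, i \in enum I -> Q i c.
  by exists c => // i; apply: Hc; rewrite mem_enum.
elim: (enum I) => [|i s [c c0 Hc]]; first by exists 1.
have [d d0 Hd] := H i; exists (Num.min c d); first by rewrite lt_min c0.
move=> j; rewrite inE => /predU1P[->|/Hc Qj].
  by apply: mono Hd; rewrite ge_min lexx orbT.
by apply: mono Qj; rewrite ge_min lexx.
Qed.

Lemma fin_bound (I : finType) (T : Type) (g : I -> T -> R) :
  (forall i, exists M, forall x, `|g i x| <= M) -> exists M, forall i x, `|g i x| <= M.
Proof.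
move=> H; suff [M HM] : exists M, forall i, i \in enum I -> forall x, `|g i x| <= M.
  by exists M => i; apply: HM; rewrite mem_enum.
elim: (enum I) => [|i s [M HM]]; first by exists 0.
have [N HN] := H i; exists (Num.max M N) => j; rewrite inE => /predU1P[-> x|/HM Mj x].
  by rewrite (le_trans (HN x))// le_max lexx orbT.
by rewrite (le_trans (Mj x))// le_max lexx.
Qed.

Lemma cl_cont01 (g : R -> R) : cont01 g -> continuous (fun x => g (cl x)).
Proof. by move=> cg; apply: (within_comp _ _ _ _ _ cg (@cont_cl R)) => x; exact: clI. Qed.

Lemma cl_cont01_2 (g : R -> R -> R) : cont01_2 g ->
  continuous (fun p : R * R => g (cl p.1) (cl p.2)).
Proof.
move=> cg; apply: (within_comp _ _ _ _ (fun p : R * R => (cl p.1, cl p.2)) cg).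
  apply: cont_pair; apply: (cont_comp _ _ _ _ _ (@cont_cl R)).
    exact: cont_fst (@cont_id _).
  exact: cont_snd (@cont_id _).
by move=> p; split; exact: clI.
Qed.

Lemma cl_cont01_3 (g : R -> R -> R -> R) : cont01_3 g ->
  continuous (fun p : R * R * R => g (cl p.1.1) (cl p.1.2) (cl p.2)).
Proof.
move=> cg; apply: (within_comp _ _ _ _ (fun p : R * R * R => (cl p.1.1, cl p.1.2, cl p.2)) cg).
  apply: cont_pair; first apply: cont_pair; apply: (cont_comp _ _ _ _ _ (@cont_cl R)).
  - exact: cont_fst (cont_fst _ _ _ _ (@cont_id _)).
  - exact: cont_snd (cont_fst _ _ _ _ (@cont_id _)).
  - exact: cont_snd (@cont_id _).
by move=> p; split; [split|]; exact: clI.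
Qed.

Lemma clK (x : R) : cl (cl x) = cl x.
Proof. by rewrite cl_id// cl01. Qed.

Lemma cont_bounded (V : topologicalType) (K : set V) (g : V -> R) : compact K -> continuous g ->
  exists B, forall x, K x -> `|g x| <= B.
Proof.
move=> cK cg; have /compact_bounded[B [_ HB]] := continuous_compact (continuous_subspaceT cg) cK.
by exists (B + 1) => x Kx; apply: (HB (B + 1)); [rewrite ltrDl|exists x].
Qed.

Lemma clamp_bounded1 (g : R -> R) : continuous (fun x => g (cl x)) ->
  exists B, forall x, `|g (cl x)| <= B.
Proof.
move=> cg; have [B HB] := itv_bounded _ cg; exists B => x.
by have := HB (cl x) (cl01 x); rewrite clK.
Qed.

Lemma clamp_bounded2 (g : R -> R -> R) : continuous (fun p : R * R => g (cl p.1) (cl p.2)) ->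
  exists B, forall p : R * R, `|g (cl p.1) (cl p.2)| <= B.
Proof.
move=> cg; have [|B HB] := @cont_bounded (R * R)%type ((@I01 R) `*` (@I01 R)) _ _ cg.
  by apply: compact_setX; exact: segment_compact.
exists B => p; have h := HB (cl p.1, cl p.2) (conj (clI _) (clI _)).
by rewrite /= !clK in h.
Qed.

Lemma clamp_bounded3 (g : R -> R -> R -> R) :
  continuous (fun p : R * R * R => g (cl p.1.1) (cl p.1.2) (cl p.2)) ->
  exists B, forall p : R * R * R, `|g (cl p.1.1) (cl p.1.2) (cl p.2)| <= B.
Proof.
move=> cg; have [|B HB] := @cont_bounded (R * R * R)%type ((@I01 R) `*` (@I01 R) `*` (@I01 R))
  _ _ cg.
  by apply: compact_setX; [apply: compact_setX|]; exact: segment_compact.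
exists B => p.
have h := HB (cl p.1.1, cl p.1.2, cl p.2) (conj (conj (clI _) (clI _)) (clI _)).
by rewrite /= !clK in h.
Qed.

End OneSidedDerivative.

Section ExtendedParameters.
Context {R : realType} {m : nat} (P : continuum_params R m).
Hypothesis JC : jointly_continuous P.
Hypothesis CA : continuum_assumption P.

Definition slowness (j : 'I_m) (x : R) : R := (c_mu P j (cl x))^-1.
(* On [0, 1] this is phi_j. *)
Definition travel (j : 'I_m) : R -> R := prim (slowness j).
Definition lam_slowness (y x : R) : R := (c_lam P (cl x) (cl y))^-1.
Definition lam_travel (y : R) : R -> R := prim (lam_slowness y).

Lemma mu_cont01 j : cont01 (c_mu P j).
Proof. by apply: derivable01_cont; have [[H _] _ _ _ _] := CA; case: (H j). Qed.

Lemma mu_lt (j k : 'I_m) : (j < k)%N -> forall x x', 0 <= x <= 1 -> 0 <= x' <= 1 ->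
  c_mu P k x' < c_mu P j x.
Proof.
have [_ _ _ _ [_ _ ord]] := CA.
suff H n : forall k : 'I_m, (k = n :> nat) -> (j < n)%N -> forall x x', 0 <= x <= 1 ->
  0 <= x' <= 1 ->
    c_mu P k x' < c_mu P j x by move=> jk; exact: (H k k erefl jk).
elim: n => [//|n IH] {}k kn; rewrite ltnS leq_eqVlt => /orP[/eqP jn|jn] x x' x01 x'01.
  by apply: ord; rewrite ?I01E ?kn ?jn.
have nm : (n < m)%N by rewrite -ltnS -kn ltnS ltnW// -kn.
have h1 := IH (Ordinal nm) erefl jn x x' x01 x'01.
by apply: lt_trans h1; apply: ord; rewrite ?I01E// kn.
Qed.

(** The slowest channel is bounded below by assumption, and the ordering passes its bound on to the
    others. *)
Lemma mu_gt0 : exists2 c : R, 0 < c & forall j x, 0 <= x <= 1 -> c <= c_mu P j x.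
Proof.
have [_ _ _ _ [[c c0 Hc] _ _]] := CA.
exists c => // j x x01.
have m0 : (m.-1 < m)%N by case: (m) j => [[]|].
have [jm|jm] := eqVneq (j.+1 : nat) m; first by apply: Hc; rewrite ?I01E.
have lastE : (m.-1).+1 = m by apply: prednK; case: (m) j {jm} => [[]|].
apply: (@le_trans _ _ (c_mu P (Ordinal m0) x)); first by apply: Hc; rewrite ?I01E.
apply/ltW/mu_lt => //=; rewrite -ltnS lastE ltn_neqAle jm.
exact: ltn_ord.
Qed.

Lemma mu_pos j x : 0 <= x <= 1 -> 0 < c_mu P j x.
Proof. by have [c c0 H] := mu_gt0 => x01; exact: lt_le_trans c0 (H j x x01). Qed.

Lemma mu_cl_cont j : continuous (fun x => c_mu P j (cl x)).
Proof. by apply: cl_cont01; exact: mu_cont01. Qed.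

Lemma slowness_cont j : continuous (slowness j).
Proof.
by apply: contV; [exact: mu_cl_cont|move=> x; rewrite gt_eqF// mu_pos// cl01].
Qed.

Lemma travel_phi j x : 0 <= x <= 1 -> phi (c_mu P) j x = travel j x.
Proof.
move=> x01; rewrite /phi /travel /prim cl_id// subrr mul0r addr0.
apply: eq_Rintegral => s; rewrite inE/= in_itv/= => /andP[s0 sx].
by rewrite /slowness cl_id// s0 (le_trans sx)//; case/andP: x01.
Qed.

Lemma travel_derive j (x : R) : 0 < x < 1 -> is_derive x (1 : R) (travel j) (c_mu P j x)^-1.
Proof.
move=> x01; have := prim_derive _ x (slowness_cont j) x01.
by rewrite /slowness cl_id//; case/andP: x01 => ? ?; rewrite !ltW.
Qed.

Lemma lam_pos : exists2 c : R, 0 < c & forall x y, 0 <= x <= 1 -> 0 <= y <= 1 -> c <= c_lam P x y.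
Proof.
have [_ _ _ _ [_ [c c0 Hc] _]] := CA.
by exists c => // x y x01 y01; apply: Hc; rewrite I01E.
Qed.

Lemma lam_gt0 x y : 0 <= x <= 1 -> 0 <= y <= 1 -> 0 < c_lam P x y.
Proof. by have [c c0 H] := lam_pos => h h'; exact: lt_le_trans c0 (H _ _ h h'). Qed.

Lemma lam_cl_cont : continuous (fun p : R * R => c_lam P (cl p.1) (cl p.2)).
Proof. by apply: cl_cont01_2; have [H _ _ _ _] := JC. Qed.

Lemma lam_slowness_cont : continuous (fun p : R * R => lam_slowness p.1 p.2).
Proof.
apply: contV; last by move=> p; rewrite gt_eqF// lam_gt0 ?cl01.
exact: (cont_comp _ _ _ (fun p : R * R => (p.2, p.1)) _ lam_cl_cont
  (cont_pair _ _ _ _ _ (cont_snd _ _ _ _ (@cont_id _)) (cont_fst _ _ _ _ (@cont_id _)))).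
Qed.

Lemma lam_slowness_cont1 y : continuous (lam_slowness y).
Proof.
exact: (cont_comp _ _ _ (fun x => (y, x)) _ lam_slowness_cont
  (cont_pair _ _ _ _ _ (@cont_cst _ _ y) (@cont_id _))).
Qed.

Lemma lam_slowness_bounded : exists B, forall y x, `|lam_slowness y x| <= B.
Proof.
have [c c0 Hc] := lam_pos; exists c^-1 => y x.
have h := Hc _ _ (cl01 x) (cl01 y).
have l0 : 0 < c_lam P (cl x) (cl y) := lt_le_trans c0 h.
by rewrite /lam_slowness ger0_norm ?invr_ge0 ?(ltW l0)// lef_pV2 ?posrE.
Qed.

Lemma lam_travel_cont : continuous (fun p : R * R => lam_travel p.1 p.2).
Proof.
by have [B HB] := lam_slowness_bounded; exact: prim_family lam_slowness_cont HB.
Qed.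

Lemma lam_travel_derive y (x : R) : 0 <= y <= 1 -> 0 < x < 1 ->
  is_derive x (1 : R) (lam_travel y) (c_lam P x y)^-1.
Proof.
move=> y01 x01; have -> : (c_lam P x y)^-1 = lam_slowness y x.
  by rewrite /lam_slowness (cl_id y)// cl_id//; case/andP: x01 => ? ?; rewrite !ltW.
exact: prim_derive (lam_slowness_cont1 y) x01.
Qed.

(** All three are primitives of functions with a positive lower bound on [0, 1]: the slownesses,
    their differences by the strict ordering of the speeds, and 1/lambda because lambda is
    bounded. *)
Lemma travel_slope : exists2 c : R, 0 < c &
  [/\ forall j (a b : R), a <= b -> c * (b - a) <= travel j b - travel j a,
      forall j l : 'I_m, (j < l)%N -> forall a b : R, a <= b ->
        c * (b - a) <= (travel l b - travel j b) - (travel l a - travel j a) &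
      forall y (a b : R), a <= b -> c * (b - a) <= lam_travel y b - lam_travel y a].
Proof.
have mono (d c c' a b : R) : a <= b -> c' <= c -> c * (b - a) <= d -> c' * (b - a) <= d.
  by move=> ab cc; apply: le_trans; rewrite ler_wpM2r// subr_ge0.
have [c1 c10 H1] : exists2 c, 0 < c & forall j (a b : R), a <= b ->
  c * (b - a) <= travel j b - travel j a.
  apply: (@fin_common R _ (fun j c => forall a b : R, a <= b ->
    c * (b - a) <= travel j b - travel j a)).
    move=> j; have [|c c0 Hc] := itv_gt0_min _ (slowness_cont j).
      by move=> x x01; rewrite invr_gt0 mu_pos// cl01.
    by exists c => // a b; exact: prim_ge (slowness_cont j) Hc _ _.
  by move=> j c c' cc H a b ab; apply: (mono _ _ _ _ _ ab cc); exact: H.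
have [c2 c20 H2] : exists2 c, 0 < c & forall jl : 'I_m * 'I_m, (jl.1 < jl.2)%N ->
  forall a b : R, a <= b ->
    c * (b - a) <= (travel jl.2 b - travel jl.1 b) - (travel jl.2 a - travel jl.1 a).
  apply: (@fin_common R ('I_m * 'I_m)%type (fun jl c => (jl.1 < jl.2)%N -> forall a b : R, a <= b ->
    c * (b - a) <= (travel jl.2 b - travel jl.1 b) - (travel jl.2 a - travel jl.1 a))).
    move=> [j l] /=; have [jl|_] := boolP (j < l)%N; last by exists 1.
    pose g x := 1 * slowness l x + (-1) * slowness j x.
    have cg : continuous g.
      by apply: contD; apply: contM; [exact: cont_cst|exact: slowness_cont|exact:
        cont_cst|exact: slowness_cont].
    have [|c c0 Hc] := itv_gt0_min _ cg.
      move=> x x01; rewrite /g mul1r mulN1r subr_gt0 ltf_pV2 ?posrE ?mu_pos ?cl01//.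
      by apply: mu_lt; rewrite ?cl01.
    exists c => // _ a b ab; have := prim_ge _ _ cg Hc _ _ ab.
    by rewrite /g !prim_lin; [rewrite /travel; lra|exact: slowness_cont..].
  by move=> jl c c' cc H jll a b ab; apply: (mono _ _ _ _ _ ab cc); exact: H.
have [B HB] := clamp_bounded2 _ lam_cl_cont.
have B0 : 0 <= B := le_trans (normr_ge0 _) (HB (0, 0)).
have B1 : 0 < B + 1 by rewrite ltr_wpDl.
exists (Num.min (Num.min c1 c2) (B + 1)^-1); first by rewrite !lt_min c10 c20 invr_gt0.
split.
- move=> j a b ab; apply: (mono _ _ _ _ _ ab _ (H1 j a b ab)).
  by rewrite !ge_min lexx.
- move=> j l jl a b ab; apply: (mono _ _ _ _ _ ab _ (H2 (j, l) jl a b ab)).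
  by rewrite !ge_min lexx !orbT.
- move=> y a b ab; apply: (mono _ (B + 1)^-1 _ _ _ ab); first by rewrite ge_min lexx orbT.
  apply: (prim_ge _ _ (lam_slowness_cont1 y) _ _ _ ab) => x x01.
  rewrite /lam_slowness lef_pV2 ?posrE ?lam_gt0 ?cl01//.
  by apply: (le_trans (ler_norm _)); apply: (le_trans (HB (x, y))); rewrite lerDl.
Qed.

Lemma speed_gap (i : 'I_m) : exists a b : R, [/\ 0 < a, a < b,
  forall j : 'I_m, (i <= j)%N -> forall x, 0 <= x <= 1 -> c_mu P j x <= a &
  forall j : 'I_m, (j < i)%N -> forall x, 0 <= x <= 1 -> b <= c_mu P j x].
Proof.
have [x x01 Hx] := @EVT_max R _ 0 1 ler01 (continuous_subspaceT (mu_cl_cont i)).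
rewrite in_itv/= in x01; pose a := c_mu P i (cl x).
have Ha y : 0 <= y <= 1 -> c_mu P i y <= a.
  by move=> y01; have := Hx y; rewrite in_itv/= cl_id//; exact.
have a0 : 0 < a by apply: mu_pos; exact: cl01.
have Hge (j : 'I_m) : (i <= j)%N -> forall y, 0 <= y <= 1 -> c_mu P j y <= a.
  rewrite leq_eqVlt => /orP[/eqP/val_inj <- //|ij] y y01.
  exact: le_trans (ltW (mu_lt _ _ ij y y y01 y01)) (Ha y y01).
have [i0|i0] := posnP i.
  (* For the fastest row there is no faster channel, and any number above [a] will do. *)
  by exists a, (a + 1); split => //; [rewrite ltrDl|move=> j; rewrite i0].
have im : (i.-1 < m)%N by rewrite (leq_ltn_trans (leq_pred _))//.
pose k := Ordinal im.
have [z z01 Hz] := @EVT_min R _ 0 1 ler01 (continuous_subspaceT (mu_cl_cont k)).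
rewrite in_itv/= in z01.
exists a, (c_mu P k (cl z)); split => //.
  by apply: mu_lt; rewrite ?cl01//= prednK.
move=> j ji y y01.
have Hk : c_mu P k (cl z) <= c_mu P k y by have := Hz y; rewrite in_itv/= (cl_id y)//; exact.
have : (j <= k)%N by rewrite /= -ltnS prednK.
rewrite leq_eqVlt => /orP[/eqP/val_inj -> //|jk].
exact: le_trans Hk (ltW (mu_lt _ _ jk y y y01 y01)).
Qed.

(** With kap = 2 / (a + b) and eps = (b - a) / (a + b) one has kap * a = 1 - eps and kap * b = 1 +
    eps: speeds up to [a] lie below 1/kap and speeds from [b] on above it, with the same relative
    margin. *)
Lemma travel_rates (i : 'I_m) : exists kap eps : R, [/\ 0 <= kap, 0 < eps, eps <= 1,
  forall j : 'I_m, (i <= j)%N -> forall a b, a <= b ->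
    kap * (b - a) <= (1 - eps) * (travel j b - travel j a) &
  forall j : 'I_m, (j < i)%N -> forall a b, a <= b ->
    (1 + eps) * (travel j b - travel j a) <= kap * (b - a)].
Proof.
have [a [b [a0 ab Ha Hb]]] := speed_gap i.
have b0 : 0 < b by lra.
have s0 : 0 < a + b by lra.
exists (2 / (a + b)), ((b - a) / (a + b)); split.
- by rewrite divr_ge0// ltW.
- by rewrite divr_gt0// subr_gt0.
- by rewrite ler_pdivrMr//; lra.
- move=> j ij x y xy.
  have hs s : 0 <= s <= 1 -> a^-1 <= slowness j s.
    by move=> s01; rewrite /slowness lef_pV2 ?posrE ?mu_pos ?cl01// Ha// cl01.
  have h := prim_ge _ _ (slowness_cont j) hs x y xy.
  have -> : 1 - (b - a) / (a + b) = 2 / (a + b) * a by field; rewrite gt_eqF.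
  rewrite -[leRHS]mulrA ler_wpM2l ?divr_ge0 ?(ltW s0)//.
  by rewrite mulrC -ler_pdivrMr// mulrC.
- move=> j ji x y xy.
  have hs s : 0 <= s <= 1 -> slowness j s <= b^-1.
    by move=> s01; rewrite /slowness lef_pV2 ?posrE ?mu_pos ?cl01// Hb// cl01.
  have h := prim_le _ _ (slowness_cont j) hs x y xy.
  have -> : 1 + (b - a) / (a + b) = 2 / (a + b) * b by field; rewrite gt_eqF.
  rewrite -[leLHS]mulrA ler_wpM2l ?divr_ge0 ?(ltW s0)//.
  by rewrite mulrC -ler_pdivlMr// mulrC.
Qed.

End ExtendedParameters.

(** * Inverse travel times and the segments *)

Section Inverses.
Context {R : realType} {m : nat} (P : continuum_params R m).
Hypothesis JC : jointly_continuous P.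
Hypothesis CA : continuum_assumption P.

(** What the geometric section assumes for row [i], with the inverse functions as data so that all
    lemmas speak of the same ones. *)
Record setup (i : 'I_m) (kap eps c0 : R) (finv : 'I_m -> R -> R) (Laminv zK : R -> R -> R)
    (zd : 'I_m -> R -> R) : Prop := Setup {
  su_c0 : 0 < c0;
  su_eps : 0 < eps;
  su_eps1 : eps <= 1;
  su_kap : 0 <= kap;
  su_slope : forall j (a b : R), a <= b -> c0 * (b - a) <= travel P j b - travel P j a;
  su_dslope : forall j l : 'I_m, (j < l)%N -> forall a b : R, a <= b ->
    c0 * (b - a) <= (travel P l b - travel P j b) - (travel P l a - travel P j a);
  su_lslope : forall y (a b : R), a <= b -> c0 * (b - a) <= lam_travel P y b - lam_travel P y a;
  su_slow : forall j : 'I_m, (i <= j)%N -> forall a b : R, a <= b ->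
    kap * (b - a) <= (1 - eps) * (travel P j b - travel P j a);
  su_fast : forall j : 'I_m, (j < i)%N -> forall a b : R, a <= b ->
    (1 + eps) * (travel P j b - travel P j a) <= kap * (b - a);
  su_finvK : forall j v, travel P j (finv j v) = v;
  su_fK : forall j z, finv j (travel P j z) = z;
  su_finv_cont : forall j, continuous (finv j);
  su_LaminvK : forall y v, lam_travel P y (Laminv y v) = v;
  su_LamK : forall y z, Laminv y (lam_travel P y z) = z;
  su_Laminv_cont : continuous (fun p : R * R => Laminv p.1 p.2);
  su_zKE : forall y c, travel P i (zK y c) + lam_travel P y (zK y c) = c;
  su_zK_cont : continuous (fun p : R * R => zK p.1 p.2);
  su_zdE : forall j : 'I_m, j != i -> forall c, travel P j (zd j c) - travel P i (zd j c) = c;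
  su_zd_cont : forall j : 'I_m, j != i -> continuous (zd j)
}.

Lemma travel_cont j : continuous (travel P j).
Proof. by apply: prim_cont; exact: slowness_cont. Qed.

Lemma travel0 j : travel P j 0 = 0. Proof. exact: prim0. Qed.

Lemma lam_travel_cont1 y : continuous (lam_travel P y).
Proof. by apply: prim_cont; exact: lam_slowness_cont1. Qed.

Lemma setup_exists i : exists kap eps c0 finv Laminv zK zd, setup i kap eps c0 finv Laminv zK zd.
Proof.
have [c0 c00 [H1 H2 H3]] := travel_slope P JC CA.
have [kap [eps [k0 e0 e1 Hs Hf]]] := travel_rates P CA i.
have inv1 (g : R -> R) : continuous g -> (forall a b : R, a <= b -> c0 * (b - a) <= g b - g a) ->
    exists h : R -> R, [/\ forall v, g (h v) = v, forall z, h (g z) = z & continuous h].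
  move=> cg sg; have [||G [GK KG cG]] := inverse_family R (fun _ : R => g) c0 c00 _ _ (fun _ => sg).
  - by [].
  - by move=> z; exact: cont_cst.
  exists (G 0); split => //.
  exact: (cont_comp _ _ _ (fun v : R => (0,
    v)) _ cG (cont_pair _ _ _ _ _ (@cont_cst _ _ 0) (@cont_id _))).
have /choice[finv Hfinv] j := inv1 (travel P j) (travel_cont j) (H1 j).
have cLy z : continuous (fun y => lam_travel P y z).
  exact: (cont_comp _ _ _ (fun y : R => (y,
    z)) _ (lam_travel_cont P JC CA) (cont_pair _ _ _ _ _ (@cont_id _) (@cont_cst _ _ z))).
have [Laminv [L1 L2 L3]] := inverse_family R (lam_travel P) c0 c00 lam_travel_cont1 cLy H3.
have [||| zK [Z1 Z2 Z3]] := inverse_family R (fun y z => travel P i z + lam_travel P y z) c0 c00.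
- by move=> y; apply: contD; [exact: travel_cont|exact: lam_travel_cont1].
- by move=> z; apply: contD; [exact: cont_cst|exact: cLy].
- move=> y a b ab; have := H3 y a b ab; have := H1 i a b ab.
  by have := mulr_ge0 (ltW c00) (_ : 0 <= b - a); rewrite subr_ge0 => /(_ ab); lra.
have /choice[zd Hzd] j : exists z : R -> R, j != i ->
    (forall c, travel P j (z c) - travel P i (z c) = c) /\ continuous z.
  have cd (a b : 'I_m) : continuous (fun z => travel P a z - travel P b z).
    by apply: contB; exact: travel_cont.
  have [ji|ij|e] := ltngtP j i.
  (* For j < i the function to be inverted decreases, so its negative is inverted. *)
  - have [h [h1 _ h3]] := inv1 _ (cd i j) (H2 _ _ ji); exists (fun c => h (- c)) => _; split.
      by move=> c; have := h1 (- c); lra.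
    exact: (cont_comp _ _ _ _ _ h3 (contN _ (@cont_id _))).
  - have [h [h1 _ h3]] := inv1 _ (cd j i) (H2 _ _ ij); exists h => _; split => //.
  - by exists id; rewrite (val_inj e) eqxx.
exists kap, eps, c0, finv, Laminv, zK, zd; split => //.
- by move=> j v; have [] := Hfinv j.
- by move=> j v; have [] := Hfinv j.
- by move=> j; have [] := Hfinv j.
- by move=> j ji c; have [] := Hzd j ji.
- by move=> j ji; have [] := Hzd j ji.
Qed.

Lemma travel_le j (a b : R) : (travel P j a <= travel P j b) = (a <= b).
Proof.
have [c0 c00 [H1 _ _]] := travel_slope P JC CA.
by apply: (fle (travel P) c0).
Qed.

Lemma travel_index_le (j l : 'I_m) (x : R) : (j <= l)%N -> 0 <= x -> travel P j x <= travel P l x.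
Proof.
have [c0 c00 [_ H2 _]] := travel_slope P JC CA.
by apply: (fle_index (travel P) c0) => // k; exact: travel0.
Qed.

(** [pinv] is a true inverse here because phi_q is injective on [0, 1] and, as i <= q, takes the
    value phi_i x there. *)
Lemma rho_channel (i q : 'I_m) x : (i <= q)%N -> 0 <= x <= 1 ->
  0 <= rho (c_mu P) i q x <= 1 /\ travel P q (rho (c_mu P) i q x) = travel P i x.
Proof.
move=> iq /andP[x0 x1]; have [kap [eps [c0 [finv [Laminv [zK [zd SU]]]]]]] := setup_exists i.
have fK := su_finvK _ _ _ _ _ _ _ _ SU.
have z0 : 0 <= finv q (travel P i x).
  by rewrite -(travel_le q) fK travel0 -(travel0 i) travel_le.
have z1 : finv q (travel P i x) <= 1.
  by rewrite -(travel_le q) fK (le_trans (travel_index_le _ _ _ iq x0))// travel_le.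
have -> : rho (c_mu P) i q x = finv q (travel P i x).
  rewrite /rho valK travel_phi ?x0// -{1}(fK q (travel P i x)) -travel_phi ?z0//.
  apply: pinvKV; last by rewrite inE I01E z0.
  move=> a b; rewrite !inE !I01E => a01 b01; rewrite !travel_phi// => ab.
  by apply/eqP; rewrite eq_le -(travel_le q) ab lexx -(travel_le q) ab lexx.
by rewrite z0 z1 fK.
Qed.

Lemma rho_last (i : 'I_m) (p : nat) x : p = m -> rho (c_mu P) i p x = 0.
Proof. by move=> ->; rewrite /rho insubF// ltnn. Qed.

(** Asking the lower inequality of all later channels, not only of the next one, is the same by
    [travel_index_le]; in this form the last segment is no special case. *)
Lemma TsegP (i p : 'I_m) x xi : (i <= p)%N -> Tseg (c_mu P) i p (x, xi) <->
  [/\ 0 <= x <= 1, 0 <= xi <= 1, travel P p xi <= travel P i x &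
      forall l : 'I_m, (p < l)%N -> travel P i x <= travel P l xi].
Proof.
move=> ip; have h1 z x' : 0 <= x' <= 1 ->
  (z <= rho (c_mu P) i p x') = (travel P p z <= travel P i x').
  by move=> x01; have [_ <-] := rho_channel i p x' ip x01; rewrite travel_le.
have [pm|pm] := eqVneq p.+1 m.
  rewrite /Tseg /= !I01E (rho_last _ _ _ pm); split.
    move=> [x01 xi01 /andP[_ h]]; split => //; first by rewrite -h1.
    by move=> l pl; have := ltn_ord l; rewrite -{2}pm ltnS leqNgt pl.
  by move=> [x01 xi01 h _]; split => //; rewrite h1// h andbT; case/andP: xi01.
have pm' : (p.+1 < m)%N by rewrite ltn_neqAle pm ltn_ord.
pose q := Ordinal pm'; have iq : (i <= q)%N by rewrite leqW.
have h2 x' z : 0 <= x' <= 1 -> (rho (c_mu P) i p.+1 x' <= z) = (travel P i x' <= travel P q z).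
  move=> x01; rewrite -[p.+1]/(q : nat).
  by have [_ <-] := rho_channel i q x' iq x01; rewrite travel_le.
rewrite /Tseg /= !I01E; split.
  move=> [x01 xi01 /andP[]]; rewrite h1// h2// => ha hb; split => // l pl.
  by apply: (le_trans ha); apply: travel_index_le => //; case/andP: xi01.
move=> [x01 xi01 ha hb]; split => //; rewrite h1// h2// ha andbT.
by apply: hb => /=.
Qed.

(** F has the derivative 1/g only inside ]0, 1[. By the mean value theorem X is strictly monotone,
    so it can touch 0 or 1 only at the ends of the time interval; in between, F composed with X has
    derivative [sg]. *)
Lemma char_travel (g F X : R -> R) (sg a b : R) : a <= b -> sg = 1 \/ sg = -1 ->
  continuous F -> (forall x : R, 0 < x < 1 -> is_derive x (1 : R) F (g x)^-1) ->
  (forall x, 0 <= x <= 1 -> 0 < g x) ->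
  {within `[a, b], continuous X} -> (forall s, a <= s <= b -> 0 <= X s <= 1) ->
  (forall s, s \in `]a, b[ -> is_derive s (1 : R) X (sg * g (X s))) ->
  forall s, a <= s <= b -> F (X s) = F (X a) + sg * (s - a).
Proof.
move=> ab sgE cF dF g0 cX X01 dX s /andP[].
rewrite le_eqVlt => /predU1P[<- _|as_ sb]; first by rewrite subrr mulr0 addr0.
have sub (u v : R) : a <= u -> v <= b -> {within `[u, v], continuous X}.
  move=> au vb; apply: continuous_subspaceW cX => z; rewrite /= !in_itv/= => /andP[? ?].
  by apply/andP; split; lra.
have incr (u v : R) : a <= u -> u < v -> v <= b -> exists2 d, 0 < d & X v - X u = sg * d.
  move=> au uv vb.
  have dXuv z : z \in `]u, v[ -> is_derive z (1 : R) X (sg * g (X z)).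
    rewrite in_itv/= => /andP[? ?]; apply: dX; rewrite in_itv/=.
    by apply/andP; split; lra.
  have [c] := @MVT R X (fun z => sg * g (X z)) u v uv dXuv (sub u v au vb).
  rewrite in_itv/= => /andP[uc cv] ->; exists (g (X c) * (v - u)); last by rewrite mulrA.
  by rewrite mulr_gt0 ?subr_gt0// g0// X01//; apply/andP; split; lra.
have inner z : a < z < b -> 0 < X z < 1.
  move=> /andP[az zb]; have [d d0 E] := incr a z (lexx _) az (ltW zb).
  have [d' d'0 E'] := incr z b (ltW az) zb (lexx _).
  have aab : a <= a <= b by rewrite lexx ab.
  have bab : a <= b <= b by rewrite lexx ab.
  have /andP[? ?] := X01 a aab; have /andP[? ?] := X01 b bab.
  by case: sgE => e; rewrite e in E E'; apply/andP; split; lra.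
have cFX : {within `[a, s], continuous (fun z => F (X z))}.
  move=> z; apply: continuous_comp; [exact: sub|exact: cF].
suff dFX z : z \in `]a, s[ -> is_derive z (1 : R) (fun z => F (X z)) sg.
  by have [c _ E] := @MVT R (fun z => F (X z)) (fun=> sg) a s as_ dFX cFX; lra.
rewrite in_itv/= => /andP[az zs].
have zab : z \in `]a, b[ by rewrite in_itv/= az (lt_le_trans zs).
have X1 : 0 < X z < 1 by apply: inner; rewrite az (lt_le_trans zs).
have dX' := dX z zab; have dF' := dF _ X1.
have -> : sg = (g (X z))^-1 * (sg * g (X z)).
  by rewrite mulrCA mulVf ?mulr1// gt_eqF// g0//; case/andP: X1 => ? ?; rewrite !ltW.
exact: is_derive1_comp.
Qed.

End Inverses.

Arguments su_c0 {R m P i kap eps c0 finv Laminv zK zd}.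
Arguments su_eps {R m P i kap eps c0 finv Laminv zK zd}.
Arguments su_eps1 {R m P i kap eps c0 finv Laminv zK zd}.
Arguments su_kap {R m P i kap eps c0 finv Laminv zK zd}.
Arguments su_slope {R m P i kap eps c0 finv Laminv zK zd}.
Arguments su_dslope {R m P i kap eps c0 finv Laminv zK zd}.
Arguments su_lslope {R m P i kap eps c0 finv Laminv zK zd}.
Arguments su_slow {R m P i kap eps c0 finv Laminv zK zd}.
Arguments su_fast {R m P i kap eps c0 finv Laminv zK zd}.
Arguments su_finvK {R m P i kap eps c0 finv Laminv zK zd}.
Arguments su_fK {R m P i kap eps c0 finv Laminv zK zd}.
Arguments su_finv_cont {R m P i kap eps c0 finv Laminv zK zd}.
Arguments su_LaminvK {R m P i kap eps c0 finv Laminv zK zd}.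
Arguments su_LamK {R m P i kap eps c0 finv Laminv zK zd}.
Arguments su_Laminv_cont {R m P i kap eps c0 finv Laminv zK zd}.
Arguments su_zKE {R m P i kap eps c0 finv Laminv zK zd}.
Arguments su_zK_cont {R m P i kap eps c0 finv Laminv zK zd}.
Arguments su_zdE {R m P i kap eps c0 finv Laminv zK zd}.
Arguments su_zd_cont {R m P i kap eps c0 finv Laminv zK zd}.

(** * The kernel equations as a system along characteristics *)

Section KernelSystem.
Context {R : realType} {m : nat} (P : continuum_params R m) (l : 'I_m -> 'I_m -> R -> R).
Hypothesis JC : jointly_continuous P.
Hypothesis CA : continuum_assumption P.
Hypothesis AL : admissible_l P l.
Variables (i : 'I_m) (kap eps c0 : R) (finv : 'I_m -> R -> R) (Laminv zK : R -> R -> R)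
  (zd : 'I_m -> R -> R).
Hypothesis SU : setup P i kap eps c0 finv Laminv zK zd.
Notation mu := (@lebesgue_measure R).

Definition kgeo : @characteristics R m :=
  geo i (travel P) (lam_travel P) kap eps finv Laminv zK zd.

Lemma kgeo_axioms : char_axioms kgeo.
Proof.
case: SU => *; apply: (@geo_axioms R m i (travel P) (lam_travel P) kap eps c0) => //.
- exact: travel0.
- exact: travel_cont.
- exact: lam_travel_cont.
Qed.

Definition diagK (x y : R) : R := - (c_th P i x y / (c_lam P x y + c_mu P i x)).
Definition diagL (j : 'I_m) (x : R) : R := - (c_psi P i j x / (c_mu P i x - c_mu P j x)).

(* For j < i a characteristic of L_j leaves through the diagonal or through x = 1.
   The sum of the two boundary values, minus their common value at the corner, is
   a continuous expression for the datum because the clampings freeze the other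
   value at the corner. *)
Definition kcoefs : @coefficients R m := {|
  cZ := fun q p => if q is Some (j, _) then - derive01 (c_mu P j) (cl p.1)
                   else derive01 (c_lam P ^~ (cl p.2)) (cl p.1);
  cA := fun q k p => if q is Some (j, _) then c_psi P k j (cl p.1) else c_th P k (cl p.1) (cl p.2);
  cS := fun q p => if q is Some (j, _) then c_W P j (cl p.1.1) (cl p.1.2)
                   else c_sig P (cl p.1.1) (cl p.1.2) (cl p.2);
  cB := fun q eta => if q is Some (j, _)
                   then (c_mu P j 0)^-1 * (c_lam P 0 (cl eta) * c_Q P j (cl eta)) else 0;
  cb := fun q p => match kind_of i q with
    | KK => if q is None then diagK (cl (zK p.2 p.1)) (cl p.2) else 0
    | KL j => 0
    | KR j => diagL j (cl (zd j p.1)) + l i j (cl (finv j (p.1 + travel P i 1))) - diagL j 1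
    | KU j => diagL j (cl (zd j p.1))
    end |}.

Lemma diagK_cont : continuous (fun p : R * R => diagK (cl p.1) (cl p.2)).
Proof.
have [_ _ _ cth _] := JC; apply: contN; apply: contM; first exact: (cl_cont01_2 _ (cth i)).
apply: contV; last first.
  by move=> p; rewrite gt_eqF// addr_gt0 ?lam_gt0 ?mu_pos ?cl01.
apply: contD; first exact: lam_cl_cont.
exact: (cont_comp _ _ _ _ _ (mu_cl_cont P CA i) (cont_fst _ _ _ _ (@cont_id _))).
Qed.

Lemma diagL_cont j : j != i -> continuous (fun x => diagL j (cl x)).
Proof.
move=> ji; have [_ _ [_ _] [cpsi _] _] := CA; apply: contN; apply: contM;
  first exact: (cl_cont01 _ (cpsi i j)).
apply: contV; first by apply: contB; exact: mu_cl_cont.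
move=> x; rewrite subr_eq0; have [jl|jl|e] := ltngtP j i; last by rewrite (val_inj e) eqxx in ji.
  by rewrite lt_eqF// (mu_lt P CA) ?cl01.
by rewrite gt_eqF// (mu_lt P CA) ?cl01.
Qed.

Lemma continuum_cont_psi k j : continuous (fun x => c_psi P k j (cl x)).
Proof. by have [_ _ _ [H _] _] := CA; exact: (cl_cont01 _ (H k j)). Qed.

Lemma kcoefs_bounded : exists M, coef_axioms kgeo kcoefs M.
Proof.
have [[C1mu [_ _ C1lam _]] _ _ [Cpsi psi0] _] := CA; have [_ Csig CW Cth CQ] := JC.
have c1 : continuous (fun p : R * R => p.1) by exact: cont_fst (@cont_id _).
have c2 : continuous (fun p : R * R => p.2) by exact: cont_snd (@cont_id _).
have cZc q : continuous (cZ kcoefs q).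
  case: q => [[j b]|] /=; last exact: (cl_cont01_2 _ C1lam).
  apply: contN; have [_ cd] := C1mu j; exact: (cont_comp _ _ _ _ _ (cl_cont01 _ cd) c1).
have cAc q k : continuous (cA kcoefs q k).
  case: q => [[j b]|] /=; last exact: (cl_cont01_2 _ (Cth k)).
  exact: (cont_comp _ _ _ _ _ (continuum_cont_psi k j) c1).
have cSc q : continuous (cS kcoefs q).
  case: q => [[j b]|] /=; last exact: (cl_cont01_3 _ Csig).
  exact: (cont_comp _ _ _ _ _ (cl_cont01_2 _ (CW j)) (cont_fst _ _ _ _ (@cont_id _))).
have cBc q : continuous (cB kcoefs q).
  case: q => [[j b]|] /=; last exact: cont_cst.
  apply: contM; first exact: cont_cst; apply: contM; last exact: (cl_cont01 _ (CQ j)).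
  have := cont_comp _ _ _ _ _ (lam_cl_cont P JC) (cont_pair _ _ _ _ _ (@cont_cst _ _ 0)
    (@cont_id R)).
  by rewrite /= (cl_id 0) ?lexx ?ler01.
have nji j b : kind_of i (Some (j, b)) = KR j \/ kind_of i (Some (j, b)) = KU j -> j != i.
  move=> h; apply/eqP => e; move: h; rewrite e /=; case: b; rewrite ?leqnn ?ltnn; case => //.
have cbc q : continuous (cb kcoefs q).
  have kP := kind_ofP i q; rewrite /=; case E : (kind_of i q) kP => [|j|j|j] kP.
  - case: q {E kP} => [?|]; first exact: cont_cst.
    apply: (cont_comp _ _ _ (fun p : R * R => (zK p.2 p.1, p.2)) _ diagK_cont).
    apply: cont_pair => //.
    exact: (cont_comp _ _ _ (fun p : R * R => (p.2,
      p.1)) _ (su_zK_cont SU) (cont_pair _ _ _ _ _ c2 c1)).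
  - exact: cont_cst.
  - have [ji qE] := kP; have ji' : j != i by apply: (nji j true); left; rewrite -qE.
    have [cl _] := AL _ _ ji.
    apply: contB; last exact: cont_cst; apply: contD.
      exact: (cont_comp _ _ _ _ _ (diagL_cont j ji') (cont_comp _ _ _ _ _ (su_zd_cont SU j ji')
        c1)).
    apply: (cont_comp _ _ _ _ _ (cl_cont01 _ cl)).
    apply: (cont_comp _ _ _ _ _ (su_finv_cont SU j)).
    by apply: contD => //; exact: cont_cst.
  - have [ij qE] := kP; have ji' : j != i by apply: (nji j false); right; rewrite -qE.
    exact: (cont_comp _ _ _ _ _ (diagL_cont j ji') (cont_comp _ _ _ _ _ (su_zd_cont SU j ji') c1)).
have [M1 H1] : exists M, forall q p, `|cZ kcoefs q p| <= M.
  apply: fin_bound => -[[j b]|] /=; last exact: (clamp_bounded2 _ (cl_cont01_2 _ C1lam)).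
  have [_ cd] := C1mu j; have [B HB] := clamp_bounded1 _ (cl_cont01 _ cd).
  by exists B => p; rewrite normrN.
have [M2 H2] : exists M, forall (qk : @channel m * 'I_m) p, `|cA kcoefs qk.1 qk.2 p| <= M.
  apply: (fin_bound (@channel m * 'I_m)%type) => -[[[j b]|] k] /=;
    last exact: (clamp_bounded2 _ (cl_cont01_2 _ (Cth k))).
  have [B HB] := clamp_bounded1 _ (continuum_cont_psi k j).
  by exists B => p.
have [M3 H3] : exists M, forall q p, `|cS kcoefs q p| <= M.
  apply: fin_bound => -[[j b]|] /=; last exact: (clamp_bounded3 _ (cl_cont01_3 _ Csig)).
  have [B HB] := clamp_bounded2 _ (cl_cont01_2 _ (CW j)).
  by exists B => p; exact: HB.
have [M4 H4] : exists M, forall q p, `|cB kcoefs q p| <= M.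
  apply: fin_bound => q; have := cBc q; case: q => [[j b]|] /=; last by exists 0 => x;
    rewrite normr0.
  exact: (@clamp_bounded1 R (fun x => (c_mu P j 0)^-1 * (c_lam P 0 x * c_Q P j x))).
have [M5 H5] : exists M, forall q p, `|cb kcoefs q p| <= M.
  apply: fin_bound => q /=; have kP := kind_ofP i q; case E : (kind_of i q) kP => [|j|j|j] kP.
  - case: q {E kP} => [?|]; first by exists 0 => ?; rewrite normr0.
    have [B HB] := clamp_bounded2 _ diagK_cont; exists B => p.
    exact: (HB (zK p.2 p.1, p.2)).
  - by exists 0 => ?; rewrite normr0.
  - have [ji qE] := kP; have ji' : j != i by apply: (nji j true); left; rewrite -qE.
    have [cl _] := AL _ _ ji.
    have [B HB] := clamp_bounded1 _ (diagL_cont j ji').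
    have [B' HB'] := clamp_bounded1 _ (cl_cont01 _ cl).
    exists (B + B' + `|diagL j 1|) => p.
    apply: (le_trans (ler_normB _ _)); rewrite lerD2r.
    by apply: (le_trans (ler_normD _ _)); exact: lerD.
  - have [ij qE] := kP; have ji' : j != i by apply: (nji j false); right; rewrite -qE.
    by have [B HB] := clamp_bounded1 _ (diagL_cont j ji'); exists B => p.
exists (Num.max M1 (Num.max M2 (Num.max M3 (Num.max M4 M5)))); split => //.
- by move=> q p; rewrite le_max H1.
- by move=> q k p; rewrite !le_max (H2 (q, k)) !orbT.
- by move=> q p; rewrite !le_max H3 !orbT.
- by move=> q p; rewrite !le_max H4 !orbT.
- by move=> q p; rewrite !le_max H5 !orbT.
- move=> q k; have [[b ->]|] := @flow_transversal R m i (travel P) (lam_travel P) kap eps c0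
    (su_c0 SU) (su_slope SU) (su_dslope SU)
    (su_lslope SU) finv Laminv zK zd (su_finvK SU)
    (su_fK SU) (su_LaminvK SU) (su_LamK SU) q k.
    (* The coupling of L_j to itself is psi_{j,j}, so its own jump is invisible along its
       characteristics. *)
    by left => p /=; apply: psi0; exact: clI.
  by right.
Qed.

End KernelSystem.

(** * Fixed points restricted to segments *)

Section SegmentIdentities.
Context {R : realType} {m : nat} (P : continuum_params R m) (l : 'I_m -> 'I_m -> R -> R).
Hypothesis JC : jointly_continuous P.
Hypothesis CA : continuum_assumption P.
Hypothesis AL : admissible_l P l.
Variables (i : 'I_m) (kap eps c0 : R) (finv : 'I_m -> R -> R) (Laminv zK : R -> R -> R)
  (zd : 'I_m -> R -> R).
Hypothesis SU : setup P i kap eps c0 finv Laminv zK zd.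
Variable nu : R -> R.
Hypothesis mnu : measurable_fun setT nu.
Hypothesis nu01 : forall s, 0 <= nu s <= 1.
Notation mu := (@lebesgue_measure R).
Notation state := (@channel m * (R * R * R) -> R).
Notation KG := (kgeo P i kap eps finv Laminv zK zd).
Notation KC := (kcoefs P l i finv zK zd).
Variable u : state.
Hypothesis ru : regular KG u.
Hypothesis fu : forall x, evolve KG KC nu u x = u x.

Definition in_segment (p : 'I_m) (t xi : R) : Prop :=
  [/\ 0 <= xi <= 1, t <= travel P i 1, travel P p xi <= t &
      forall k : 'I_m, (p < k)%N -> t <= travel P k xi].

(** In segment p one has f_j xi <= t for j <= p and t <= f_j xi for j > p, so the index decides the
    branch of L_j. *)
Definition segment_channel (p : 'I_m) (q : @channel m) : Prop :=
  if q is Some (j, b) then b = (j <= p)%N else True.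

Lemma segment_dom (p : 'I_m) (q : @channel m) (t xi y : R) : (i <= p)%N ->
  segment_channel p q -> in_segment p t xi ->
  0 <= y <= 1 -> dom KG q (t, xi, y).
Proof.
move=> ip sq [xi01 tT ft tf] y01; have /andP[x0 x1] := xi01.
have fi : travel P i xi <= t by apply: le_trans ft; exact: travel_index_le.
split; first by split => //; rewrite /= fi.
have kP := kind_ofP i q; case: (kind_of i q) kP => //= j [ij qE]; rewrite qE /= in sq.
- by apply: le_trans ft; apply: travel_index_le.
- by apply: le_trans ft; apply: travel_index_le.
- by apply: tf; rewrite ltnNge -sq.
Qed.

(** This is [source] with the branches chosen by the segment, hence continuous along
    characteristics. *)
Definition source_seg (q : @channel m) (p : 'I_m) (t xi y : R) : R :=
  cZ KC q (xi, y) * u (q, (t, xi, y)) +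
  \sum_(k < m) u (Some (k, (k <= p)%N), (t, xi, 0)) * cA KC q k (xi, y) +
  avg nu (fun eta => u (None, (t, xi, eta)) * cS KC q (xi, eta, y)).

Lemma source_seg_cont (q : @channel m) (p : 'I_m) (c y : R) : continuous (fun r => source_seg q
  p r (flow KG q (c, y, r)) y).
Proof.
have GA := kgeo_axioms P JC CA _ _ _ _ _ _ _ _ SU.
have [M CM] := kcoefs_bounded P l JC CA AL _ _ _ _ _ _ _ _ SU.
have [cu _ _] := ru.
have cp : continuous (fun r : R => (c, y, r)).
  by apply: cont_pair; [exact: cont_cst|exact: cont_id].
have cfl : continuous (fun r : R => flow KG q (c, y, r)).
  exact: (cont_comp _ _ _ _ _ (flow_cont _ GA q) cp).
have cxy : continuous (fun r : R => (flow KG q (c, y, r), y)).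
  by apply: cont_pair => //; exact: cont_cst.
apply: contD; first apply: contD.
- apply: contM.
    exact: (cont_comp _ _ _ _ _ (cZ_cont _ _ _ CM q) cxy).
  exact: (cont_comp _ _ _ _ _ (cu q) (cont_comp _ _ _ _ _ (path_cont _ GA q) cp)).
- apply: cont_sum => k; apply: contM.
    exact: (cont_comp _ _ _ _ _ (branch_pt_cont _ GA u q _ k ru) cp).
  exact: (cont_comp _ _ _ _ _ (cA_cont _ _ _ CM q k) cxy).
- exact: (cont_comp _ _ _ _ _ (avg_source_cont _ _ _ CM nu mnu u q ru) (cont_comp _ _ _ _ _
  (path_cont _ GA q) cp)).
Qed.

(** Inside segment p, [source] and [source_seg] can differ only where t = f_k xi for some k > p,
    since [branch] then takes the lower branch. By transversality this happens at a null set of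
    instants, or the coefficient vanishes. *)
Lemma segment_increment (p : 'I_m) (q : @channel m) (y r1 r2 xi1 : R) : (i <= p)%N ->
  segment_channel p q ->
  0 <= y <= 1 -> r1 <= r2 ->
  let c := invar KG q (r1, xi1, y) in
  xi1 = flow KG q (c, y, r1) ->
  (forall r, r1 <= r <= r2 -> in_segment p r (flow KG q (c, y, r)) /\
     invar KG q (r, flow KG q (c, y, r), y) = c) ->
  u (q, (r2, flow KG q (c, y, r2), y)) - u (q, (r1, xi1, y)) =
  \int[mu]_(r in `[r1, r2]) source_seg q p r (flow KG q (c, y, r)) y.
Proof.
move=> ip sq y01 r12 c xiE Hr.
have GA := kgeo_axioms P JC CA _ _ _ _ _ _ _ _ SU.
have [M CM] := kcoefs_bounded P l JC CA AL _ _ _ _ _ _ _ _ SU.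
have H1 := Hr r1 ltac:(by rewrite lexx); have H2 := Hr r2 ltac:(by rewrite r12 lexx).
have D1 : dom KG q (r1, xi1, y) by rewrite xiE; apply: segment_dom; [|exact: sq|case: H1|].
have D2 : dom KG q (r2, flow KG q (c, y, r2), y) by apply: segment_dom; [|exact: sq|case: H2|].
rewrite (state_increment _ _ _ GA CM nu mnu nu01 u q r1 r2 xi1 _ y ru fu D1 D2 r12);
  last by case: H2.
rewrite /Rintegral; congr fine.
pose N : set R := \bigcup_k [set r | exists j : 'I_m, j = k :> nat /\
  ~ (forall p', cA KC q j p' = 0) /\ front KG j (flow KG q (c, y, r)) = r].
have nN : mu.-negligible N.
  apply: negligible_bigcup => k; apply: subsingleton_negligible => r r' /= [j [jk [nA e1]]] [j'
    [jk' [_ e2]]].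
  have jj' : j = j' by apply/val_inj; rewrite /= jk jk'.
  rewrite -{}jj' in e2; have [//|H] := transversal _ _ _ CM q j.
  have E1 : front KG j (flow KG q (c, y, r)) - r = 0 by apply/eqP; rewrite subr_eq0; exact/eqP.
  have E2 : front KG j (flow KG q (c, y, r')) - r' = 0 by apply/eqP; rewrite subr_eq0; exact/eqP.
  by apply: (H c y); rewrite E1 E2.
have [N' [mN' N'0 NN']] := nN.
apply: ae_eq_integral => //.
- apply/measurable_EFinP; apply: measurable_funTS.
  exact: (measurable_along _ _ _ GA CM nu mnu).
- apply/measurable_EFinP; apply: measurable_funTS; apply: continuous_measurable_fun.
  exact: source_seg_cont.
- exists N'; split => // r /= /not_implyP[]; rewrite in_itv/= => rr ne.
  apply: NN'; apply: contrapT => Nr; apply: ne; congr EFin.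
  rewrite /along /source /source_seg; congr (_ + _ + _); apply: eq_bigr => k _.
  have [A0|nA] := pselect (forall p', cA KC q k p' = 0); first by rewrite !A0 !mulr0.
  have fr : front KG k (flow KG q (c, y, r)) <> r.
    by move=> e; apply: Nr; exists (k : nat) => //; exists k.
  congr (_ * _); rewrite /branch; have [[xi01 tT ft tf] _] := Hr r rr.
  have /andP[x0 _] := xi01.
  have [kp|pk] := leqP k p.
    by rewrite ifT//; apply: le_trans ft; exact: travel_index_le.
  by rewrite ifF//; apply/negbTE; rewrite -ltNge lt_neqAle tf// andbT; apply/eqP => /esym.
Qed.

(** A curve with x-speed mu_i runs through travel times at unit speed, so the substitution is a
    shift. *)
Lemma curve_increment (p : 'I_m) (q : @channel m) (y a b : R) (T X : R -> R) : (i <= p)%N ->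
  segment_channel p q ->
  0 <= y <= 1 -> a <= b ->
  let c := invar KG q (T a, X a, y) in
  (forall s, a <= s <= b -> [/\ T s = T a + (s - a), in_segment p (T s) (X s),
     flow KG q (c, y, T s) = X s & invar KG q (T s, X s, y) = c]) ->
  mu.-integrable `[a, b] (EFin \o (fun s => source_seg q p (T s) (X s) y)) /\
  u (q, (T b, X b, y)) - u (q, (T a, X a, y)) =
  \int[mu]_(s in `[a, b]) source_seg q p (T s) (X s) y.
Proof.
move=> ip sq y01 ab c H.
pose h r := source_seg q p r (flow KG q (c, y, r)) y.
have ch : continuous h := source_seg_cont q p c y.
have hE : {in `[a, b]%classic, (fun s => source_seg q p (T s) (X s) y) =1 (fun s => h (s + (T a
  - a)))}.
  move=> s; rewrite inE/= in_itv/= => sab; have [TE _ fE _] := H s sab.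
  by rewrite /h (_ : s + (T a - a) = T s) ?fE// TE; ring.
have chs : continuous (fun s => h (s + (T a - a))).
  by apply: (cont_comp _ _ _ _ _ ch); apply: contD; [exact: cont_id|exact: cont_cst].
split.
  have := cont_integrable _ a b chs; apply: eq_integrable => // s sab /=.
  by rewrite hE.
have -> : \int[mu]_(s in `[a, b]) source_seg q p (T s) (X s) y =
    \int[mu]_(s in `[a, b]) h (s + (T a - a)) by apply: eq_Rintegral => s sab; exact: hE.
rewrite Rintegral_shift//.
have [TaE _ fa _] := H a ltac:(by rewrite lexx).
have [TbE _ fb _] := H b ltac:(by rewrite lexx ab).
rewrite (_ : a + (T a - a) = T a); last ring.
rewrite (_ : b + (T a - a) = T b); last by rewrite TbE; ring.
rewrite -{1}fb; apply: segment_increment => //.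
  by rewrite TbE lerDl subr_ge0.
move=> r /andP[r1 r2]; pose s := a + (r - T a).
have sab : a <= s <= b by rewrite /s; apply/andP; split; lra.
have [TsE Ts fs is_] := H s sab.
have rE : T s = r by rewrite TsE /s; ring.
by rewrite -rE fs.
Qed.

(** [su_zKE] gives one of the two inverse identities; this other one follows from strict
    monotonicity. *)
Lemma zK_diag x y : zK y (travel P i x + lam_travel P y x) = x.
Proof.
have E := su_zKE SU y (travel P i x + lam_travel P y x).
set z := zK _ _ in E *.
have [zx|xz|//] := ltgtP z x; exfalso.
  have h1 := su_slope SU i _ _ (ltW zx).
  have h2 := su_lslope SU y _ _ (ltW zx).
  have : 0 < c0 * (x - z) by rewrite mulr_gt0 ?subr_gt0//; exact: su_c0 SU.
  by lra.
have h1 := su_slope SU i _ _ (ltW xz).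
have h2 := su_lslope SU y _ _ (ltW xz).
have : 0 < c0 * (z - x) by rewrite mulr_gt0 ?subr_gt0//; exact: su_c0 SU.
by lra.
Qed.

Lemma zd_diag (j : 'I_m) x : j != i -> zd j (travel P j x - travel P i x) = x.
Proof.
move=> ji; have E := su_zdE SU j ji (travel P j x - travel P i x).
set z := zd j _ in E *.
have D (a b : 'I_m) (v w : R) : (a < b)%N -> v < w ->
    travel P b v - travel P a v < travel P b w - travel P a w.
  move=> ab vw; have h := su_dslope SU a b ab _ _ (ltW vw).
  have : 0 < c0 * (w - v) by rewrite mulr_gt0 ?subr_gt0//; exact: su_c0 SU.
  by lra.
have [zx|xz|//] := ltgtP z x; exfalso; have [h|h|e] := ltngtP j i.
- by have := D _ _ _ _ h zx; lra.
- by have := D _ _ _ _ h zx; lra.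
- by rewrite (val_inj e) eqxx in ji.
- by have := D _ _ _ _ h xz; lra.
- by have := D _ _ _ _ h xz; lra.
- by rewrite (val_inj e) eqxx in ji.
Qed.

Lemma diag_segment (x : R) : 0 <= x <= 1 -> in_segment i (travel P i x) x.
Proof.
move=> /andP[x0 x1]; split; rewrite ?x0 ?lexx//; first by rewrite travel_le.
by move=> k ik; apply: travel_index_le => //; exact: ltnW.
Qed.

Lemma value_diagK (x y : R) : 0 <= x <= 1 -> 0 <= y <= 1 ->
  u (None, (travel P i x, x, y)) = diagK P i x y.
Proof.
move=> x01 y01; have GA := kgeo_axioms P JC CA _ _ _ _ _ _ _ _ SU.
have D : dom KG None (travel P i x, x, y) by apply: segment_dom (diag_segment _ x01) y01.
rewrite (state_start _ _ GA nu u None _ _ _ fu D) /initial /=.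
  by rewrite [_ + travel P i x]addrC zK_diag !cl_id// addr0.
by rewrite [_ + travel P i x]addrC zK_diag.
Qed.

Lemma value_diagL (j : 'I_m) (x : R) : j != i -> 0 <= x <= 1 ->
  u (Some (j, (j <= i)%N), (travel P i x, x, 0)) = diagL P i j x.
Proof.
move=> ji x01; have GA := kgeo_axioms P JC CA _ _ _ _ _ _ _ _ SU.
have z01 : 0 <= (0 : R) <= 1 by rewrite lexx ler01.
have /andP[x0 x1] := x01.
have D : dom KG (Some (j, (j <= i)%N)) (travel P i x, x, 0).
  by apply: segment_dom (diag_segment _ x01) z01.
have [jl|ij|e] := ltngtP j i; last by rewrite (val_inj e) eqxx in ji.
- rewrite (ltnW jl) in D *.
  have kE : kind_of i (Some (j, true)) = KR j by rewrite /= leqNgt jl.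
  rewrite (state_start _ _ GA nu u _ _ _ _ fu D) /initial /start /invar /bottom /=.
    rewrite leqNgt jl /= zd_diag// cl_id// addr0.
    (* Continued up to x = 1, the characteristic has xi >= 1, so the datum from x = 1 is clamped to
       its corner value, which cancels by the compatibility of [l]. *)
    have -> : cl (finv j (travel P j x - travel P i x + travel P i 1)) = 1.
      rewrite clE ifT// -(travel_le P JC CA j) (su_finvK SU).
      by have := su_dslope SU j i jl _ _ x1;
        have := mulr_ge0 (ltW (su_c0 SU)) (_ : 0 <= 1 - x); rewrite subr_ge0 => /(_ x1); lra.
    by have [_ ->] := AL i j jl; rewrite /diagL; ring.
  by rewrite leqNgt jl /= zd_diag// min_l// travel_le.
- have ij' : (j <= i)%N = false by rewrite leqNgt ij.
  rewrite ij' in D *.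
  rewrite (state_start _ _ GA nu u _ _ _ _ fu D) /initial /start /invar /bottom /=.
    by rewrite ij /= zd_diag// cl_id// addr0.
  by rewrite ij /= zd_diag.
Qed.

Lemma value_bottom (j : 'I_m) (x : R) : (i <= j)%N -> 0 <= x <= 1 ->
  u (Some (j, true), (travel P i x, 0, 0)) =
  avg nu (fun eta => u (None, (travel P i x, 0, eta)) * cB KC (Some (j, true)) eta).
Proof.
move=> ij /andP[x0 x1]; have GA := kgeo_axioms P JC CA _ _ _ _ _ _ _ _ SU.
have D : dom KG (Some (j, true)) (travel P i x, 0, 0).
  split; first split; rewrite /= ?lexx ?ler01//.
    by rewrite !travel_le// x0.
  by rewrite ij travel0 -(travel0 P i) travel_le.
rewrite (state_start _ _ GA nu u _ _ _ _ fu D) /initial /start /invar /bottom /=.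
  by rewrite ij travel0 sub0r opprK add0r.
by rewrite ij travel0 sub0r opprK.
Qed.

Lemma value_right (j : 'I_m) (xi : R) : (j < i)%N -> 0 <= xi <= 1 ->
  u (Some (j, true), (travel P i 1, xi, 0)) = l i j xi.
Proof.
move=> ji xi01; have /andP[x0 x1] := xi01; have GA := kgeo_axioms P JC CA _ _ _ _ _ _ _ _ SU.
have nji : j != i by apply/eqP => e; move: ji; rewrite e ltnn.
have fx : travel P i xi <= travel P i 1 by rewrite travel_le.
have fj : travel P j xi <= travel P i xi by apply: travel_index_le => //; exact: ltnW.
have D : dom KG (Some (j, true)) (travel P i 1, xi, 0).
  split; first by split; rewrite /= ?lexx ?ler01// fx.
  by rewrite /= leqNgt ji /=; lra.
have sd := start_side _ GA _ _ _ _ D; have sb := start_bounds _ GA _ _ _ _ D.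
rewrite /= leqNgt ji /= in sd sb.
have zE := su_zdE SU j nji (travel P j xi - travel P i 1).
rewrite (state_start _ _ GA nu u _ _ _ _ fu D) /initial /start /invar /bottom /=;
  rewrite leqNgt ji /=.
  (* Here the diagonal is met at or beyond x = 1, so the diagonal datum is clamped to the corner
     value and cancels. *)
  have -> : cl (zd j (travel P j xi - travel P i 1)) = 1.
    by rewrite clE ifT// -(travel_le P JC CA i); move: sd; rewrite le_min => /andP[].
  by rewrite subrK (su_fK SU) cl_id//; ring.
by apply/eqP; rewrite eq_le sd; case/andP: sb.
Qed.

End SegmentIdentities.

(** * Square-integrable functions *)

Section SquareIntegrable.
Context {R : realType} d (T : measurableType d) (nu : {measure set T -> \bar R}) (D : set T).
Hypothesis mD : measurable D.
Hypothesis nuD : (nu D <= 1)%E.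

Lemma Lnorm2_le (f : T -> R) (B : R) : 0 <= B -> measurable_fun D f ->
  {ae nu, forall x, D x -> `|f x| <= B} ->
  ('N[nu]_(2%:E) [EFin \o (f \_ D)] <= B%:E)%E.
Proof.
move=> B0 mf fB; rewrite unlock /=.
have mfD : measurable_fun setT (f \_ D) by apply/(measurable_restrictT _ mD).
have -> : B%:E = ((B ^+ 2)%:E `^ 2^-1)%E.
  by rewrite poweR_EFin powR12_sqrt ?sqr_ge0// sqrtr_sqr ger0_norm.
apply: gt0_ler_poweR; rewrite ?invr_ge0//.
- by rewrite in_itv/= leey andbT; apply: integral_ge0 => x _; rewrite lee_fin powR_ge0.
- by rewrite in_itv/= leey andbT lee_fin sqr_ge0.
apply: (@le_trans _ _ (\int[nu]_(x in D) (B ^+ 2)%:E)%E); last first.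
  rewrite integral_cst// -[leRHS]mule1; apply: lee_wpmul2l => //.
  by rewrite lee_fin sqr_ge0.
rewrite [leRHS]integral_mkcond; apply: ae_ge0_le_integral => //.
- apply/measurable_EFinP; apply: (@measurableT_comp _ _ _ _ _ _ (fun x : R => x `^ 2)) => //.
  exact: measurableT_comp.
- by move=> x _; apply: erestrict_ge0 => y _; rewrite lee_fin sqr_ge0.
- by apply/(measurable_restrictT _ mD); exact: measurable_cst.
apply: filterS fB => x Hx _; rewrite /= /patch.
case: ifPn => [|_]; last by rewrite normr0 powR0.
rewrite inE => /Hx h; rewrite lee_fin powR_mulrn//.
by rewrite lerXn2r ?nnegrE.
Qed.

Lemma L2_bounded (f : T -> R) (B : R) : measurable_fun D f ->
  (forall x, D x -> `|f x| <= B) -> L2_on nu D f.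
Proof.
move=> mf fB; rewrite /L2_on inE; apply/andP; split; rewrite inE/=.
  exact/(measurable_restrictT _ mD).
apply: (@le_lt_trans _ _ (`|B|)%:E); last exact: ltry.
apply: Lnorm2_le => //; apply: aeW => x Dx.
exact: le_trans (fB x Dx) (ler_norm _).
Qed.

Lemma L2_norm_le (f : T -> R) (B : R) : 0 <= B -> measurable_fun D f ->
  {ae nu, forall x, D x -> `|f x| <= B} -> L2_norm_on nu D f <= B.
Proof.
move=> B0 mf fB; have h := Lnorm2_le f B B0 mf fB.
rewrite /L2_norm_on -lee_fin fineK//.
by rewrite ge0_fin_numE ?Lnorm_ge0// (le_lt_trans h)// ltry.
Qed.

Lemma L2_onB (f g : T -> R) : L2_on nu D f -> L2_on nu D g -> L2_on nu D (fun x => f x - g x).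
Proof.
move=> Lf Lg; rewrite /L2_on.
have -> : (fun x => f x - g x) \_ D = f \_ D \+ \- (g \_ D).
  by apply/funext => x; rewrite /= /patch; case: ifP => //; rewrite subr0.
have p1 : (1 <= 2%:E :> \bar R)%E by rewrite lee_fin ler1n.
apply: (Lfun_addr_closed nu p1).2 => //.
exact: (@Lfun_oppr_closed _ _ _ nu _ (g \_ D) Lg).
Qed.

Lemma L2_on_measurable (f : T -> R) : L2_on nu D f -> measurable_fun D f.
Proof.
rewrite /L2_on inE => /andP[/[!inE]/= mf _].
by apply/(measurable_restrictT _ mD).
Qed.

(** Hölder's inequality against the constant 1, whose norm is at most 1. *)
Lemma L2_on_L1 (f : T -> R) : L2_on nu D f ->
  nu.-integrable D (EFin \o f) /\ \int[nu]_(x in D) `|f x| <= L2_norm_on nu D f.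
Proof.
move=> Lf; have mf := L2_on_measurable _ Lf.
have mfD : measurable_fun setT (f \_ D) by apply/(measurable_restrictT _ mD).
have m1 : measurable_fun setT (cst (1 : R) \_ D).
  by apply/(measurable_restrictT _ mD); exact: measurable_cst.
have fin : ('N[nu]_(2%:E) [EFin \o (f \_ D)] < +oo)%E.
  by move: Lf; rewrite /L2_on inE => /andP[_ /[!inE]].
have h : (\int[nu]_(x in D) `|f x|%:E <= 'N[nu]_(2%:E) [EFin \o (f \_ D)])%E.
  have half : (2^-1 + 2^-1 = 1 :> R) by field.
  have H := @hoelder _ _ _ nu _ _ 2 2 mfD m1 (ltr0Sn _ 1) (ltr0Sn _ 1) half.
  rewrite Lnorm1 in H; rewrite integral_mkcond.
  refine (le_trans _ (le_trans H _)).
    apply: ge0_le_integral => //.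
    - by move=> x _; apply: erestrict_ge0 => y _.
    - apply/(measurable_restrictT _ mD); apply/measurable_EFinP.
      exact: measurableT_comp.
    - apply: measurableT_comp => //; apply/measurable_EFinP; exact: measurable_funM.
    - by move=> x _; rewrite /= /patch; case: ifP => _; rewrite ?mulr1// mulr0 normr0.
  rewrite -[leRHS]mule1; apply: lee_wpmul2l; first exact: Lnorm_ge0.
  apply: Lnorm2_le => //.
  by apply: aeW => x _; rewrite normr1.
split.
  apply/integrableP; split; first exact/measurable_EFinP.
  exact: le_lt_trans h fin.
rewrite /L2_norm_on /Rintegral fine_le//.
- by rewrite ge0_fin_numE ?integral_ge0// (le_lt_trans h).
- by rewrite ge0_fin_numE ?Lnorm_ge0.
Qed.

End SquareIntegrable.

Section L2Families.
Context {R : realType}.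
Notation mu := (@lebesgue_measure R).

(** Step functions vanish at y = 0, so sampled parameters are compared with the original ones on ]0,
    1] only; the point 0 affects neither measurability nor the integral. *)
Lemma integrable_oc (f g : R -> R) : (forall x, 0 < x <= 1 -> f x = g x) ->
  mu.-integrable `[0, 1] (EFin \o g) -> mu.-integrable `[0, 1] (EFin \o f) /\
  \int[mu]_(x in `[0, 1]) f x = \int[mu]_(x in `[0, 1]) g x.
Proof.
move=> fg ig.
have ig' : mu.-integrable `]0, 1] (EFin \o g).
  by apply: integrableS ig => //; apply: subset_itv; rewrite bnd_simp.
have fE : {in `]0, 1]%classic, EFin \o g =1 EFin \o f}.
  by move=> x; rewrite inE/= in_itv/= => h; rewrite /= fg.
have if' : mu.-integrable `]0, 1] (EFin \o f) by apply: eq_integrable ig'.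
have if1 : mu.-integrable `[0, 1] (EFin \o f).
  have mf' : measurable_fun `](0 : R), 1] f by apply/measurable_EFinP; case/integrableP : if'.
  have mf : measurable_fun `[(0 : R), 1] f by apply/measurable_fun_itv_obnd_cbndP.
  apply/integrableP; split; first exact/measurable_EFinP.
  rewrite -integral_itv_obnd_cbnd; first by case/integrableP : if'.
  by apply/measurable_EFinP; apply: measurableT_comp => //; exact/measurable_EFinP.
split => //; rewrite -[LHS]Rintegral_itv_obnd_cbnd// -[RHS]Rintegral_itv_obnd_cbnd//.
by apply: eq_Rintegral => x /fE [].
Qed.

Lemma leb_I01 : (@leb R I01 <= 1)%E.
Proof.
have := lebesgue_measure_itv `[(0 : R), 1]%R; rewrite /= lte_fin ltr01 -EFinB subr0.
by rewrite /leb /I01 => h; rewrite -[X in (_ <= X)%E]h.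
Qed.

Lemma C_L2_uniform (X : pseudoMetricType R) (A : set X) d (T : measurableType d) (nu : {measure
  set T -> \bar R})
    (D : set T) (F : X -> T -> R) : measurable D -> (nu D <= 1)%E ->
  (forall a, A a -> measurable_fun D (F a)) -> (forall a, A a -> exists B, forall y, D y ->
    `|F a y| <= B) ->
  (forall a e, A a -> 0 < e -> exists2 r, 0 < r & forall b y, A b -> ball a r b -> D y ->
    `|F b y - F a y| <= e) ->
  C_L2 A nu D F.
Proof.
move=> mD nuD mF bF cF; split=> a Aa.
  by have [B HB] := bF a Aa; apply: (L2_bounded _ _ nu D mD nuD (F a) B) => //; exact: mF.
apply/cvgrPdist_le => e e0; have [r r0 Hr] := cF a e Aa e0.
have : \forall b \near a, A b -> `|0 - L2_norm_on nu D (fun y => F b y - F a y)| <= e.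
  apply/nbhs_ballP; exists r => //= b ab Ab; rewrite sub0r normrN ger0_norm; last first.
    by apply: fine_ge0; exact: Lnorm_ge0.
  apply: (L2_norm_le _ _ nu D mD nuD _ _ (ltW e0)); first by apply: measurable_funB; exact: mF.
  by apply: aeW => y Dy; exact: Hr.
by [].
Qed.

End L2Families.

(* [P'] is [P] with its ensemble variables read through [nu]: [nu] is the clamping
   [cl] for [P] itself, and the step function of the nodes for the parameters of
   the n+m system. *)
Record sampled (R : realType) (m : nat) (P P' : continuum_params R m) (nu : R ->
  R) : Prop := Sampled {
  sa_mu : c_mu P' = c_mu P;
  sa_psi : c_psi P' = c_psi P;
  sa_lam : forall x y, 0 <= x <= 1 -> 0 < y <= 1 -> c_lam P' x y = c_lam P x (nu y);
  sa_sig : forall x eta y, 0 <= x <= 1 -> 0 < eta <= 1 -> 0 < y <= 1 ->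
    c_sig P' x eta y = c_sig P x (nu eta) (nu y);
  sa_W : forall j x y, 0 <= x <= 1 -> 0 < y <= 1 -> c_W P' j x y = c_W P j x (nu y);
  sa_th : forall j x y, 0 <= x <= 1 -> 0 < y <= 1 -> c_th P' j x y = c_th P j x (nu y);
  sa_Q : forall j y, 0 < y <= 1 -> c_Q P' j y = c_Q P j (nu y)
}.

Arguments sa_mu {R m P P' nu}.
Arguments sa_psi {R m P P' nu}.
Arguments sa_lam {R m P P' nu}.
Arguments sa_sig {R m P P' nu}.
Arguments sa_W {R m P P' nu}.
Arguments sa_th {R m P P' nu}.
Arguments sa_Q {R m P P' nu}.

(** * From fixed points to segmented solutions *)

Section SampledSolution.
Context {R : realType} {m : nat} (P : continuum_params R m) (l : 'I_m -> 'I_m -> R -> R).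
Hypothesis JC : jointly_continuous P.
Hypothesis CA : continuum_assumption P.
Hypothesis AL : admissible_l P l.
Variables (kap eps c0 : 'I_m -> R) (finv : 'I_m -> 'I_m -> R -> R)
  (Laminv zK : 'I_m -> R -> R -> R) (zd : 'I_m -> 'I_m -> R -> R).
Hypothesis SU : forall i, setup P i (kap i) (eps i) (c0 i) (finv i) (Laminv i) (zK i) (zd i).
Variable nu : R -> R.
Hypothesis mnu : measurable_fun setT nu.
Hypothesis nu01 : forall s, 0 <= nu s <= 1.
Notation mu := (@lebesgue_measure R).
Notation state := (@channel m * (R * R * R) -> R).
Notation KG i := (kgeo P i (kap i) (eps i) (finv i) (Laminv i) (zK i) (zd i)).
Notation KC i := (kcoefs P l i (finv i) (zK i) (zd i)).
Variable U : 'I_m -> state.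
Hypothesis ru : forall i, regular (KG i) (U i).
Hypothesis fu : forall i x, evolve (KG i) (KC i) nu (U i) x = U i x.
Variable P' : continuum_params R m.
Hypothesis PP' : sampled R m P P' nu.

(* The value 0 outside ]0, 1] makes this a [step_kernel] when [nu] is a step
   function. *)
Definition state_K : kernelK R m := fun i p x xi y =>
  if 0 < y <= 1 then U i (None, (travel P i x, xi, nu y)) else 0.
Definition state_L : kernelL R m := fun i j p x xi => U i (Some (j, (j <= p)%N), (travel P i x,
  xi, 0)).

Notation sseg i := (source_seg P l i (finv i) (zK i) (zd i) nu (U i)).

Lemma state_source_integral i p q x xi y (g : R -> R) :
  (forall eta, 0 < eta <= 1 -> g eta = cS (KC i) q (xi, nu eta, y)) ->
  \int[mu]_(eta in `[0, 1]) (state_K i p x xi eta * g eta) =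
  avg nu (fun eta => U i (None, (travel P i x, xi, eta)) * cS (KC i) q (xi, eta, y)).
Proof.
move=> gE; have [M CM] := kcoefs_bounded P l JC CA AL i _ _ _ _ _ _ _ (SU i).
have ig := avg_integrable nu (fun eta => U i (None, (travel P i x, xi, eta)) * cS (KC i) q (xi,
  eta, y))
  mnu nu01.
rewrite /avg; apply: (proj2 (integrable_oc _ _ _ (ig _))).
  by move=> eta eta01; rewrite /state_K eta01 gE.
apply: contM; first exact: (cont_slice (KG i)).
exact: (cont_cS _ _ _ CM).
Qed.

Lemma K_rhs_state (i p : 'I_m) (y x xi : R) : 0 <= x <= 1 -> 0 <= xi <= 1 -> 0 < y <= 1 ->
  K_rhs P' state_K state_L i p y x xi = sseg i None p (travel P i x) xi (nu y).
Proof.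
move=> x01 xi01 y01; rewrite /K_rhs /source_seg; congr (_ + _ + _).
- rewrite /= !cl_id// /state_K y01; congr (_ * _); apply: derive01_ext; last by rewrite I01E.
  by move=> z; rewrite I01E => z01; apply: sa_lam PP' _ _ _ _.
- apply: eq_bigr => k _; rewrite /= !cl_id//; congr (_ * _).
  exact: sa_th PP' _ _ _ xi01 y01.
- apply: state_source_integral => eta eta01; rewrite /= !cl_id//.
  exact: sa_sig PP' _ _ _ xi01 eta01 y01.
Qed.

Lemma L_rhs_state (i j p : 'I_m) (x xi : R) : 0 <= x <= 1 -> 0 <= xi <= 1 ->
  L_rhs P' state_K state_L i j p x xi = sseg i (Some (j, (j <= p)%N)) p (travel P i x) xi 0.
Proof.
move=> x01 xi01; rewrite /L_rhs /source_seg; congr (_ + _ + _).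
- by rewrite /= (sa_mu PP') cl_id// mulNr.
- apply: eq_bigr => k _; rewrite /= cl_id//; congr (_ * _).
  by rewrite (sa_psi PP').
- apply: state_source_integral => eta eta01; rewrite /= !cl_id//.
  exact: sa_W PP' _ _ _ xi01 eta01.
Qed.

Lemma in_segment_Tseg (i p : 'I_m) (x xi : R) : (i <= p)%N -> Tseg (c_mu P) i p (x, xi) ->
  in_segment P i p (travel P i x) xi /\ 0 <= x <= 1.
Proof.
move=> ip /(TsegP P JC CA _ _ _ _ ip)[x01 xi01 h1 h2]; split => //; split => //.
by rewrite (travel_le P JC CA); case/andP: x01.
Qed.

Lemma kind_L (i j p : 'I_m) : (i <= p)%N -> let q := Some (j, (j <= p)%N) in
  (forall z, invar (KG i) q z = travel P j z.1.2 - z.1.1) /\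
  (forall z, flow (KG i) q z = finv i j (z.1.1 + z.2)).
Proof.
move=> ip; rewrite /=; have [jp|pj] := leqP j p; last first.
  by rewrite (leq_ltn_trans ip pj).
by case: ifP.
Qed.

(** By [char_travel] an arbitrary characteristic curve for y conserves t + Lam xi taken at the
    ensemble value [nu y]. It is therefore a characteristic of the state at [nu y], and
    [curve_increment] applies. *)
Lemma transport_K (i p : 'I_m) (y : R) : (i <= p)%N -> 0 < y <= 1 ->
  transport (Tseg (c_mu P') i p) (c_mu P' i) (fun xi => - c_lam P' xi y)
    (fun x xi => state_K i p x xi y) (K_rhs P' state_K state_L i p y).
Proof.
move=> ip y01 a b X Xi ab; rewrite (sa_mu PP') => -[cX cXi TX dX dXi].
have TX' s : a <= s <= b -> in_segment P i p (travel P i (X s)) (Xi s) /\ 0 <= X s <= 1.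
  by move=> sab; apply: in_segment_Tseg => //; apply: TX; rewrite in_itv.
have Xi01 s : a <= s <= b -> 0 <= Xi s <= 1 by move=> /TX'[[]].
have nuy := nu01 y.
have TE := char_travel (c_mu P i) (travel P i) X 1 a b ab (or_introl erefl) (travel_cont P CA i)
  (travel_derive P CA i) (mu_pos P CA i) cX (fun s h => proj2 (TX' s h)).
have {}TE s : a <= s <= b -> travel P i (X s) = travel P i (X a) + (s - a).
  move=> sab; rewrite -[s - a]mul1r; apply: TE => // r rab; rewrite mul1r; exact: dX.
have LE := char_travel (fun xi => c_lam P xi (nu y)) (lam_travel P (nu y)) Xi (-1) a b ab
  (or_intror erefl) (lam_travel_cont1 P JC CA (nu y))
  (fun x => lam_travel_derive P JC CA (nu y) x nuy) (fun x h => lam_gt0 P CA x (nu y) h nuy)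
    cXi Xi01.
have {}LE s : a <= s <= b -> lam_travel P (nu y) (Xi s) = lam_travel P (nu y) (Xi a) - (s - a).
  move=> sab; rewrite -mulN1r; apply: LE => // r rab; rewrite mulN1r -(sa_lam PP')//;
    first exact: dXi.
  by apply: Xi01; move: rab; rewrite in_itv/= => /andP[? ?]; rewrite !ltW.
have [] := @curve_increment R m P l JC CA AL i _ _ _ _ _ _ _ (SU i) nu mnu nu01 (U i) (ru i) (fu i)
  p None (nu y) a b (fun s => travel P i (X s)) Xi ip I nuy ab.
  move=> s sab; have [h1 h2] := TX' s sab.
  have cE : lam_travel P (nu y) (Xi s) + travel P i (X s) = lam_travel P (nu y) (Xi a) + travel
    P i (X a).
    by rewrite (LE s sab) (TE s sab); ring.
  split => //=; first exact: TE.
  by rewrite -cE addrK (su_LamK (SU i)).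
have FE s : s \in `[a, b]%classic -> K_rhs P' state_K state_L i p y (X s) (Xi s) =
    sseg i None p (travel P i (X s)) (Xi s) (nu y).
  rewrite inE/= in_itv/= => sab; apply: K_rhs_state => //; [by case: (TX' s sab)|exact: Xi01].
move=> Hint Hinc; split.
  by apply: eq_integrable Hint => // s sab; rewrite /= FE.
by rewrite /state_K y01 Hinc; apply: eq_Rintegral => s sab; rewrite FE.
Qed.

Lemma transport_L (i j p : 'I_m) : (i <= p)%N ->
  transport (Tseg (c_mu P') i p) (c_mu P' i) (c_mu P' j) (state_L i j p) (L_rhs P' state_K
    state_L i j p).
Proof.
move=> ip a b X Xi ab; rewrite (sa_mu PP') => -[cX cXi TX dX dXi].
have TX' s : a <= s <= b -> in_segment P i p (travel P i (X s)) (Xi s) /\ 0 <= X s <= 1.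
  by move=> sab; apply: in_segment_Tseg => //; apply: TX; rewrite in_itv.
have Xi01 s : a <= s <= b -> 0 <= Xi s <= 1 by move=> /TX'[[]].
have TE := char_travel (c_mu P i) (travel P i) X 1 a b ab (or_introl erefl) (travel_cont P CA i)
  (travel_derive P CA i) (mu_pos P CA i) cX (fun s h => proj2 (TX' s h)).
have {}TE s : a <= s <= b -> travel P i (X s) = travel P i (X a) + (s - a).
  move=> sab; rewrite -[s - a]mul1r; apply: TE => // r rab; rewrite mul1r; exact: dX.
have LE := char_travel (c_mu P j) (travel P j) Xi 1 a b ab (or_introl erefl) (travel_cont P CA j)
  (travel_derive P CA j) (mu_pos P CA j) cXi Xi01.
have {}LE s : a <= s <= b -> travel P j (Xi s) = travel P j (Xi a) + (s - a).
  move=> sab; rewrite -[s - a]mul1r; apply: LE => // r rab; rewrite mul1r; exact: dXi.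
have z01 : 0 <= (0 : R) <= 1 by rewrite lexx ler01.
have [iE fE] := kind_L i j p ip.
have [] := @curve_increment R m P l JC CA AL i _ _ _ _ _ _ _ (SU i) nu mnu nu01 (U i) (ru i) (fu i)
  p (Some (j, (j <= p)%N)) 0 a b (fun s => travel P i (X s)) Xi ip erefl z01 ab.
  move=> s sab; have [h1 h2] := TX' s sab; rewrite !iE fE /=.
  have cE : travel P j (Xi a) - travel P i (X a) = travel P j (Xi s) - travel P i (X s).
    by rewrite (LE s sab) (TE s sab); ring.
  split => //; first exact: TE.
  by rewrite cE subrK (su_fK (SU i)).
have FE s : s \in `[a, b]%classic -> L_rhs P' state_K state_L i j p (X s) (Xi s) =
    sseg i (Some (j, (j <= p)%N)) p (travel P i (X s)) (Xi s) 0.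
  rewrite inE/= in_itv/= => sab; apply: L_rhs_state => //; [by case: (TX' s sab)|exact: Xi01].
move=> Hint Hinc; split.
  by apply: eq_integrable Hint => // s sab; rewrite /= FE.
by rewrite /state_L Hinc; apply: eq_Rintegral => s sab; rewrite FE.
Qed.

Lemma state_kernels_continuous : kernels_continuous P' state_K state_L.
Proof.
move=> i p ip; have [cu [B uB] _] := ru i.
have cz : continuous (fun z : R * R => (travel P i z.1, z.2)).
  apply: cont_pair; last exact: cont_snd (@cont_id _).
  exact: (cont_comp _ _ _ _ _ (travel_cont P CA i) (cont_fst _ _ _ _ (@cont_id _))).
split; last first.
  move=> j; apply: continuous_subspaceT.
  apply: (cont_comp _ _ _ (fun z : R * R => (travel P i z.1, z.2, 0)) _ (cu (Some (j,
    (j <= p)%N)))).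
  by apply: cont_pair => //; exact: cont_cst.
have cG : continuous (fun w : R * (R * R) => U i (None, (travel P i w.2.1, w.2.2, w.1))).
  apply: (cont_comp _ _ _ (fun w : R * (R * R) => (travel P i w.2.1, w.2.2, w.1)) _ (cu None)).
  apply: cont_pair; last exact: cont_fst (@cont_id _).
  exact: (cont_comp _ _ _ _ _ cz (cont_snd _ _ _ _ (@cont_id _))).
have mI : measurable (@I01 R) by exact: measurable_itv.
apply: C_L2_uniform => //; first exact: leb_I01.
- move=> z _; apply: measurable_funTS; apply: measurable_fun_ifT; [| |exact: measurable_cst].
    by apply: measurable_and; [exact: measurable_fun_ltr|exact: measurable_fun_ler].
  apply: (@measurableT_comp _ _ _ _ _ _ (fun y => U i (None, (travel P i z.1, z.2, y)))) => //.
  by apply: continuous_measurable_fun; exact: (cont_slice (KG i)).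
- move=> z _; exists B => y _; rewrite /state_K; case: ifP => _; first exact: uB.
  by rewrite normr0; exact: le_trans (uB (None, (0, 0, 0))).
- move=> a e _ e0.
  pose K1 := (@I01 R `*` [set a]).
  have [|d d0 Hd] := @unif_cont_compact R (R * (R * R))%type K1 _ e _ cG e0.
    by apply: compact_setX; [exact: segment_compact|exact: compact_set1].
  exists d => // b y _ ab y01.
  rewrite /state_K; case: ifP => _; last by rewrite subrr normr0 ltW.
  rewrite distrC; apply/ltW/(Hd (nu y, a) (nu y, b)).
    by split => //=; rewrite I01E.
  by split => //=; exact: ballxx.
Qed.

Lemma state_segmented_solution : segmented_solution P' l state_K state_L.
Proof.
split; first exact: state_kernels_continuous.
(* The exceptional ensemble value is y = 0, where [state_K] is set to 0. *)
- have n0 : mu.-negligible [set (0 : R)].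
    by exists [set 0]; split => //; exact: lebesgue_measure_set1.
  apply: negligibleS n0 => y /= /not_implyP[]; rewrite I01E => /andP[y0 y1] H.
  apply: contrapT => yn0; apply: H.
  have y01 : 0 < y <= 1 by rewrite lt_neqAle y0 y1 andbT andbT; apply/eqP => e; exact: yn0.
  split.
  + by move=> i p ip; exact: transport_K.
  + move=> i x; rewrite I01E => x01.
    rewrite /state_K y01 (value_diagK P l JC CA i _ _ _ _ _ _ _ (SU i) nu (U i) (fu i))//.
    by rewrite /diagK (sa_mu PP') (sa_th PP')// (sa_lam PP').
  + by [].
- split.
  + by move=> i j p ip; exact: transport_L.
  + move=> i j ji x; rewrite I01E => x01.
    rewrite /state_L (value_diagL P l JC CA AL i _ _ _ _ _ _ _ (SU i) nu (U i) (fu i))//.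
    by rewrite /diagL (sa_mu PP') (sa_psi PP').
  + move=> i j p pm ij x; rewrite I01E => x01.
    have jp : (j <= p)%N by have := ltn_ord j; rewrite -{2}pm ltnS.
    rewrite /state_L jp (value_bottom P l JC CA i _ _ _ _ _ _ _ (SU i) nu (U i) (fu i))//.
    have [M CM] := kcoefs_bounded P l JC CA AL i _ _ _ _ _ _ _ (SU i).
    have z01 : 0 <= (0 : R) <= 1 by rewrite lexx ler01.
    have cf : continuous (fun eta => U i (None, (travel P i x, 0,
      eta)) * (c_lam P 0 (cl eta) * c_Q P j (cl eta))).
      apply: contM; first exact: (cont_slice (KG i)).
      have [_ _ _ _ CQ] := JC; apply: contM; last exact: (cl_cont01 _ (CQ j)).
      have := cont_comp _ _ _ _ _ (lam_cl_cont P JC) (cont_pair _ _ _ _ _ (@cont_cst _ _ 0)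
        (@cont_id R)).
      by rewrite /= (cl_id 0).
    rewrite (sa_mu PP').
    rewrite (proj2 (integrable_oc _ _ _ (avg_integrable nu _ mnu nu01 cf))); last first.
      move=> eta eta01; rewrite /= (sa_lam PP')// (sa_Q PP')// !cl_id//.
      by rewrite /state_K eta01 mulrA.
    rewrite -RintegralZl//; last exact: (avg_integrable nu _ mnu nu01 cf).
    by rewrite /avg; apply: eq_Rintegral => eta _ /=; ring.
  + move=> i j p /andP[ji ip] xi /andP[h1 h2].
    rewrite (sa_mu PP') in h1 h2.
    have o01 : 0 <= (1 : R) <= 1 by rewrite lexx ler01.
    have jp : (j <= p)%N by rewrite (leq_trans (ltnW ji)).
    have x1 : xi <= 1.
      apply: (le_trans h2); have [] := rho_channel P JC CA i p 1 ip o01.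
      by case/andP.
    have x0 : 0 <= xi.
      apply: le_trans h1; have [pm|pm] := eqVneq p.+1 m; first by rewrite (rho_last P).
      have pm' : (p.+1 < m)%N by rewrite ltn_neqAle pm ltn_ord.
      have [] := rho_channel P JC CA i (Ordinal pm') 1 _ o01; last by case/andP.
      by rewrite /= leqW.
    rewrite /state_L jp (value_right P l JC CA i _ _ _ _ _ _ _ (SU i) nu (U i) (fu i))//.
    by rewrite x0.
  (* Passing from p' to p = p' + 1 changes the branch of L_j only for j = p, the excluded case. *)
  + move=> i j p p' ip' pE jp x x01; rewrite /state_L pE.
    suff -> : (j <= p'.+1)%N = (j <= p')%N by [].
    rewrite leq_eqVlt ltnS; case: eqP => // e.
    by move: jp => /eqP[]; apply/val_inj; rewrite /= e.
Qed.

End SampledSolution.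

(** * Uniqueness *)

Section InverseTravel.
Context {R : realType}.

Lemma inverse_derive (F G g : R -> R) (lo hi v : R) : 
  (forall z, G (F z) = z) -> continuous F -> continuous G -> F (G v) = v ->
  is_derive (G v) (1 : R) F (g (G v))^-1 -> 0 < g (G v) ->
  is_derive v (1 : R) G (g (G v)).
Proof.
move=> GF cF cG FG dF g0.
have := @is_derive_inverse R F G (g (G v))^-1 (G v).
rewrite FG invrK; apply => //.
- by near=> z; exact: GF.
- by near=> z; exact: cF.
- by rewrite invr_eq0 gt_eqF.
Unshelve. all: by end_near. Qed.

Lemma ivt_zero (g : R -> R) (a b : R) : a <= b -> continuous g -> 
  (0 <= g a /\ g b <= 0) \/ (g a <= 0 /\ 0 <= g b) -> exists2 s, a <= s <= b & g s = 0.
Proof.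
move=> ab cg H; have [|s sab gs] := @IVT R g a b 0 ab (continuous_subspaceT cg).
  rewrite ge_min le_max; case: H => -[-> ->]; by rewrite ?orbT.
by exists s => //; move: sab; rewrite in_itv.
Qed.

End InverseTravel.

(** * Following characteristics to the boundary of a segment *)

Section Paths.
Context {R : realType} {m : nat} (P : continuum_params R m).
Hypothesis JC : jointly_continuous P.
Hypothesis CA : continuum_assumption P.
Variables (i : 'I_m) (kap eps c0 : R) (finv : 'I_m -> R -> R) (Laminv zK : R -> R -> R)
  (zd : 'I_m -> R -> R).
Hypothesis SU : setup P i kap eps c0 finv Laminv zK zd.
Notation inseg := (in_segment P i).

Lemma inseg_bounds (p : 'I_m) (t xi : R) : (i <= p)%N -> inseg p t xi ->
  [/\ 0 <= t, t <= travel P i 1, travel P i xi <= t & 0 <= finv i t <= 1].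
Proof.
move=> ip [/andP[x0 x1] tT ft tf].
have h : travel P i xi <= t by apply: le_trans ft; exact: travel_index_le.
have t0 : 0 <= t by apply: le_trans h; rewrite -(travel0 P i) (travel_le P JC CA).
have fK := su_finvK SU i t.
split => //; apply/andP; split; first by rewrite -(travel_le P JC CA i) fK travel0.
by rewrite -(travel_le P JC CA i) fK.
Qed.

(** For K and for L_j with j > p: traced back in time, they leave segment p through xi = phi_p^{-1}
    t, an interface or, if p = i, the diagonal. The function phi_p (z r) - r changes sign between 0
    and t, and its monotonicity keeps the path inside after the zero. *)
Lemma entry_above (p : 'I_m) (t xi : R) (z : R -> R) : (i <= p)%N -> inseg p t xi -> 
  z t = xi -> continuous z -> (forall r, 0 <= r <= t -> 0 <= z r) ->
  (forall r r', 0 <= r -> r <= r' -> r' <= t -> travel P p (z r') - r' <= travel P p (z r) - r) ->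
  (forall k : 'I_m, (p < k)%N -> forall r, 0 <= r <= t -> r <= travel P k (z r)) ->
  exists2 s, 0 <= s <= t & travel P p (z s) = s /\ forall r, s <= r <= t -> inseg p r (z r).
Proof.
move=> ip S zt cz z0 dz kz; have [t0 tT _ _] := inseg_bounds p t xi ip S.
have [xi01 _ ft _] := S.
have [||s st fs] := ivt_zero (fun r => travel P p (z r) - r) 0 t t0.
- by apply: contB (@cont_id _); exact: (cont_comp _ _ _ _ _ (travel_cont P CA p) cz).
- left; split; last by rewrite zt subr_le0.
  by rewrite subr0; have := z0 0; rewrite lexx t0 -(travel_le P JC CA p) travel0; exact.
have /andP[s0 s1] := st.
exists s => //; split; first by apply/eqP; rewrite -subr_eq0 fs.
move=> r /andP[sr rt]; have r0t : 0 <= r <= t by rewrite (le_trans s0 sr).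
have fr : travel P p (z r) <= r by have := dz s r s0 sr rt; rewrite fs subr_le0.
have rT : r <= travel P i 1 := le_trans rt tT.
split => //; last by move=> k pk; exact: kz.
rewrite z0//= -(travel_le P JC CA i); apply: le_trans rT; apply: le_trans fr.
by apply: travel_index_le => //; exact: z0.
Qed.

Lemma inseg_down (p p' : 'I_m) (s x : R) : (p : nat) = p'.+1 -> inseg p s x ->
  travel P p x = s -> inseg p' s x.
Proof.
move=> pE [x01 sT _ kz] fs; have /andP[x0 _] := x01; split => //.
- by rewrite -fs travel_index_le// pE.
- move=> k pk; rewrite -fs travel_index_le// pE//.
Qed.

(** Traced back in time, L_j with i <= j <= p leaves through the lower boundary, the interface to p
    + 1 or xi = 0 in the last segment, because phi_k (z r) - r is nondecreasing for k >= j. *)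
Lemma entry_below (p : 'I_m) (j : 'I_m) (t xi : R) : (i <= j <= p)%N -> inseg p t xi ->
  let c := travel P j xi - t in let z r := finv j (c + r) in
  exists2 s, s <= t & (forall r, s <= r <= t -> inseg p r (z r)) /\
    ((p.+1 = m /\ z s = 0) \/ (exists p' : 'I_m, [/\ (p' : nat) = p.+1,
      travel P p' (z s) = s & inseg p' s (z s)])).
Proof.
move=> /andP[ij jp] S c z; have ip := leq_trans ij jp.
have [t0 tT fit _] := inseg_bounds p t xi ip S.
have [/andP[x0 x1] _ ft tf] := S.
have fz r : travel P j (z r) = c + r by exact: (su_finvK SU).
have zt : z t = xi by rewrite /z /c subrK (su_fK SU).
have cz : continuous z.
  apply: (cont_comp _ _ _ _ _ (su_finv_cont SU j)).
  by apply: contD; [exact: cont_cst|exact: cont_id].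
have zle r r' : r <= r' -> z r <= z r'.
  by move=> rr; rewrite -(travel_le P JC CA j) !fz lerD2l.
have c_le0 : c <= 0 by rewrite /c subr_le0; apply: le_trans ft; exact: travel_index_le.
have incr (k : 'I_m) r r' : (j <= k)%N -> r <= r' -> travel P k (z r) - r <= travel P k (z r') - r'.
  move=> jk rr; have [jk'|e] := ltnP j k; last first.
    have -> : k = j by apply/val_inj/eqP; rewrite eqn_leq e jk.
    by rewrite !fz; lra.
  have zz := zle r r' rr; have h := su_dslope SU j k jk' _ _ zz.
  have : 0 <= c0 * (z r' - z r) by rewrite mulr_ge0 ?subr_ge0// ltW//; exact: su_c0 SU.
  by move: h; rewrite !fz; lra.
have z0E : z (- c) = 0 by rewrite -[RHS](su_fK SU j) travel0 /z subrr.
have z0 r : - c <= r -> 0 <= z r by move=> h; rewrite -z0E zle.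
have ct : - c <= t by rewrite /c opprB lerBlDr lerDl -(travel0 P j) (travel_le P JC CA).
have good s : - c <= s -> s <= t -> (forall k : 'I_m, (p < k)%N -> s <= travel P k (z s)) ->
    forall r, s <= r <= t -> inseg p r (z r).
  move=> cs st ks r /andP[sr rt]; have zr0 := z0 r (le_trans cs sr).
  have zr1 : z r <= 1 by apply: (le_trans (zle _ _ rt)); rewrite zt.
  split; [by rewrite zr0 zr1|exact: le_trans tT| |].
  - by have := incr p r t jp rt; rewrite zt; lra.
  - move=> k pk; have := incr k s r (leq_trans jp (ltnW pk)) sr; have := ks k pk; lra.
have [pm|pm] := eqVneq p.+1 m.
  exists (- c) => //; split; last by left.
  apply: good => // k pk; have := ltn_ord k; by rewrite -{2}pm ltnS leqNgt pk.
have pm' : (p.+1 < m)%N by rewrite ltn_neqAle pm ltn_ord.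
pose p' := Ordinal pm'.
have [||s /andP[s0 st] fs] := ivt_zero (fun r => travel P p' (z r) - r) (- c) t ct.
- by apply: contB (@cont_id _); exact: (cont_comp _ _ _ _ _ (travel_cont P CA p') cz).
- by right; rewrite z0E travel0 zt subr_ge0 tf//; split => //; lra.
have fsE : travel P p' (z s) = s by apply/eqP; rewrite -subr_eq0 fs.
have ks (k : 'I_m) : (p < k)%N -> s <= travel P k (z s).
  by move=> pk; rewrite -{1}fsE travel_index_le// z0.
have G := good s s0 st ks.
exists s => //; split => //; right; exists p'; split => //.
have [a b _ d] := G s ltac:(by rewrite lexx st).
split => //; first by rewrite fsE.
by move=> k pk; apply: d; exact: ltn_trans pk.
Qed.

(** For j < i the data lie ahead. Forward in time phi_p (z r) - r is nondecreasing, so the path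
    stays in the segment until x = 1 or until it meets xi = phi_p^{-1} t, which is the diagonal if p
    = i. *)
Lemma exit_right (p : 'I_m) (j : 'I_m) (t xi : R) : (j < i <= p)%N -> inseg p t xi ->
  let c := travel P j xi - t in let z r := finv j (c + r) in
  exists2 s, t <= s & (forall r, t <= r <= s -> inseg p r (z r)) /\
    (s = travel P i 1 \/ travel P p (z s) = s).
Proof.
move=> /andP[ji ip] S c z; have jp := leq_trans ji ip.
have [t0 tT fit _] := inseg_bounds p t xi ip S.
have [/andP[x0 x1] _ ft tf] := S.
have fz r : travel P j (z r) = c + r by exact: (su_finvK SU).
have zt : z t = xi by rewrite /z /c subrK (su_fK SU).
have cz : continuous z.
  apply: (cont_comp _ _ _ _ _ (su_finv_cont SU j)).
  by apply: contD; [exact: cont_cst|exact: cont_id].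
have zle r r' : r <= r' -> z r <= z r'.
  by move=> rr; rewrite -(travel_le P JC CA j) !fz lerD2l.
have incr (k : 'I_m) r r' : (j < k)%N -> r <= r' -> travel P k (z r) - r <= travel P k (z r') - r'.
  move=> jk' rr.
  have zz := zle r r' rr; have h := su_dslope SU j k jk' _ _ zz.
  have : 0 <= c0 * (z r' - z r) by rewrite mulr_ge0 ?subr_ge0// ltW//; exact: su_c0 SU.
  by move: h; rewrite !fz; lra.
have good s : t <= s -> s <= travel P i 1 -> travel P p (z s) <= s -> forall r, t <= r <= s ->
  inseg p r (z r).
  move=> ts sT fs r /andP[tr rs]; have zr0 : 0 <= z r by apply: (le_trans x0); rewrite -zt zle.
  have fr : travel P p (z r) <= r by have := incr p r s jp rs; lra.
  split => //; [|exact: le_trans sT|].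
  - rewrite zr0 -(travel_le P JC CA i); apply: le_trans (le_trans rs sT); apply: le_trans fr.
    exact: travel_index_le.
  - move=> k pk; have := incr k t r (ltn_trans jp pk) tr; rewrite zt; have := tf k pk; lra.
have [fT|fT] := leP (travel P p (z (travel P i 1))) (travel P i 1).
  by exists (travel P i 1) => //; split; [exact: good|left].
have [||s /andP[ts sT] fs] := ivt_zero (fun r => travel P p (z r) - r) t (travel P i 1) tT.
- by apply: contB (@cont_id _); exact: (cont_comp _ _ _ _ _ (travel_cont P CA p) cz).
- by right; rewrite zt subr_le0 ft subr_ge0 ltW.
have fsE : travel P p (z s) = s by apply/eqP; rewrite -subr_eq0 fs.
exists s => //; split; last by right.
by apply: good => //; rewrite fsE.
Qed.

End Paths.

Section Pairing.
Context {R : realType}.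
Notation mu := (@lebesgue_measure R).

Lemma integrable_diff (a b : R) (f1 f2 : R -> R) : mu.-integrable `[a, b] (EFin \o f1) ->
  mu.-integrable `[a, b] (EFin \o f2) -> mu.-integrable `[a, b] (EFin \o (fun y => f1 y - f2 y)).
Proof.
move=> i1 i2; have := fun mD => integrableB mD i1 i2; move=> /(_ (measurable_itv _)).
by apply: eq_integrable => // y _ /=.
Qed.

Lemma integrable_normR (a b : R) (f : R -> R) : mu.-integrable `[a, b] (EFin \o f) ->
  mu.-integrable `[a, b] (EFin \o (fun y => `|f y|)).
Proof.
by move=> /integrable_norm; apply: eq_integrable => // y _ /=.
Qed.

Lemma pairing_diff (nu f1 f2 g G : R -> R) (M : R) : measurable_fun setT nu ->
  continuous G -> (forall s, `|G s| <= M) -> (forall y, 0 < y <= 1 -> g y = G (nu y)) ->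
  mu.-integrable `[0, 1] (EFin \o f1) -> mu.-integrable `[0, 1] (EFin \o f2) ->
  `|\int[mu]_(y in `[0, 1]) (f1 y * g y) - \int[mu]_(y in `[0, 1]) (f2 y * g y)| <=
  M * \int[mu]_(y in `[0, 1]) `|f1 y - f2 y|.
Proof.
move=> mnu cG GM gE i1 i2.
have mG : measurable_fun `[(0 : R), 1] (fun y => G (nu y)).
  apply: measurable_funTS; apply: measurableT_comp => //.
  exact: continuous_measurable_fun.
have bG : [bounded G (nu y) | y in (`[(0 : R), 1] : set R)].
  by exists M; split; [exact: num_real|move=> N MN y _; exact: le_trans (GM _) (ltW MN)].
have iG f : mu.-integrable `[0, 1] (EFin \o f) ->
  mu.-integrable `[0, 1] (EFin \o (fun y => f y * G (nu y))).
  by move=> fi; exact: (integrableMl _ fi mG bG).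
have E f : mu.-integrable `[0, 1] (EFin \o f) -> 
    \int[mu]_(y in `[0, 1]) (f y * g y) = \int[mu]_(y in `[0, 1]) (f y * G (nu y)).
  by move=> fi; apply: (integrable_oc _ _ _ (iG _ fi)).2 => y /gE ->.
rewrite E// E//.
have id_ : mu.-integrable `[0, 1] (EFin \o (fun y => f1 y - f2 y)) by exact: integrable_diff.
have ia : mu.-integrable `[0, 1] (EFin \o (fun y => `|f1 y - f2 y|)).
  exact: integrable_normR.
rewrite -RintegralB//; try exact: iG.
apply: (le_trans (le_normr_Rintegral _ _)) => //.
  by apply: integrable_diff; exact: iG.
rewrite -RintegralZl//; apply: le_Rintegral => //.
- by apply: integrable_normR; apply: integrable_diff; exact: iG.
- have := @integrableZl _ _ _ mu `[0, 1]%classic (measurable_itv _) M _ ia.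
  by apply: eq_integrable => // y _ /=; rewrite EFinM.
- by move=> y _; rewrite -mulrBl normrM mulrC ler_wpM2r.
Qed.

End Pairing.

Section Curves.
Context {R : realType} {m : nat} (P : continuum_params R m) (l : 'I_m -> 'I_m -> R -> R).
Hypothesis JC : jointly_continuous P.
Hypothesis CA : continuum_assumption P.
Hypothesis AL : admissible_l P l.
Variables (i : 'I_m) (kap eps c0 : R) (finv : 'I_m -> R -> R) (Laminv zK : R -> R -> R)
  (zd : 'I_m -> R -> R).
Hypothesis SU : setup P i kap eps c0 finv Laminv zK zd.
Variable nu : R -> R.
Hypothesis mnu : measurable_fun setT nu.
Hypothesis nu01 : forall s, 0 <= nu s <= 1.
Notation mu := (@lebesgue_measure R).
Notation inseg := (in_segment P i).
Variable P' : continuum_params R m.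
Hypothesis PP' : sampled R m P P' nu.
Notation KC := (kcoefs P l i finv zK zd).

Lemma inseg_Tseg (p : 'I_m) (t xi : R) : (i <= p)%N -> inseg p t xi ->
  Tseg (c_mu P) i p (finv i t, xi).
Proof.
move=> ip S; have [_ _ _ x01] := inseg_bounds P JC CA i _ _ _ _ _ _ _ SU p t xi ip S.
by apply/(TsegP P JC CA) => //; rewrite (su_finvK SU); case: S.
Qed.

Lemma finv_derive (j : 'I_m) (v : R) : 0 < v -> v < travel P j 1 ->
  is_derive v (1 : R) (finv j) (c_mu P j (finv j v)).
Proof.
move=> v0 v1; have fK := su_finvK SU j v.
have z0 : 0 < finv j v by rewrite ltNge -(travel_le P JC CA j) fK travel0 -ltNge.
have z1 : finv j v < 1 by rewrite ltNge -(travel_le P JC CA j) fK -ltNge.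
have z01 : 0 < finv j v < 1 by rewrite z0.
apply: (inverse_derive (travel P j)) => //.
- exact: (su_fK SU).
- exact: travel_cont.
- exact: (su_finv_cont SU).
- exact: travel_derive.
- by apply: mu_pos => //; rewrite !ltW.
Qed.

Lemma lam_travel_le (y a b : R) : (lam_travel P y a <= lam_travel P y b) = (a <= b).
Proof. exact: (Lamle (lam_travel P) c0 (su_c0 SU) (su_lslope SU)). Qed.

Lemma Laminv_derive (y v : R) : 0 <= y <= 1 -> 0 < Laminv y v < 1 ->
  is_derive v (1 : R) (Laminv y) (c_lam P (Laminv y v) y).
Proof.
move=> y01 z01; have /andP[z0 z1] := z01.
apply: (inverse_derive (lam_travel P y) (Laminv y) (fun x => c_lam P x y) v) => //.
- exact: (su_LamK SU).
- exact: lam_travel_cont1.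
- exact: (cont_comp _ _ _ (fun v : R => (y,
  v)) _ (su_Laminv_cont SU) (cont_pair _ _ _ _ _ (@cont_cst _ _ y) (@cont_id _))).
- exact: (su_LaminvK SU).
- exact: lam_travel_derive.
- by apply: lam_gt0 => //; rewrite !ltW.
Qed.

Lemma curve_L (p j : 'I_m) (c r1 r2 : R) : (i <= p)%N ->
  (forall r, r1 <= r <= r2 -> inseg p r (finv j (c + r))) -> r1 <= r2 ->
  char_curve (Tseg (c_mu P') i p) (c_mu P' i) (c_mu P' j) r1 r2 (finv i) (fun r => finv j (c + r)).
Proof.
move=> ip H r12; rewrite (sa_mu PP').
have b r xi := inseg_bounds P JC CA i _ _ _ _ _ _ _ SU p r xi ip.
have fK := su_finvK SU.
have l1 : r1 <= r1 <= r2 by rewrite lexx.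
have l2 : r1 <= r2 <= r2 by rewrite lexx r12.
have cs : continuous (fun r => c + r) by apply: contD; [exact: cont_cst|exact: cont_id].
have [[/andP[x0 _] _ _ _] [/andP[_ x1] _ _ _]] := (H r1 l1, H r2 l2).
have h1 : 0 <= c + r1 by rewrite -(fK j (c + r1)) -(travel0 P j) (travel_le P JC CA).
have h2 : c + r2 <= travel P j 1 by rewrite -(fK j (c + r2)) (travel_le P JC CA).
have [t0 _ _ _] := b r1 _ (H r1 l1); have [_ t1 _ _] := b r2 _ (H r2 l2).
split.
- by apply: continuous_subspaceT; exact: (su_finv_cont SU).
- by apply: continuous_subspaceT; apply: (cont_comp _ _ _ _ _ (su_finv_cont SU j) cs).
- by move=> s; rewrite in_itv/= => sr; apply: inseg_Tseg => //; exact: H.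
- move=> s; rewrite in_itv/= => /andP[rs sr].
  by apply: finv_derive; [exact: le_lt_trans rs|exact: lt_le_trans sr _].
- move=> s; rewrite in_itv/= => /andP[rs sr].
  have D : is_derive (c + s) (1 : R) (finv j) (c_mu P j (finv j (c + s))).
    by apply: finv_derive; lra.
  have d1 : is_derive s (1 : R) (fun r : R => c + r) 1.
    have := @is_deriveD R R R (cst c) id s 1 0 1 (is_derive_cst _ _ _) (is_derive_id _ _).
    by rewrite add0r.
  rewrite -[X in is_derive _ _ _ X]mulr1.
  exact: (@is_derive1_comp R (finv j) (fun r => c + r) s).
Qed.

Lemma curve_K (p : 'I_m) (y c r1 r2 : R) : (i <= p)%N -> 0 < y <= 1 ->
  (forall r, r1 <= r <= r2 -> inseg p r (Laminv (nu y) (c - r))) -> r1 <= r2 ->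
  char_curve (Tseg (c_mu P') i p) (c_mu P' i) (fun xi => - c_lam P' xi y) r1 r2 (finv i)
    (fun r => Laminv (nu y) (c - r)).
Proof.
move=> ip y01 H r12; rewrite (sa_mu PP').
have b r xi := inseg_bounds P JC CA i _ _ _ _ _ _ _ SU p r xi ip.
have LK := su_LaminvK SU.
have l1 : r1 <= r1 <= r2 by rewrite lexx.
have l2 : r1 <= r2 <= r2 by rewrite lexx r12.
have cs : continuous (fun r => (nu y, c - r)).
  by apply: cont_pair; [exact: cont_cst|apply: contB; [exact: cont_cst|exact: cont_id]].
have [[/andP[_ x1] _ _ _] [/andP[x0 _] _ _ _]] := (H r1 l1, H r2 l2).
have [t0 _ _ _] := b r1 _ (H r1 l1); have [_ t1 _ _] := b r2 _ (H r2 l2).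
have lt_ (r r' : R) : r < r' -> Laminv (nu y) (c - r') < Laminv (nu y) (c - r).
  by move=> rr; rewrite ltNge -(lam_travel_le (nu y)) !LK -ltNge; lra.
split.
- by apply: continuous_subspaceT; exact: (su_finv_cont SU).
- by apply: continuous_subspaceT; exact: (cont_comp _ _ _ _ _ (su_Laminv_cont SU) cs).
- by move=> s; rewrite in_itv/= => sr; apply: inseg_Tseg => //; exact: H.
- move=> s; rewrite in_itv/= => /andP[rs sr].
  by apply: finv_derive; [exact: le_lt_trans rs|exact: lt_le_trans sr _].
- move=> s; rewrite in_itv/= => /andP[rs sr].
  have z01 : 0 < Laminv (nu y) (c - s) < 1.
    by rewrite (le_lt_trans x0 (lt_ _ _ sr)) (lt_le_trans (lt_ _ _ rs) x1).
  have D := Laminv_derive (nu y) (c - s) (nu01 y) z01.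
  have /andP[z0 z1] := z01.
  rewrite (sa_lam PP')//; last by rewrite !ltW.
  have d1 : is_derive s (1 : R) (fun r : R => c - r) (- 1).
    have := @is_deriveB R R R (cst c) id s 1 0 1 (is_derive_cst _ _ _) (is_derive_id _ _).
    by rewrite sub0r.
  rewrite -[X in is_derive _ _ _ X]mulrN1.
  exact: (@is_derive1_comp R (Laminv (nu y)) (fun r => c - r) s).
Qed.

End Curves.

(** * Differences of two solutions *)

Section Difference.
Context {R : realType} {m : nat} (P : continuum_params R m) (l : 'I_m -> 'I_m -> R -> R).
Hypothesis JC : jointly_continuous P.
Hypothesis CA : continuum_assumption P.
Hypothesis AL : admissible_l P l.
Variables (i : 'I_m) (kap eps c0 : R) (finv : 'I_m -> R -> R) (Laminv zK : R -> R -> R)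
  (zd : 'I_m -> R -> R).
Hypothesis SU : setup P i kap eps c0 finv Laminv zK zd.
Variable nu : R -> R.
Hypothesis mnu : measurable_fun setT nu.
Hypothesis nu01 : forall s, 0 <= nu s <= 1.
Notation mu := (@lebesgue_measure R).
Notation inseg := (in_segment P i).
Variable P' : continuum_params R m.
Hypothesis PP' : sampled R m P P' nu.
Notation KG := (kgeo P i kap eps finv Laminv zK zd).
Notation KC := (kcoefs P l i finv zK zd).
Variable M : R.
Hypothesis CM : coef_axioms KG KC M.
Variables (K1 K2 : kernelK R m) (L1 L2 : kernelL R m).
Hypothesis S1 : segmented_solution P' l K1 L1.
Hypothesis S2 : segmented_solution P' l K2 L2.

Definition gapK (p : 'I_m) (t xi y : R) : R := K1 i p (finv i t) xi y - K2 i p (finv i t) xi y.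
Definition gapL (j p : 'I_m) (t xi : R) : R := L1 i j p (finv i t) xi - L2 i j p (finv i t) xi.
Definition gapK1 (p : 'I_m) (t xi : R) : R := \int[mu]_(y in `[0, 1]) `|gapK p t xi y|.

Lemma kernel_integrable (K : kernelK R m) (L : kernelL R m) (p : 'I_m) (x xi : R) :
  kernels_continuous P' K L -> (i <= p)%N -> Tseg (c_mu P) i p (x, xi) ->
  mu.-integrable `[0, 1] (EFin \o K i p x xi).
Proof.
move=> KL ip T; have [[H _] _] := KL i p ip.
have mI : measurable (@I01 R) by exact: measurable_itv.
have h : L2_on leb I01 (K i p x xi).
  by apply: (H (x, xi)); rewrite (sa_mu PP').
by have [] := L2_on_L1 _ _ leb I01 mI (leb_I01) _ h.
Qed.

Lemma L_rhs_gap (p j : 'I_m) (t xi a b : R) : (i <= p)%N -> inseg p t xi ->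
  (forall k, `|gapL k p t xi| <= a) -> gapK1 p t xi <= b ->
  `|L_rhs P' K1 L1 i j p (finv i t) xi - L_rhs P' K2 L2 i j p (finv i t) xi| <=
  (m.+1)%:R * (M * a) + M * b.
Proof.
move=> ip S Ha Hb; have [xi01 _ _ _] := S; have M0 := M_ge0 _ _ _ CM.
have T := inseg_Tseg P JC CA i _ _ _ _ _ _ _ SU p t xi ip S.
have [[k1 _ _] [k2 _ _]] := (S1, S2).
have i1 := kernel_integrable _ _ _ _ _ k1 ip T.
have i2 := kernel_integrable _ _ _ _ _ k2 ip T.
pose q : @channel m := Some (j, true).
have HW : `|\int[mu]_(y in `[0, 1]) (K1 i p (finv i t) xi y * c_W P' j xi y) -
    \int[mu]_(y in `[0, 1]) (K2 i p (finv i t) xi y * c_W P' j xi y)| <= M * gapK1 p t xi.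
  apply: (pairing_diff nu _ _ _ (fun s => cS KC q (xi, s, 0)) M) => //.
  - exact: (cont_cS _ _ _ CM).
  - by move=> s; exact: (cS_le _ _ _ CM).
  - by move=> y y01; rewrite /= !cl_id//; exact: sa_W PP' _ _ _ xi01 y01.
rewrite /L_rhs.
have -> : forall z v1 v2 s1 s2 w1 w2 : R, - (z * v1) + s1 + w1 - (- (z * v2) + s2 + w2) =
   (- z) * (v1 - v2) + (s1 - s2) + (w1 - w2) by move=> *; ring.
apply: le_trans (ler_normD _ _) _; apply: lerD; last by apply: le_trans HW _; rewrite ler_wpM2l.
apply: le_trans (ler_normD _ _) _; rewrite -natr1 mulrDl mul1r addrC; apply: lerD.
  rewrite -sumrB; apply: le_trans (ler_norm_sum _ _ _) _.
  have -> : m%:R * (M * a) = \sum_(k < m) (M * a) by rewrite sumr_const card_ord mulr_natl.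
  apply: ler_sum => k _; rewrite -mulrBl normrM mulrC; apply: ler_pM => //; last exact: Ha.
  rewrite (sa_psi PP').
  by have := cA_le _ _ _ CM q k (xi, 0); rewrite /= cl_id.
rewrite normrM; apply: ler_pM => //; last exact: Ha.
rewrite (sa_mu PP').
by have := cZ_le _ _ _ CM q (xi, 0); rewrite /= cl_id.
Qed.

(** The term with lambda_xi involves the gap at the single value y, about which the L^1 bound [b]
    says nothing; it is kept here and absorbed later by [gronwall]. *)
Lemma K_rhs_gap (p : 'I_m) (t xi a b y : R) : (i <= p)%N -> inseg p t xi -> 0 < y <= 1 ->
  (forall k, `|gapL k p t xi| <= a) -> gapK1 p t xi <= b ->
  `|K_rhs P' K1 L1 i p y (finv i t) xi - K_rhs P' K2 L2 i p y (finv i t) xi| <=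
  M * `|gapK p t xi y| + (m%:R * (M * a) + M * b).
Proof.
move=> ip S y01 Ha Hb; have [xi01 _ _ _] := S; have M0 := M_ge0 _ _ _ CM.
have T := inseg_Tseg P JC CA i _ _ _ _ _ _ _ SU p t xi ip S.
have [[k1 _ _] [k2 _ _]] := (S1, S2).
have i1 := kernel_integrable _ _ _ _ _ k1 ip T.
have i2 := kernel_integrable _ _ _ _ _ k2 ip T.
have HW : `|\int[mu]_(eta in `[0, 1]) (K1 i p (finv i t) xi eta * c_sig P' xi eta y) -
    \int[mu]_(eta in `[0, 1]) (K2 i p (finv i t) xi eta * c_sig P' xi eta y)| <= M * gapK1 p t xi.
  apply: (pairing_diff nu _ _ _ (fun s => cS KC None (xi, s, nu y)) M) => //.
  - exact: (cont_cS _ _ _ CM).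
  - by move=> s; exact: (cS_le _ _ _ CM).
  - by move=> eta eta01; rewrite /= !cl_id//; exact: sa_sig PP' _ _ _ xi01 eta01 y01.
rewrite /K_rhs.
have -> : forall z v1 v2 s1 s2 w1 w2 : R, (z * v1) + s1 + w1 - ((z * v2) + s2 + w2) =
   z * (v1 - v2) + ((s1 - s2) + (w1 - w2)) by move=> *; ring.
apply: le_trans (ler_normD _ _) _; apply: lerD.
  rewrite normrM; apply: ler_pM => //.
  have := cZ_le _ _ _ CM None (xi, nu y); rewrite /= !cl_id//; apply: le_trans.
  have -> // : derive01 (c_lam P' ^~ y) xi = derive01 (c_lam P ^~ (nu y)) xi.
  apply: derive01_ext; last by rewrite I01E.
  by move=> z; rewrite I01E => z01; exact: sa_lam PP' _ _ z01 y01.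
apply: le_trans (ler_normD _ _) _; apply: lerD; last by apply: le_trans HW _; rewrite ler_wpM2l.
rewrite -sumrB; apply: le_trans (ler_norm_sum _ _ _) _.
have -> : m%:R * (M * a) = \sum_(k < m) (M * a) by rewrite sumr_const card_ord mulr_natl.
apply: ler_sum => k _; rewrite -mulrBl normrM mulrC; apply: ler_pM => //; last exact: Ha.
have := cA_le _ _ _ CM None k (xi, nu y); rewrite /= !cl_id//; apply: le_trans.
by rewrite (sa_th PP' k xi y xi01 y01).
Qed.

Lemma gapL_increment (p j : 'I_m) (c r1 r2 : R) : (i <= p)%N -> r1 <= r2 ->
  (forall r, r1 <= r <= r2 -> inseg p r (finv j (c + r))) ->
  exists h : R -> R, [/\ mu.-integrable `[r1, r2] (EFin \o h),
    gapL j p r2 (finv j (c + r2)) - gapL j p r1 (finv j (c + r1)) = \int[mu]_(r in `[r1, r2]) h r &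
    forall r, h r = L_rhs P' K1 L1 i j p (finv i r) (finv j (c + r)) -
                    L_rhs P' K2 L2 i j p (finv i r) (finv j (c + r))].
Proof.
move=> ip r12 H; have [[_ _ [T1 _ _ _ _]] [_ _ [T2 _ _ _ _]]] := (S1, S2).
have cc := curve_L P JC CA i _ _ _ _ _ _ _ SU nu P' PP' p j c r1 r2 ip H r12.
have [j1 e1] := T1 i j p ip r1 r2 _ _ r12 cc; have [j2 e2] := T2 i j p ip r1 r2 _ _ r12 cc.
eexists; split; [exact: integrable_diff j1 j2| |by []].
by rewrite RintegralB// -e1 -e2 /gapL; ring.
Qed.

Definition good (y : R) : Prop :=
  [/\ 0 < y <= 1, K_equations_at P' K1 L1 y & K_equations_at P' K2 L2 y].

Lemma gapK_increment (p : 'I_m) (y c r1 r2 : R) : (i <= p)%N -> good y -> r1 <= r2 ->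
  (forall r, r1 <= r <= r2 -> inseg p r (Laminv (nu y) (c - r))) ->
  let F r := K_rhs P' K1 L1 i p y (finv i r) (Laminv (nu y) (c - r)) -
             K_rhs P' K2 L2 i p y (finv i r) (Laminv (nu y) (c - r)) in
  mu.-integrable `[r1, r2] (EFin \o F) /\
  gapK p r2 (Laminv (nu y) (c - r2)) y =
    gapK p r1 (Laminv (nu y) (c - r1)) y + \int[mu]_(r in `[r1, r2]) F r.
Proof.
move=> ip [y01 [T1 _ _] [T2 _ _]] r12 H F.
have cc := curve_K P JC CA i _ _ _ _ _ _ _ SU nu nu01 P' PP' p y c r1 r2 ip y01 H r12.
have [j1 e1] := T1 i p ip r1 r2 _ _ r12 cc; have [j2 e2] := T2 i p ip r1 r2 _ _ r12 cc.
split; first exact: integrable_diff j1 j2.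
by rewrite RintegralB// -e1 -e2 /gapK; ring.
Qed.

Lemma good_ae : {ae mu, forall y, I01 y -> good y}.
Proof.
have [[_ g1 _] [_ g2 _]] := (S1, S2).
have n0 : mu.-negligible [set (0 : R)].
  by exists [set 0]; split => //; exact: lebesgue_measure_set1.
apply: negligibleS (negligibleU g1 (negligibleU g2 n0)) => y /= H;
  apply: contrapT => /not_orP[h1 /not_orP[h2 y0]].
move/contrapT: h1 => h1; move/contrapT: h2 => h2; apply: H => Iy; split; [|exact: h1|exact: h2].
by move: Iy; rewrite I01E => /andP[a b]; rewrite b andbT lt_neqAle a andbT; apply/eqP => e;
  exact: y0.
Qed.

End Difference.

Section Contraction.
Context {R : realType} {m : nat} (P : continuum_params R m) (l : 'I_m -> 'I_m -> R -> R).
Hypothesis JC : jointly_continuous P.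
Hypothesis CA : continuum_assumption P.
Hypothesis AL : admissible_l P l.
Variables (i : 'I_m) (kap eps c0 : R) (finv : 'I_m -> R -> R) (Laminv zK : R -> R -> R)
  (zd : 'I_m -> R -> R).
Hypothesis SU : setup P i kap eps c0 finv Laminv zK zd.
Variable nu : R -> R.
Hypothesis mnu : measurable_fun setT nu.
Hypothesis nu01 : forall s, 0 <= nu s <= 1.
Notation mu := (@lebesgue_measure R).
Notation inseg := (in_segment P i).
Variable P' : continuum_params R m.
Hypothesis PP' : sampled R m P P' nu.
Notation KG := (kgeo P i kap eps finv Laminv zK zd).
Notation KC := (kcoefs P l i finv zK zd).
Variable M : R.
Hypothesis CM : coef_axioms KG KC M.
Variables (K1 K2 : kernelK R m) (L1 L2 : kernelL R m).
Hypothesis S1 : segmented_solution P' l K1 L1.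
Hypothesis S2 : segmented_solution P' l K2 L2.
Notation GapK := (gapK i finv K1 K2).
Notation GapL := (gapL i finv L1 L2).
Notation GapK1 := (gapK1 i finv K1 K2).
Notation Good := (good P' K1 K2 L1 L2).

Lemma rho_eq (p : 'I_m) (x z : R) : (i <= p)%N -> 0 <= x <= 1 -> travel P p z = travel P i x ->
  rho (c_mu P) i p x = z.
Proof.
move=> ip x01 e; have [_ e'] := rho_channel P JC CA i p x ip x01.
have fK := su_fK SU p.
by rewrite -(fK z) -(fK (rho _ _ _ _)) e e'.
Qed.

Lemma gap_cross (p p' : 'I_m) (s z : R) : (i <= p')%N -> (p : nat) = p'.+1 -> inseg p s z ->
  travel P p z = s ->
  (forall j : 'I_m, j != p -> GapL j p s z = GapL j p' s z) /\
  (forall y, Good y -> GapK p s z y = GapK p' s z y).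
Proof.
move=> ip pE S fz; have ip' : (i <= p)%N by rewrite pE leqW.
have [_ _ _ x01] := inseg_bounds P JC CA i _ _ _ _ _ _ _ SU p s z ip' S.
have fK := su_finvK SU i s.
have rE : rho (c_mu P') i p (finv i s) = z.
  by rewrite (sa_mu PP'); apply: rho_eq => //; rewrite fK.
have Ix : I01 (finv i s) by rewrite I01E.
have [[_ _ [_ _ _ _ c1]] [_ _ [_ _ _ _ c2]]] := (S1, S2).
split.
  move=> j jp; have := c1 i j p p' ip pE jp _ Ix; have := c2 i j p p' ip pE jp _ Ix.
  by rewrite rE /gapL => -> ->.
move=> y [y01 [_ _ d1] [_ _ d2]].
have := d1 i p p' ip pE _ Ix; have := d2 i p p' ip pE _ Ix.
by rewrite rE /gapK => -> ->.
Qed.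

Lemma gap_diag (s z : R) : inseg i s z -> travel P i z = s ->
  (forall j : 'I_m, j != i -> GapL j i s z = 0) /\ (forall y, Good y -> GapK i s z y = 0).
Proof.
move=> [z01 _ _ _] fz; have fE : finv i s = z by rewrite -fz (su_fK SU).
have Iz : I01 z by rewrite I01E.
have [[_ _ [_ c1 _ _ _]] [_ _ [_ c2 _ _ _]]] := (S1, S2).
split; first by move=> j ji; rewrite /gapL fE c1// c2// subrr.
by move=> y [y01 [_ d1 _] [_ d2 _]]; rewrite /gapK fE d1// d2// subrr.
Qed.

Lemma gap_right (p j : 'I_m) (z : R) : (j < i <= p)%N -> inseg p (travel P i 1) z ->
  GapL j p (travel P i 1) z = 0.
Proof.
move=> jip S; have /andP[_ ip] := jip.
have [_ _] := inseg_Tseg P JC CA i _ _ _ _ _ _ _ SU p _ z ip S.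
rewrite /= (su_fK SU) => zz.
have [[_ _ [_ _ _ c1 _]] [_ _ [_ _ _ c2 _]]] := (S1, S2).
rewrite -(sa_mu PP') in zz.
by rewrite /gapL (su_fK SU) c1// c2// subrr.
Qed.

Lemma gap_bottom (p j : 'I_m) (t : R) : p.+1 = m -> (i <= j)%N -> inseg p t 0 ->
  `|GapL j p t 0| <= M * GapK1 p t 0.
Proof.
move=> pm ij S; have M0 := M_ge0 _ _ _ CM.
have ip : (i <= p)%N by have := ltn_ord i; rewrite -{2}pm ltnS.
have T := inseg_Tseg P JC CA i _ _ _ _ _ _ _ SU p t 0 ip S.
have [_ _ _ x01] := inseg_bounds P JC CA i _ _ _ _ _ _ _ SU p t 0 ip S.
have Ix : I01 (finv i t) by rewrite I01E.
have [[k1 _ [_ _ c1 _ _]] [k2 _ [_ _ c2 _ _]]] := (S1, S2).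
have i1 := kernel_integrable P i nu P' PP' _ _ _ _ _ k1 ip T.
have i2 := kernel_integrable P i nu P' PP' _ _ _ _ _ k2 ip T.
have z01 : 0 <= (0 : R) <= 1 by rewrite lexx ler01.
have m0 := mu_pos P CA j 0 z01.
pose G s := c_lam P 0 (cl s) * c_Q P j (cl s).
have cG : continuous G.
  have [_ _ _ _ CQ] := JC; apply: contM; last exact: (cl_cont01 _ (CQ j)).
  have := cont_comp _ _ _ _ _ (lam_cl_cont P JC) (cont_pair _ _ _ _ _ (@cont_cst _ _ 0)
    (@cont_id R)).
  by rewrite /= (cl_id 0).
rewrite /gapL c1// c2// (sa_mu PP') -mulrBr normrM gtr0_norm ?invr_gt0//.
rewrite -ler_pdivlMl ?invr_gt0// invrK mulrA.
under eq_Rintegral do rewrite -mulrA.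
under [X in _ - X]eq_Rintegral do rewrite -mulrA.
apply: (pairing_diff nu _ _ _ G (c_mu P j 0 * M)) => //.
- move=> s; rewrite -(ler_pM2l (_ : 0 < (c_mu P j 0)^-1)) ?invr_gt0// mulKf ?gt_eqF//.
  by have := cB_le _ _ _ CM (Some (j, true)) s; rewrite /= normrM gtr0_norm ?invr_gt0.
- by move=> y y01; rewrite /G (sa_lam PP')// (sa_Q PP')// !cl_id.
Qed.

Let Theta : R := 2 * M + 1.
(** The factor 4, in place of the 2 of the fixed-point problem, is there for K: [gronwall] spends
    half of [gam * eps] on the term with K itself. *)
Let gam : R := (4 * m.+2%:R * M * Theta + 1) / eps.
Let E (t xi : R) : R := expR (gam * (t - kap * xi)).

(* Bounds for the differences of two solutions; K is measured in L^1 since the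
   equations hold for almost every y only. *)
Definition gap_le (N : R) : Prop := forall (p : 'I_m) t xi, (i <= p)%N -> inseg p t xi ->
  (forall j, `|GapL j p t xi| <= N * Theta * E t xi) /\ GapK1 p t xi <= N * E t xi.

Lemma gap_level_ge1 : 1 <= Theta.
Proof. by rewrite /Theta lerDr mulr_ge0// (M_ge0 _ _ _ CM). Qed.

Lemma gap_rateE : gam * eps = 4 * m.+2%:R * M * Theta + 1.
Proof. by rewrite /gam mulfVK// gt_eqF// (su_eps SU). Qed.

Lemma gap_rate_gt0 : 0 < gam.
Proof.
have M0 := M_ge0 _ _ _ CM; have T0 := le_trans ler01 gap_level_ge1.
by rewrite /gam divr_gt0 ?(su_eps SU)// ltr_wpDl// !mulr_ge0.
Qed.

Section Step.
Variable N : R.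
Hypothesis N0 : 0 <= N.
Hypothesis HN : gap_le N.
Let B : R := m.+2%:R * M * Theta * N.

Lemma gap_source_ge0 : 0 <= B.
Proof.
have M0 := M_ge0 _ _ _ CM; have T0 := le_trans ler01 gap_level_ge1.
by rewrite /B !mulr_ge0.
Qed.

Lemma L_source_le (p j : 'I_m) t xi : (i <= p)%N -> inseg p t xi ->
  `|L_rhs P' K1 L1 i j p (finv i t) xi - L_rhs P' K2 L2 i j p (finv i t) xi| <= B * E t xi.
Proof.
move=> ip S; have [Ha Hb] := HN p t xi ip S; have M0 := M_ge0 _ _ _ CM; have T1 := gap_level_ge1.
apply: le_trans (L_rhs_gap P l JC CA i _ _ _ _ _ _ _ SU nu mnu nu01 P' PP' M CM _ _ _ _ S1 S2 p
  j t xi _ _ ip S Ha Hb) _.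
have E0 : 0 < E t xi by exact: expR_gt0.
have h : M * (N * E t xi) * 1 <= M * (N * E t xi) * Theta.
  by rewrite ler_wpM2l// !mulr_ge0// ltW.
by rewrite /B -[m.+2%:R]natr1; lra.
Qed.

Lemma K_source_le (p : 'I_m) t xi y : (i <= p)%N -> inseg p t xi -> 0 < y <= 1 ->
  `|K_rhs P' K1 L1 i p y (finv i t) xi - K_rhs P' K2 L2 i p y (finv i t) xi| <=
  M * `|GapK p t xi y| + B * E t xi.
Proof.
move=> ip S y01; have [Ha Hb] := HN p t xi ip S; have M0 := M_ge0 _ _ _ CM;
  have T1 := gap_level_ge1.
apply: le_trans (K_rhs_gap P l JC CA i _ _ _ _ _ _ _ SU nu mnu nu01 P' PP' M CM _ _ _ _ S1 S2 p
  t xi _ _ y ip S y01 Ha Hb) _.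
have E0 : 0 < E t xi by exact: expR_gt0.
have h0 : 0 <= M * (N * E t xi) by rewrite !mulr_ge0// ltW.
have h : M * (N * E t xi) * 1 <= M * (N * E t xi) * Theta by rewrite ler_wpM2l.
by rewrite lerD2l /B -[m.+2%:R]natr1 -[m.+1%:R]natr1; lra.
Qed.

Lemma gap_source_le : B <= N / 2 * Theta * (gam * eps).
Proof.
rewrite gap_rateE /B; have M0 := M_ge0 _ _ _ CM; have T1 := gap_level_ge1.
set X := m.+2%:R * M; have X0 : 0 <= X by rewrite /X mulr_ge0.
have -> : N / 2 * Theta * (4 * m.+2%:R * M * Theta + 1) = N * Theta * (2 * (X * Theta) + 1 / 2).
  by rewrite /X; field.
have -> : X * Theta * N = N * Theta * X by ring.
rewrite ler_wpM2l ?mulr_ge0//; first exact: le_trans ler01 T1.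
have : X * 1 <= X * Theta by rewrite ler_wpM2l.
by lra.
Qed.

Lemma gap_source_leK : 2 * B <= N / 2 * (gam * eps).
Proof.
rewrite gap_rateE /B; have -> : N / 2 * (4 * m.+2%:R * M * Theta + 1) =
  2 * (m.+2%:R * M * Theta * N) + N / 2 by field.
by rewrite lerDl divr_ge0.
Qed.

Lemma gap_damping_le : 2 * M <= gam * eps.
Proof.
rewrite gap_rateE; have M0 := M_ge0 _ _ _ CM; have T1 := gap_level_ge1.
have h : M * 1 <= M * Theta by rewrite ler_wpM2l.
have h0 : 0 <= m%:R * (M * Theta) by rewrite !mulr_ge0// (le_trans ler01).
by rewrite -[m.+2%:R]natr1 -[m.+1%:R]natr1; lra.
Qed.

(** [s] is the end nearer to the data and [t] the end at which the bound is wanted; both orders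
    occur, as data lie ahead for j < i. *)
Lemma L_piece (p j : 'I_m) (c lo hi t s : R) : let z r := finv j (c + r) in
  (i <= p)%N -> lo <= hi -> (t = hi /\ s = lo) \/ (t = lo /\ s = hi) ->
  (forall r, lo <= r <= hi -> inseg p r (z r)) ->
  (forall r, lo <= r <= hi -> r - kap * z r <= t - kap * z t - eps * `|t - r|) ->
  `|GapL j p s (z s)| <= N / 2 * Theta * E s (z s) ->
  `|GapL j p t (z t)| <= N / 2 * Theta * E t (z t).
Proof.
move=> z ip lohi ts Hin Hr Hs.
have [h [ih eh hE]] := gapL_increment P l JC CA i _ _ _ _ _ _ _ SU nu P' PP' _ _ _ _ S1 S2 p j
  c lo hi ip lohi Hin.
have mh : measurable_fun `[lo, hi] h by apply/measurable_EFinP; case/integrableP : ih.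
have := growth_step lo hi t s gam eps (N / 2 * Theta) B (GapL j p s (z s)) (fun r => r - kap *
  z r) h
  gap_rate_gt0 (su_eps SU) lohi ts Hr mh _ gap_source_ge0 gap_source_le Hs.
move=> H; apply: le_trans (H _); last by move=> r rr; rewrite hE; apply: L_source_le => //;
  exact: Hin.
case: ts => -[-> ->]; rewrite -eh.
  by rewrite -{1}[GapL j p hi _](subrK (GapL j p lo (z lo))) addrC ler_normD.
rewrite -{1}[GapL j p lo _](subrK (GapL j p hi (z hi))) addrC.
by apply: le_trans (ler_normD _ _) _; rewrite [X in _ + X <= _]distrC.
Qed.

(* Each characteristic is followed within one segment up to the neighbouring
   segment its data come from; inductions on the segment then cross the
   interfaces. *)
Lemma K_piece (y : R) (p : 'I_m) t xi : Good y -> (i <= p)%N -> inseg p t xi ->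
  exists s z, [/\ travel P p z = s, inseg p s z &
    (`|GapK p s z y| <= N / 2 * E s z -> `|GapK p t xi y| <= N / 2 * E t xi)].
Proof.
move=> gy ip S; have [y01 _ _] := gy.
have LK := su_LaminvK SU (nu y).
pose c := lam_travel P (nu y) xi + t; pose z r := Laminv (nu y) (c - r).
have zt : z t = xi by rewrite /z /c addrK (su_LamK SU).
have zle (r r' : R) : r <= r' -> z r' <= z r.
  by move=> rr; rewrite -(lam_travel_le P i _ _ _ _ _ _ _ SU (nu y)) !LK; lra.
have [/andP[x0 _] tT ft tf] := S.
have cz : continuous z.
  apply: (cont_comp _ _ _ (fun r => (nu y, c - r)) _ (su_Laminv_cont SU)).
  by apply: cont_pair; [exact: cont_cst|apply: contB; [exact: cont_cst|exact: cont_id]].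
have z0 (r : R) : 0 <= r <= t -> 0 <= z r by move=> /andP[_ rt]; apply: (le_trans x0);
  rewrite -zt zle.
have [||s /andP[s0 st] [fs Hs]] := entry_above P JC CA i _ _ _ _ _ _ _ SU p t xi z ip S zt cz z0.
- by move=> r r' _ rr _; have := zle r r' rr; rewrite -(travel_le P JC CA p); lra.
- move=> k pk r /andP[_ rt]; apply: (le_trans rt); apply: (le_trans (tf k pk)).
  by rewrite (travel_le P JC CA) -zt zle.
exists s, (z s); split => //; first by apply: Hs; rewrite lexx.
move=> Ds; rewrite -zt.
have [iF _] := gapK_increment P JC CA i _ _ _ _ _ _ _ SU nu nu01 P' PP' _ _ _ _ p y c s t ip gy
  st Hs.
apply: (gronwall s t gam eps (N / 2) B M (fun r => r - kap * z r) (fun r => GapK p r (z r) y) _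
    gap_rate_gt0 (su_eps SU) st _ iF _ _ gap_source_ge0 (M_ge0 _ _ _ CM) gap_source_leK
      gap_damping_le Ds).
- move=> r r' _ rr _; have zz := zle r r' rr; have k0 := su_kap SU.
  have e1 := su_eps1 SU.
  have h1 : 0 <= kap * (z r - z r') by rewrite mulr_ge0 ?subr_ge0.
  have h2 : 0 <= (1 - eps) * (r' - r) by rewrite mulr_ge0 ?subr_ge0.
  by lra.
- move=> r /andP[sr rt]; apply: (proj2 (gapK_increment P JC CA i _ _ _ _ _ _ _ SU nu nu01 P'
  PP' _ _ _ _ p y c s r ip gy sr _)).
  by move=> r' /andP[h1 h2]; apply: Hs; rewrite h1 (le_trans h2).
- by move=> r rr; apply: K_source_le => //; exact: Hs.
- by rewrite st lexx.
Qed.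

Lemma gap_weight_ge0 (A t xi : R) : 0 <= A -> 0 <= A * E t xi.
Proof. by move=> A0; rewrite mulr_ge0// ltW// expR_gt0. Qed.

Lemma segment_ind (Q : 'I_m -> Prop) : Q i ->
  (forall p p' : 'I_m, (i <= p')%N -> (p : nat) = p'.+1 -> Q p' -> Q p) ->
    forall p : 'I_m, (i <= p)%N -> Q p.
Proof.
move=> Qi Qs p ip; have [n] := ubnP (p - i); elim: n p ip => // n IH p ip.
rewrite ltnS => pn; have [e|ne] := eqVneq i p; first by rewrite -e.
have ltip : (i < p)%N by rewrite ltn_neqAle ip andbT.
have pm : (p.-1 < m)%N by rewrite prednK ?(ltnW (ltn_ord p))// (leq_ltn_trans _ ltip).
have pE : (p : nat) = p.-1.+1 by rewrite prednK// (leq_ltn_trans _ ltip).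
apply: (Qs p (Ordinal pm)) => //=; first by rewrite -ltnS -pE.
apply: IH => /=; first by rewrite -ltnS -pE.
by rewrite -subn1 subnAC subn1 prednK ?subn_gt0.
Qed.

Lemma segment_ind_down (j : 'I_m) (Q : 'I_m -> Prop) : (forall p : 'I_m, p.+1 = m -> Q p) ->
  (forall p p' : 'I_m, (j <= p)%N -> (p' : nat) = p.+1 -> Q p' -> Q p) ->
    forall p : 'I_m, (j <= p)%N -> Q p.
Proof.
move=> Qm Qs p jp; have [n] := ubnP (m - p); elim: n p jp => // n IH p jp.
rewrite ltnS => pn; have [e|ne] := eqVneq p.+1 m; first exact: Qm.
have pm : (p.+1 < m)%N by rewrite ltn_neqAle ne ltn_ord.
apply: (Qs p (Ordinal pm)) => //; apply: IH => /=; first by rewrite leqW.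
apply: leq_trans pn; rewrite ltn_sub2l//; exact: ltnW.
Qed.

(** Being pointwise in y, this serves both for the L^1 bound of the next round and, as N tends to 0,
    for the equality of the kernels. *)
Lemma K_step (y : R) (p : 'I_m) t xi : Good y -> (i <= p)%N -> inseg p t xi ->
  `|GapK p t xi y| <= N / 2 * E t xi.
Proof.
move=> gy ip; move: p ip t xi; apply: segment_ind => [|p p' ip' pE IH] t xi S.
  have [s [z [fz Sz]]] := K_piece y i t xi gy (leqnn _) S; apply.
  by have [_ ->//] := gap_diag s z Sz fz; rewrite normr0 gap_weight_ge0// divr_ge0.
have [s [z [fz Sz]]] := K_piece y p t xi gy ltac:(by rewrite pE leqW) S; apply.
have [_ ->//] := gap_cross p p' s z ip' pE Sz fz.
by apply: IH; exact: (inseg_down P JC CA i p p').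
Qed.

Lemma L_above_piece (p j : 'I_m) t xi : (i <= p < j)%N -> inseg p t xi ->
  exists s z, [/\ travel P p z = s, inseg p s z &
    (`|GapL j p s z| <= N / 2 * Theta * E s z -> `|GapL j p t xi| <= N / 2 * Theta * E t xi)].
Proof.
move=> /andP[ip pj] S; have fK := su_finvK SU j.
pose c := travel P j xi - t; pose z r := finv j (c + r).
have fz r : travel P j (z r) = c + r by exact: fK.
have zt : z t = xi by rewrite /z /c subrK (su_fK SU).
have zle (r r' : R) : r <= r' -> z r <= z r'.
  by move=> rr; rewrite -(travel_le P JC CA j) !fz lerD2l.
have [/andP[x0 _] tT ft tf] := S.
have c0' : 0 <= c by rewrite /c subr_ge0; exact: tf.
have cz : continuous z.
  apply: (cont_comp _ _ _ (fun r => c + r) _ (su_finv_cont SU j)).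
  by apply: contD; [exact: cont_cst|exact: cont_id].
have z0 (r : R) : 0 <= r <= t -> 0 <= z r.
  by move=> /andP[r0 _]; rewrite -(travel_le P JC CA j) travel0 fz addr_ge0.
have drop (a b : 'I_m) (r r' : R) : (a < b)%N -> r <= r' ->
    travel P b (z r) - travel P a (z r) <= travel P b (z r') - travel P a (z r').
  move=> ab rr; have h := su_dslope SU a b ab _ _ (zle r r' rr).
  by have : 0 <= c0 * (z r' - z r);
    [rewrite mulr_ge0 ?subr_ge0 ?zle// ltW//; exact: su_c0 SU|lra].
have [||s /andP[s0 st] [fs Hs]] := entry_above P JC CA i _ _ _ _ _ _ _ SU p t xi z ip S zt cz z0.
- by move=> r r' _ rr _; have := drop p j r r' pj rr; rewrite !fz; lra.
- move=> k pk r /andP[r0 rt]; have [kj|jk|e] := ltngtP k j.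
  + by have := drop k j r t kj rt; have := tf k pk; rewrite !fz zt; lra.
  + apply: le_trans (travel_index_le P JC CA j k (z r) (ltnW jk) (z0 r ltac:(by rewrite r0))).
    by rewrite fz lerDr.
  + by rewrite (val_inj e) fz lerDr.
exists s, (z s); split => //; first by apply: Hs; rewrite lexx.
move=> Ds; rewrite -zt; apply: (L_piece p j c s t t s) => //; first by left.
move=> r /andP[sr rt]; have ij : (i <= j)%N := leq_trans ip (ltnW pj).
have := su_slow SU j ij _ _ (zle r t rt).
by rewrite !fz ger0_norm ?subr_ge0//; rewrite -/(z r) -/(z t); lra.
Qed.

(** The induction crosses interfaces with index at most p < j, hence not the one at which L_j may
    jump. *)
Lemma L_above (p j : 'I_m) t xi : (i <= p < j)%N -> inseg p t xi ->
  `|GapL j p t xi| <= N / 2 * Theta * E t xi.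
Proof.
have A0 : 0 <= N / 2 * Theta by rewrite mulr_ge0 ?divr_ge0// (le_trans ler01 gap_level_ge1).
move=> /andP[ip]; move: p ip t xi; apply: segment_ind => [|p p' ip' pE IH] t xi pj S.
  have [|s [z [fz Sz]]] := L_above_piece i j t xi _ S; first by rewrite leqnn.
  apply; have [->] := gap_diag s z Sz fz; first by rewrite normr0 gap_weight_ge0.
  by apply/eqP => e; rewrite e ltnn in pj.
have [|s [z [fz Sz]]] := L_above_piece p j t xi _ S; first by rewrite pj pE leqW.
apply; have [->] := gap_cross p p' s z ip' pE Sz fz.
  by move=> _; apply: IH; [rewrite (leq_trans _ (ltnW pj))// pE|exact: (inseg_down P JC CA i p p')].
by apply/eqP => e; rewrite e ltnn in pj.
Qed.

(** Segments are left downwards, across interfaces with index above p >= j, so the jump of L_j is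
    not met here either. *)
Lemma L_below (j p : 'I_m) t xi : (i <= j <= p)%N -> inseg p t xi ->
  `|GapL j p t xi| <= N / 2 * Theta * E t xi.
Proof.
move=> /andP[ij]; move: p t xi.
suff H (p : 'I_m) : (j <= p)%N -> forall t xi, inseg p t xi ->
  `|GapL j p t xi| <= N / 2 * Theta * E t xi.
  by move=> p t xi /H; apply.
have piece (q : 'I_m) t xi : (j <= q)%N -> inseg q t xi -> exists s z,
    [/\ inseg q s z, (q.+1 = m /\ z = 0) \/ (exists q' : 'I_m, [/\ (q' : nat) = q.+1,
      travel P q' z = s & inseg q' s z]) &
    (`|GapL j q s z| <= N / 2 * Theta * E s z -> `|GapL j q t xi| <= N / 2 * Theta * E t xi)].
  move=> jq S; have ijq : (i <= j <= q)%N by rewrite ij.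
  have [s st [Hs He]] := entry_below P JC CA i _ _ _ _ _ _ _ SU q j t xi ijq S.
  set c := travel P j xi - t in Hs He.
  exists s, (finv j (c + s)); split => //; first by apply: Hs; rewrite lexx.
  move=> Ds; have zt : finv j (c + t) = xi by rewrite /c subrK (su_fK SU).
  rewrite -[X in GapL j q t X]zt -[X in E t X]zt.
  apply: (L_piece q j c s t t s) => //; [exact: leq_trans jq|by left|].
  move=> r /andP[sr rt]; have fK := su_finvK SU j.
  have zz : finv j (c + r) <= finv j (c + t) by rewrite -(travel_le P JC CA j) !fK lerD2l.
  have := su_slow SU j ij _ _ zz.
  by rewrite !fK ger0_norm ?subr_ge0//; lra.
move: p; apply: segment_ind_down => [p pm|p p' jp pE IH] t xi S.
  have jp : (j <= p)%N by have := ltn_ord j; rewrite -{2}pm ltnS.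
  have [s [z [Sz [[_ z0]|[q' [qE _ _]]]]]] := piece p t xi jp S; last first.
    by have := ltn_ord q'; rewrite qE pm ltnn.
  (* At xi = 0 the bound for K gives the constant M * N, which 2 M + 1 = Theta makes at most N / 2 *
     Theta. *)
  apply; rewrite z0 in Sz *; apply: (le_trans (gap_bottom p j s pm ij Sz)).
  have [_ h] := HN p s 0 (leq_trans ij jp) Sz; have M0 := M_ge0 _ _ _ CM.
  apply: le_trans (ler_wpM2l M0 h) _; rewrite mulrA ler_wpM2r ?expR_ge0//.
  have -> : N / 2 * Theta = M * N + N / 2 by rewrite /Theta; field.
  by rewrite lerDl divr_ge0.
have [s [z [Sz [[pm _]|[q' [qE fz Sq]]]]]] := piece p t xi jp S.
  by have := ltn_ord p'; rewrite pE pm ltnn.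
have {}qE : q' = p' by apply/val_inj; rewrite /= qE pE.
rewrite qE in fz Sq; apply.
have [<-] := gap_cross p' p s z (leq_trans ij jp) pE Sq fz; first by move=> _; exact: IH.
by apply/eqP => e; move: pE; rewrite -e => pE; rewrite pE ltnn in jp.
Qed.

Lemma L_right (j p : 'I_m) t xi : (j < i <= p)%N -> inseg p t xi ->
  `|GapL j p t xi| <= N / 2 * Theta * E t xi.
Proof.
have A0 : 0 <= N / 2 * Theta by rewrite mulr_ge0 ?divr_ge0// (le_trans ler01 gap_level_ge1).
move=> /andP[ji ip].
have piece (q : 'I_m) t' xi' : (i <= q)%N -> inseg q t' xi' -> exists s z,
    [/\ inseg q s z, s = travel P i 1 \/ travel P q z = s &
    (`|GapL j q s z| <= N / 2 * Theta * E s z -> `|GapL j q t' xi'| <= N / 2 * Theta * E t' xi')].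
  move=> iq S; have jiq : (j < i <= q)%N by rewrite ji.
  have [s st [Hs He]] := exit_right P JC CA i _ _ _ _ _ _ _ SU q j t' xi' jiq S.
  set c := travel P j xi' - t' in Hs He.
  exists s, (finv j (c + s)); split => //; first by apply: Hs; rewrite st lexx.
  move=> Ds; have zt : finv j (c + t') = xi' by rewrite /c subrK (su_fK SU).
  rewrite -[X in GapL j q t' X]zt -[X in E t' X]zt.
  apply: (L_piece q j c t' s t' s) => //; [by right|].
  move=> r /andP[tr rs]; have fK := su_finvK SU j.
  have zz : finv j (c + t') <= finv j (c + r) by rewrite -(travel_le P JC CA j) !fK lerD2l.
  have := su_fast SU j ji _ _ zz.
  by rewrite !fK ler0_norm ?subr_le0//; lra.
have right (q : 'I_m) s z : (i <= q)%N -> inseg q s z -> s = travel P i 1 ->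
  `|GapL j q s z| <= N / 2 * Theta * E s z.
  by move=> iq S e; rewrite e in S *; rewrite gap_right ?ji// normr0 gap_weight_ge0.
move: p ip t xi; apply: segment_ind => [|p p' ip' pE IH] t xi S.
  have [s [z [Sz [e|fz]]]] := piece i t xi (leqnn _) S; apply; first exact: right.
  have [->] := gap_diag s z Sz fz; first by rewrite normr0 gap_weight_ge0.
  by apply/eqP => e; rewrite e ltnn in ji.
have ip : (i <= p)%N by rewrite pE leqW.
have [s [z [Sz [e|fz]]]] := piece p t xi ip S; apply; first exact: right.
have [->] := gap_cross p p' s z ip' pE Sz fz.
  by move=> _; apply: IH; exact: (inseg_down P JC CA i p p').
by apply/eqP => e; have := leq_trans ji ip; rewrite e ltnn.
Qed.

Lemma gapK_L2 (p : 'I_m) t xi : (i <= p)%N -> inseg p t xi -> L2_on leb I01 (GapK p t xi).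
Proof.
move=> ip S; have T := inseg_Tseg P JC CA i _ _ _ _ _ _ _ SU p t xi ip S.
have mI : measurable (@I01 R) by exact: measurable_itv.
rewrite -(sa_mu PP') in T.
have [[k1 _ _] [k2 _ _]] := (S1, S2).
have [[h1 _] _] := k1 i p ip; have [[h2 _] _] := k2 i p ip.
have a1 : L2_on leb I01 (K1 i p (finv i t) xi) := h1 _ T.
have a2 : L2_on leb I01 (K2 i p (finv i t) xi) := h2 _ T.
exact: (L2_onB _ _ leb I01 _ _ a1 a2).
Qed.

Lemma gap_half : gap_le (N / 2).
Proof.
move=> p t xi ip S; split.
  move=> j; have [ji|ij] := ltnP j i; first by apply: L_right; rewrite ?ji.
  have [jp|pj] := leqP j p; first by apply: L_below; rewrite ?ij.
  by apply: L_above; rewrite ?ip.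
have mI : measurable (@I01 R) by exact: measurable_itv.
have Lg := gapK_L2 p t xi ip S.
have [_ h] := L2_on_L1 _ _ leb I01 mI leb_I01 _ Lg.
apply: le_trans h _; apply: (L2_norm_le _ _ leb I01 mI leb_I01).
- by rewrite gap_weight_ge0// divr_ge0.
- exact: (L2_on_measurable _ _ leb I01 mI _ Lg).
- have := good_ae l P' _ _ _ _ S1 S2; apply: negligibleS => y /= H h'; apply: H => Iy.
  by apply: K_step => //; exact: h'.
Qed.

End Step.

(** Through [TsegP] the segment is cut out of the square by inequalities between continuous travel
    times, so no continuity of [rho] is involved. *)
Lemma Tseg_compact (p : 'I_m) : (i <= p)%N -> compact (Tseg (c_mu P) i p).
Proof.
move=> ip; pose F (k : 'I_m) (z : R * R) := travel P k z.2 - travel P i z.1.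
have cF k : continuous (F k).
  apply: contB; first exact: (cont_comp _ _ _ _ _ (travel_cont P CA k) (cont_snd _ _ _ _
    (@cont_id _))).
  exact: (cont_comp _ _ _ _ _ (travel_cont P CA i) (cont_fst _ _ _ _ (@cont_id _))).
have clF k : closed [set z | F k z <= 0] /\ closed [set z | 0 <= F k z].
  split; first by apply: (@closed_comp _ _ (F k) [set x | x <= 0]); [by move=> z _;
    exact: cF|exact: closed_le].
  by apply: (@closed_comp _ _ (F k) [set x | 0 <= x]); [by move=> z _; exact: cF|exact: closed_ge].
have cI : compact (@I01 R `*` @I01 R) by apply: compact_setX; exact: segment_compact.
have -> : Tseg (c_mu P) i p = (@I01 R `*` @I01 R) `&` ([set z | F p z <= 0] `&`
    \bigcap_(k in [set k : 'I_m | (p < k)%N]) [set z | 0 <= F k z]).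
  apply/seteqP; split => -[x xi].
    move=> /(TsegP P JC CA _ _ _ _ ip)[x01 xi01 h1 h2]; split; first by split; rewrite /= I01E.
    by split; [rewrite /F /= subr_le0|move=> k /= pk; rewrite /F /= subr_ge0; exact: h2].
  rewrite /= !I01E => -[[x01 xi01] [h1 h2]]; apply/(TsegP P JC CA _ _ _ _ ip); split => //.
    by rewrite -subr_le0.
  by move=> k pk; rewrite -subr_ge0; exact: (h2 k pk).
apply: (subclosed_compact _ cI) => //.
apply: closedI; first exact: compact_closed.
apply: closedI; first exact: (clF p).1.
by apply: closed_bigI => k _; exact: (clF k).2.
Qed.

Lemma within_bounded (T : topologicalType) (A : set T) (f : T -> R) : compact A ->
  {within A, continuous f} ->
  exists B, forall x, A x -> `|f x| <= B.
Proof.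
move=> cA cf; have /compact_bounded[B [_ HB]] := continuous_compact cf cA.
exists (B + 1) => x Ax; apply: (HB (B + 1)); first by rewrite ltrDl.
by exists x.
Qed.

(** By the reverse triangle inequality, and since on [0, 1] the L^1 norm is at most the L^2 norm. *)
Lemma kernel_norm_cont (K : kernelK R m) (L : kernelL R m) (p : 'I_m) : kernels_continuous P' K L ->
  (i <= p)%N -> {within Tseg (c_mu P) i p, continuous (fun z : R * R => \int[mu]_(y in `[0,
    1]) `|K i p z.1 z.2 y|)}.
Proof.
move=> kK ip; have [[h1 h2] _] := kK i p ip.
rewrite (sa_mu PP') in h1 h2.
have mI : measurable (@I01 R) by exact: measurable_itv.
apply/subspace_continuousP => a Ta; apply/cvgrPdist_le => e e0.
have := h2 a Ta => /cvgrPdist_le/(_ e e0); apply: filter_app; near=> b.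
rewrite sub0r normrN => /(le_trans (ler_norm _)) He; apply: le_trans He.
have Tb : Tseg (c_mu P) i p b by near: b; exact: withinT.
have La : L2_on leb I01 (K i p a.1 a.2) := h1 _ Ta.
have Lb : L2_on leb I01 (K i p b.1 b.2) := h1 _ Tb.
have [ia _] := L2_on_L1 _ _ leb I01 mI leb_I01 _ La.
have [ib _] := L2_on_L1 _ _ leb I01 mI leb_I01 _ Lb.
have [iba h] := L2_on_L1 _ _ leb I01 mI leb_I01 _ (L2_onB _ _ leb I01 _ _ Lb La).
apply: le_trans h.
have na := integrable_normR _ _ _ ia; have nb := integrable_normR _ _ _ ib.
rewrite -RintegralB//; apply: (le_trans (le_normr_Rintegral _ _)) => //.
  exact: integrable_diff.
apply: le_Rintegral => //.
- exact: (integrable_normR _ _ _ (integrable_diff _ _ _ _ na nb)).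
- exact: integrable_normR.
- by move=> y _; rewrite distrC; exact: ler_dist_dist.
Unshelve. all: by end_near. Qed.

(** Continuity on compact segments bounds both solutions, and the weight is bounded below since t >=
    0 and xi <= 1. *)
Lemma gap_initial : exists2 N, 0 <= N & gap_le N.
Proof.
have [[k1 _ _] [k2 _ _]] := (S1, S2).
have bd (p : 'I_m) : exists B, forall t xi, (i <= p)%N -> inseg p t xi ->
    (forall j, `|GapL j p t xi| <= B) /\ GapK1 p t xi <= B.
  have [ip|] := boolP (i <= p)%N; last by exists 0.
  have cT := Tseg_compact p ip.
  have bL (K : kernelK R m) (L : kernelL R m) : kernels_continuous P' K L ->
      exists B, forall (j : 'I_m) z, Tseg (c_mu P) i p z -> `|L i j p z.1 z.2| <= B.
    move=> kK; have [_ h] := kK i p ip; rewrite (sa_mu PP') in h.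
    have bj (j : 'I_m) : exists B, forall z,
      `|if `[< Tseg (c_mu P) i p z >] then L i j p z.1 z.2 else 0| <= B.
      have [B HB] := within_bounded _ _ _ cT (h j); exists `|B| => z.
      case: asboolP => [Tz|_]; last by rewrite normr0.
      exact: le_trans (HB z Tz) (ler_norm _).
    have [B HB] := fin_bound 'I_m _ _ bj; exists B => j z Tz.
    by have := HB j z; case: asboolP.
  have [BL1 HL1] := bL _ _ k1; have [BL2 HL2] := bL _ _ k2.
  have [BK1 HK1] := within_bounded _ _ _ cT (kernel_norm_cont _ _ p k1 ip).
  have [BK2 HK2] := within_bounded _ _ _ cT (kernel_norm_cont _ _ p k2 ip).
  exists (Num.max (BL1 + BL2) (BK1 + BK2)) => t xi _ S.
  have T := inseg_Tseg P JC CA i _ _ _ _ _ _ _ SU p t xi ip S.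
  split.
    move=> j; rewrite le_max; apply/orP; left; apply: (le_trans (ler_normB _ _)).
    by apply: lerD; [exact: (HL1 j _ T)|exact: (HL2 j _ T)].
  rewrite le_max; apply/orP; right.
  have i1 := kernel_integrable P i nu P' PP' _ _ _ _ _ k1 ip T.
  have i2 := kernel_integrable P i nu P' PP' _ _ _ _ _ k2 ip T.
  have n1 := integrable_normR _ _ _ i1; have n2 := integrable_normR _ _ _ i2.
  apply: le_trans (lerD (le_trans (ler_norm _) (HK1 _ T)) (le_trans (ler_norm _) (HK2 _ T))).
  rewrite -RintegralD//; apply: le_Rintegral => //.
  - exact: (integrable_normR _ _ _ (integrable_diff _ _ _ _ i1 i2)).
  - have := fun mD => integrableD mD n1 n2; move=> /(_ (measurable_itv _)).
    by apply: eq_integrable => // y _ /=.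
  - by move=> y _; exact: ler_normB.
have {bd}[B HB] : exists B, forall (p : 'I_m) t xi, (i <= p)%N -> inseg p t xi ->
    (forall j, `|GapL j p t xi| <= B) /\ GapK1 p t xi <= B.
  have /choice[b Hb] := bd; exists (\sum_p `|b p|) => p t xi ip S.
  have bp : b p <= \sum_p `|b p|.
    apply: (le_trans (ler_norm _)); rewrite (bigD1 p)//= lerDl; exact: sumr_ge0.
  have [h1 h2] := Hb p t xi ip S; split; last exact: le_trans h2 bp.
  by move=> j; exact: le_trans (h1 j) bp.
have T1 := gap_level_ge1; have g0 := gap_rate_gt0; have k0 := su_kap SU.
pose e0 := expR (- (gam * kap)); have e00 : 0 < e0 by exact: expR_gt0.
exists (`|B| / e0); first by rewrite divr_ge0// ltW.
have Ege (p : 'I_m) t xi : (i <= p)%N -> inseg p t xi -> `|B| <= `|B| / e0 * E t xi.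
  move=> ip S; rewrite mulrAC -mulrA ler_peMr// ler_pdivlMr// mul1r ler_expR.
  have [t0 _ _ _] := inseg_bounds P JC CA i _ _ _ _ _ _ _ SU p t xi ip S.
  have [/andP[_ x1] _ _ _] := S.
  rewrite -mulrN ler_wpM2l ?(ltW g0)//.
  by have := ler_wpM2l k0 x1; lra.
move=> p t xi ip S; have [h1 h2] := HB p t xi ip S; have h := Ege p t xi ip S.
split; last exact: le_trans h2 (le_trans (ler_norm _) h).
move=> j; apply: (le_trans (h1 j)); apply: (le_trans (ler_norm _)); apply: (le_trans h).
rewrite ler_wpM2r// ?expR_ge0// ler_peMr// divr_ge0// ltW//.
Qed.

Lemma gap_small (e : R) : 0 < e -> exists2 N, 0 <= N <= e & gap_le N.
Proof.
have [N N0 HN] := gap_initial.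
by apply: (halving gap_le N N0 HN) => N'; exact: gap_half.
Qed.

Lemma gap_zero (p : 'I_m) (t xi : R) : (i <= p)%N -> inseg p t xi ->
  (forall j, GapL j p t xi = 0) /\ forall y, Good y -> GapK p t xi y = 0.
Proof.
move=> ip S; have T1 := gap_level_ge1.
have small (v a : R) : 0 < a -> (forall N, 0 <= N -> gap_le N -> `|v| <= N * a) -> v = 0.
  move=> a0 H; apply/eqP; rewrite -normr_eq0; apply/eqP; apply/le_anti; rewrite normr_ge0 andbT.
  apply/ler_addgt0Pr => e e0; rewrite add0r.
  have [|N /andP[N0 Ne] HN] := gap_small (e / a); first by rewrite divr_gt0.
  by apply: (le_trans (H N N0 HN)); rewrite -ler_pdivlMr.
split.
  move=> j; apply: (small _ (Theta * E t xi));
    first by rewrite mulr_gt0 ?expR_gt0// (lt_le_trans ltr01).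
  by move=> N N0 HN; rewrite mulrA; have [h _] := HN p t xi ip S; exact: h.
move=> y gy; apply: (small _ (E t xi)); first exact: expR_gt0.
move=> N N0 HN; apply: le_trans (K_step N N0 HN y p t xi gy ip S) _.
by rewrite ler_wpM2r ?expR_ge0//; lra.
Qed.

End Contraction.

Section Uniqueness.
Context {R : realType} {m : nat} (P : continuum_params R m) (l : 'I_m -> 'I_m -> R -> R).
Hypothesis JC : jointly_continuous P.
Hypothesis CA : continuum_assumption P.
Hypothesis AL : admissible_l P l.
Variable nu : R -> R.
Hypothesis mnu : measurable_fun setT nu.
Hypothesis nu01 : forall s, 0 <= nu s <= 1.
Variable P' : continuum_params R m.
Hypothesis PP' : sampled R m P P' nu.

Lemma segmented_solution_unique (K1 K2 : kernelK R m) (L1 L2 : kernelL R m) :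
  segmented_solution P' l K1 L1 -> segmented_solution P' l K2 L2 ->
  (forall i j p : 'I_m, (i <= p)%N -> forall x xi, Tseg (c_mu P) i p (x, xi) ->
     L1 i j p x xi = L2 i j p x xi) /\
  {ae @lebesgue_measure R, forall y, I01 y -> forall i p : 'I_m, (i <= p)%N ->
     forall x xi, Tseg (c_mu P) i p (x, xi) -> K1 i p x xi y = K2 i p x xi y}.
Proof.
move=> S1 S2.
have H (i p : 'I_m) (x xi : R) : (i <= p)%N -> Tseg (c_mu P) i p (x, xi) ->
    (forall j, L1 i j p x xi = L2 i j p x xi) /\
    (forall y, good P' K1 K2 L1 L2 y -> K1 i p x xi y = K2 i p x xi y).
  move=> ip T; have [kap [eps [c0 [finv [Laminv [zK [zd SU]]]]]]] := setup_exists P JC CA i.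
  have [M CM] := kcoefs_bounded P l JC CA AL i _ _ _ _ _ _ _ SU.
  have [S _] := in_segment_Tseg P JC CA _ _ _ _ ip T.
  have [h1 h2] := gap_zero P l JC CA i _ _ _ _ _ _ _ SU nu mnu nu01 P' PP' M CM _ _ _ _ S1 S2 p
    _ _ ip S.
  rewrite /gapL /gapK (su_fK SU) in h1 h2.
  split; first by move=> j; apply/eqP; rewrite -subr_eq0; apply/eqP; have := h1 j.
  by move=> y gy; apply/eqP; rewrite -subr_eq0; apply/eqP; exact: h2.
split; first by move=> i j p ip x xi T; have [h _] := H i p x xi ip T.
have := good_ae l P' _ _ _ _ S1 S2; apply: negligibleS => y /= N G; apply: N => Iy i p ip x xi T.
by have [_ h] := H i p x xi ip T; apply: h; exact: G.
Qed.

End Uniqueness.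

(** * Dependence on the sampling of the ensemble variable *)

Section Dependence.
Context {R : realType} {m : nat} (G : @characteristics R m) (C : @coefficients R m) (M : R).
Hypothesis GA : char_axioms G.
Hypothesis CA : coef_axioms G C M.
Notation mu := (@lebesgue_measure R).
Notation state := (@channel m * (R * R * R) -> R).

Lemma avg_close (nu nu' : R -> R) (f : R -> R) (e : R) : measurable_fun setT nu ->
  measurable_fun setT nu' ->
  (forall s, 0 <= nu s <= 1) -> (forall s, 0 <= nu' s <= 1) -> continuous f ->
  (forall s, 0 <= s <= 1 -> `|f (nu' s) - f (nu s)| <= e) -> `|avg nu' f - avg nu f| <= e.
Proof.
move=> mnu mnu' nu01 nu01' cf H; rewrite /avg.
have i1 := avg_integrable nu f mnu nu01 cf; have i2 := avg_integrable nu' f mnu' nu01' cf.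
rewrite -RintegralB//.
have /integrableP[mD _] : mu.-integrable `[0, 1] (EFin \o (fun s => f (nu' s) - f (nu s))).
  have := fun mD => integrableB mD i2 i1; move=> /(_ (measurable_itv _)).
  by apply: eq_integrable => // y _ /=.
have := @Rintegral_bound R 0 1 e (fun s => f (nu' s) - f (nu s)) ler01 _ H.
by rewrite subr0 mulr1; apply; exact/measurable_EFinP.
Qed.

Let box : set (R * R * R * R) := (`[0, horizon G] `*` `[0, 1] `*` `[0, 1] `*` `[0, 1])%classic.

Lemma box_modulus (f : R * R * R * R -> R) (e : R) : continuous f -> 0 < e ->
  exists2 d, 0 < d & forall (t xi y s s' : R), 0 <= t <= horizon G -> 0 <= xi <= 1 ->
    0 <= y <= 1 -> 0 <= s <= 1 ->
    `|s' - s| < d -> `|f (t, xi, y, s') - f (t, xi, y, s)| <= e.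
Proof.
move=> cf e0; have [|d d0 H] := unif_cont_compact _ box f e _ cf e0.
  by do 3?apply: compact_setX; exact: segment_compact.
exists d => // t xi y s s' t01 xi01 y01 s01 ss'; rewrite distrC; apply/ltW/H.
  by rewrite /box /= !in_itv.
by split; [exact: ballxx|rewrite /ball /= distrC].
Qed.

Lemma state_modulus (u : state) (e : R) : regular G u -> 0 < e ->
  exists2 d, 0 < d & forall q (t xi s s' : R), 0 <= t <= horizon G -> 0 <= xi <= 1 -> 0 <= s <= 1 ->
    `|s' - s| < d -> `|u (q, (t, xi, s')) - u (q, (t, xi, s))| <= e.
Proof.
move=> [cu _ _] e0; apply: fin_common; last first.
  by move=> q d d' dd H t xi s s' t01 xi01 s01 ss; apply: H => //; exact: lt_le_trans dd.
move=> q; have [|d d0 H] := box_modulus (fun z => u (q, (z.1.1.1, z.1.1.2, z.2))) e _ e0.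
  apply: (cont_comp _ _ _ (fun z : R * R * R * R => (z.1.1.1, z.1.1.2, z.2)) _ (cu q)).
  have c1 := cont_fst _ _ _ _ (@cont_id (R * R * R * R)%type).
  have c11 := cont_fst _ _ _ _ c1.
  apply: cont_pair; last exact: cont_snd (@cont_id _).
  by apply: cont_pair; [exact: cont_fst c11|exact: cont_snd c11].
exists d => // t xi s s' t01 xi01 s01 ss.
by apply: (H t xi 0 s s') => //; rewrite lexx ler01.
Qed.

(** [nu] enters only through averages, whose change is controlled by the modulus of continuity of
    the averaged functions on a compact box. *)
Lemma evolve_modulus (nu : R -> R) (u : state) (e : R) : measurable_fun setT nu ->
  (forall s, 0 <= nu s <= 1) ->
  regular G u -> 0 < e -> exists2 d, 0 < d & forall nu' : R -> R, measurable_fun setT nu' ->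
    (forall s, 0 <= nu' s <= 1) -> (forall s, 0 <= s <= 1 -> `|nu' s - nu s| < d) ->
    forall x, `|evolve G C nu' u x - evolve G C nu u x| <= e.
Proof.
move=> mnu nu01 ru e0; have [cu _ _] := ru.
(* One share [e1] for the initial value and at most |T| shares for the path integral. *)
pose T := horizon G; pose e1 := e / (1 + `|T|).
have T0 : 0 < 1 + `|T| by rewrite ltr_pwDl.
have e10 : 0 < e1 by rewrite divr_gt0.
have [d1 d10 H1] : exists2 d, 0 < d & forall q (t xi y s s' : R), 0 <= t <= T ->
  0 <= xi <= 1 -> 0 <= y <= 1 -> 0 <= s <= 1 ->
    `|s' - s| < d -> `|u (None, (t, xi, s')) * cS C q (xi, s', y) - u (None, (t, xi,
      s)) * cS C q (xi, s, y)| <= e1.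
  apply: fin_common; last first.
    by move=> q d d' dd H t xi y s s' t01 xi01 y01 s01 ss; apply: H => //; exact: lt_le_trans dd.
  move=> q; have [|d d0 H] := box_modulus (fun z => u (None, (z.1.1.1, z.1.1.2,
    z.2)) * cS C q (z.1.1.2, z.2, z.1.2)) e1 _ e10.
    have c1 := cont_fst _ _ _ _ (@cont_id (R * R * R * R)%type).
    have c2 := cont_snd _ _ _ _ (@cont_id (R * R * R * R)%type).
    have c11 := cont_fst _ _ _ _ c1; have c12 := cont_snd _ _ _ _ c1.
    have c111 := cont_fst _ _ _ _ c11; have c112 := cont_snd _ _ _ _ c11.
    apply: contM.
      apply: (cont_comp _ _ _ (fun z : R * R * R * R => (z.1.1.1, z.1.1.2, z.2)) _ (cu None)).
      by apply: cont_pair => //; exact: cont_pair.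
    apply: (cont_comp _ _ _ (fun z : R * R * R * R => (z.1.1.2, z.2,
      z.1.2)) _ (cS_cont _ _ _ CA q)).
    by apply: cont_pair => //; exact: cont_pair.
  by exists d.
have [d2 d20 H2] : exists2 d, 0 < d & forall q (t s s' : R), 0 <= t <= T -> 0 <= s <= 1 ->
    `|s' - s| < d -> `|u (None, (t, 0, s')) * cB C q s' - u (None, (t, 0, s)) * cB C q s| <= e1.
  apply: fin_common; last first.
    by move=> q d d' dd H t s s' t01 s01 ss; apply: H => //; exact: lt_le_trans dd.
  move=> q; have [|d d0 H] := box_modulus (fun z => u (None, (z.1.1.1, 0,
    z.2)) * cB C q z.2) e1 _ e10.
    have c1 := cont_fst _ _ _ _ (@cont_id (R * R * R * R)%type).
    have c2 := cont_snd _ _ _ _ (@cont_id (R * R * R * R)%type).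
    have c111 := cont_fst _ _ _ _ (cont_fst _ _ _ _ c1).
    apply: contM; last exact: (cont_comp _ _ _ _ _ (cB_cont _ _ _ CA q) c2).
    apply: (cont_comp _ _ _ (fun z : R * R * R * R => (z.1.1.1, 0, z.2)) _ (cu None)).
    by apply: cont_pair => //; apply: cont_pair => //; exact: cont_cst.
  exists d => // t s s' t01 s01 ss; apply: (H t 0 0 s s') => //; by rewrite lexx ler01.
exists (Num.min d1 d2); first by rewrite lt_min d10.
move=> nu' mnu' nu01' Hnu x.
have h1 (s : R) : 0 <= s <= 1 -> `|nu' s - nu s| < d1 by move=> /Hnu; rewrite lt_min => /andP[].
have h2 (s : R) : 0 <= s <= 1 -> `|nu' s - nu s| < d2 by move=> /Hnu; rewrite lt_min => /andP[].
case: x => q z; rewrite /evolve /=; have D := proj_dom _ GA q z.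
case: (proj G q z) D => -[t xi] y D /=.
have [b1 b2 b3] := dom_bounds _ GA q t xi y D.
rewrite /transported; set c := invar G q (t, xi, y).
have [l0 lr rT] := path_sides _ GA _ _ _ _ D; rewrite -/c in l0 lr rT.
set lo := path_left G q c y t in l0 lr *; set hi := path_right G q c y t in lr rT *.
have ip (w : R -> R) : measurable_fun setT w -> (forall s, 0 <= w s <= 1) ->
    mu.-integrable `[lo, hi] (EFin \o along G C w u q c y).
  by move=> mw w01; exact: (integrable_along _ _ _ GA CA w mw w01).
have cslice (r xi' y' : R) : continuous (fun s => u (None, (r, xi', s)) * cS C q (xi', s, y')).
  by apply: contM; [exact: (cont_slice G)|exact: (cont_cS _ _ _ CA)].
set i1 := initial _ _ nu' _ _ _ _; set i2 := initial _ _ nu _ _ _ _.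
have hI : `|i1 - i2| <= e1.
  rewrite /i1 /i2 /initial opprD addrACA subrr add0r; case: ifP => bq;
    last by rewrite subrr normr0 ltW.
  apply: avg_close => //.
    by apply: contM; [exact: (cont_slice G)|exact: (cB_cont _ _ _ CA)].
  move=> s s01; apply: H2 => //; last exact: h2.
  by have [] := dom_bounds _ GA _ _ _ _ (bottom_dom _ GA q t xi y s bq D s01).
set I1 := Rintegral _ _ _; set I2 := Rintegral _ _ _.
have -> : i1 + (-1) ^+ (~~ forward G q) * I1 - (i2 + (-1) ^+ (~~ forward G q) * I2) =
  (i1 - i2) + (-1) ^+ (~~ forward G q) * (I1 - I2) by ring.
apply: (le_trans (ler_normD _ _)); rewrite normrM normrX normrN1 expr1n mul1r.
have hII : `|I1 - I2| <= e1 * (hi - lo).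
  rewrite /I1 /I2 -RintegralB//; [|exact: ip|exact: ip].
  apply: Rintegral_bound => //.
    by apply: measurable_funTS; apply: measurable_funB; exact: (measurable_along _ _ _ GA CA).
  move=> r rb; have [|Dr _] := flow_dom _ GA _ _ _ _ r D.
    by move: rb; rewrite /lo /hi /path_left /path_right -/c; case: (forward G q) => ?; [left|right].
  rewrite -/c in Dr; have [r1 r2 r3] := dom_bounds _ GA _ _ _ _ Dr.
  rewrite /along /source opprD addrACA subrr add0r.
  apply: avg_close => //.
  by move=> s s01; apply: H1 => //; exact: h1.
apply: (le_trans (lerD hI hII)).
have : e1 * (hi - lo) <= e1 * `|T|.
  rewrite ler_wpM2l ?(ltW e10)//; apply: le_trans (ler_norm _).
  by rewrite lerBlDr (le_trans rT)// lerDl.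
have -> : e = e1 + e1 * `|T|.
  by rewrite -[X in X + _]mulr1 -mulrDr /e1 mulfVK// gt_eqF.
by rewrite lerD2l.
Qed.

(** [u] is almost fixed for the operator of [nu'], and [state_stability] compares it with every
    fixed point [v] of that operator; so [d] depends neither on [nu'] nor on [v]. *)
Lemma state_dependence (nu : R -> R) (u : state) (e : R) : measurable_fun setT nu ->
  (forall s, 0 <= nu s <= 1) ->
  regular G u -> (forall x, evolve G C nu u x = u x) -> 0 < e ->
    exists2 d, 0 < d & forall nu' : R -> R, measurable_fun setT nu' ->
    (forall s, 0 <= nu' s <= 1) -> (forall s, 0 <= s <= 1 -> `|nu' s - nu s| < d) ->
    forall v, regular G v -> (forall x, evolve G C nu' v x = v x) -> forall x, `|u x - v x| <= e.
Proof.
move=> mnu nu01 ru fu e0; have [W HW] := weight_le G C M GA CA.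
pose w0 := expR (- ((2 * m.+2%:R * M * (2 * M + 1) + 1) / rate G * slant G)).
have w00 : 0 < w0 by exact: expR_gt0.
have W0 : 0 < 1 + `|W| by rewrite ltr_pwDl.
(* The lower bound [w0] of the weight turns an absolute error into a weighted one, the upper bound 1
   + |W| turns it back; 2 is the stability factor. *)
pose e1 := e / 2 / (1 + `|W|) * w0.
have e10 : 0 < e1 by rewrite !mulr_gt0 ?invr_gt0.
have [d d0 H] := evolve_modulus nu u e1 mnu nu01 ru e10.
exists d => // nu' mnu' nu01' Hnu v rv fv x.
have E0 : 0 <= e / 2 / (1 + `|W|) by rewrite !divr_ge0// ltW.
apply: le_trans (state_stability G C M GA CA nu' mnu' nu01' u v _ ru rv fv E0 _ x) _.
  move=> x'; rewrite -(fu x'); apply: (le_trans (H nu' mnu' nu01' Hnu x')).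
  by rewrite /e1 ler_wpM2l// (weight_ge G C M GA CA).
have h : weight G M x <= 1 + `|W|.
  by rewrite (le_trans (HW x))// (le_trans (ler_norm _))// lerDr.
apply: le_trans (ler_wpM2l _ h) _; first by rewrite mulr_ge0.
by rewrite -[2 * _ * _]mulrA mulfVK ?gt_eqF// mulrC mulfVK.
Qed.

End Dependence.

(** * Step functions and nodes *)

Section StepFunctions.
Context {R : realType} (n : nat).

Lemma step_fun_measurable (c : 'I_n -> R) : measurable_fun setT (step_fun c).
Proof.
rewrite /step_fun; apply: measurable_sum => i; apply: measurable_funM => //.
Qed.

Lemma step_fun_out (c : 'I_n -> R) (y : R) : ~~ (0 < y <= 1) -> step_fun c y = 0.
Proof.
move=> yn; rewrite /step_fun big1// => i _; rewrite indicE memNset ?mulr0//=.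
rewrite in_itv/= => /andP[iy yi]; case/negP: yn.
have n0 : (0 : R) < n%:R by rewrite ltr0n (leq_ltn_trans _ (ltn_ord i)).
rewrite (le_lt_trans _ iy) ?divr_ge0//= (le_trans yi)//.
by rewrite ler_pdivrMr// mul1r ler_nat.
Qed.

Lemma step_fun_node (y : R) : (0 < n)%N -> 0 < y <= 1 ->
  exists q : 'I_n, [/\ (q : nat)%:R / n%:R < y, y <= node R q & forall c : 'I_n ->
    R, step_fun c y = c q].
Proof.
move=> n0 /andP[y0 y1]; have n0' : (0 : R) < n%:R by rewrite ltr0n.
have ex : exists k : nat, y <= k.+1%:R / n%:R.
  by exists n.-1; rewrite prednK// divff ?gt_eqF.
have kP := ex_minnP ex; case: kP => k yk kmin.
have kn : (k < n)%N by rewrite -ltnS -(prednK n0) ltnS; apply: kmin; rewrite prednK// divff ?gt_eqF.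
have ky : k%:R / n%:R < y.
  rewrite ltNge; apply/negP => h; case: k yk kmin kn h => [|k] yk kmin kn h.
    by move: h; rewrite mul0r leNgt y0.
  by have := kmin k h; rewrite ltnn.
exists (Ordinal kn); split => // c; rewrite /step_fun (bigD1 (Ordinal kn))//= big1 ?addr0.
  by rewrite indicE mem_set ?mulr1//= in_itv/= ky.
move=> i ik; rewrite indicE memNset ?mulr0//= in_itv/= => /andP[iy yi].
have h1 : (i <= k)%N.
  by rewrite -ltnS -(ltr_nat R) -(ltr_pM2r (_ : 0 < n%:R^-1 :> R)) ?invr_gt0// (lt_le_trans iy).
have h2 : (k <= i)%N.
  by rewrite -ltnS -(ltr_nat R) -(ltr_pM2r (_ : 0 < n%:R^-1 :> R)) ?invr_gt0// (lt_le_trans ky).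
by case/eqP: ik; apply/val_inj/eqP; rewrite eqn_leq h1.
Qed.

Lemma step_node_range (s : R) : 0 <= step_fun (@node R n) s <= 1.
Proof.
have [s01|s01] := boolP (0 < s <= 1); last by rewrite step_fun_out// lexx ler01.
have [n0|] := boolP (0 < n)%N; last first.
  by rewrite -eqn0Ngt => /eqP n0; rewrite /step_fun big1 ?lexx ?ler01// => -[i ilt]; exfalso;
    move: ilt; rewrite n0.
have [q [_ _ ->]] := step_fun_node s n0 s01.
have n0' : (0 : R) < n%:R by rewrite ltr0n.
by rewrite /node divr_ge0//= ler_pdivrMr// mul1r ler_nat.
Qed.

Lemma step_node_close (s : R) : (0 < n)%N -> 0 <= s <= 1 ->
  `|step_fun (@node R n) s - cl s| < 2 / n%:R.
Proof.
move=> n0 s01; rewrite (cl_id s s01); have n0' : (0 : R) < n%:R by rewrite ltr0n.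
have [s1|s1] := boolP (0 < s <= 1); last first.
  have -> : s = 0.
    by move: s01 s1 => /andP[a b]; rewrite b andbT -leNgt => c; apply/le_anti; rewrite a c.
  by rewrite step_fun_out ?ltxx// subrr normr0 divr_gt0.
have [q [h1 h2 ->]] := step_fun_node s n0 s1.
have -> : 2 / n%:R = node R q - ((q : nat)%:R / n%:R) + 1 / n%:R :> R.
  by rewrite /node -natr1 mulrDl; lra.
have : 0 < 1 / n%:R :> R by rewrite divr_gt0.
by rewrite ger0_norm ?subr_ge0//; lra.
Qed.

End StepFunctions.

Section Sampling.
Context {R : realType} {m : nat} (P : continuum_params R m).

Lemma sampled_id : sampled R m P P cl.
Proof.
have E (y : R) : 0 < y <= 1 -> cl y = y by move=> /andP[a b]; rewrite cl_id// ltW.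
by split=> *; rewrite ?E.
Qed.

Lemma sampled_step (n : nat) (D : nm_params R m n) : (0 < n)%N -> same_mu_psi P D ->
  sampling_relations P D ->
  sampled R m P (step_params D) (step_fun (@node R n)).
Proof.
move=> n0 [emu epsi] [eth eW eQ elam esig]; split => //=.
- by move=> x y x01 /(step_fun_node n _ n0)[q [_ _ E]]; rewrite !E elam// I01E.
- move=> x eta y x01 /(step_fun_node n _ n0)[q [_ _ E]] /(step_fun_node n _ n0)[q' [_ _ E']].
  by rewrite !E !E' esig// I01E.
- by move=> j x y x01 /(step_fun_node n _ n0)[q [_ _ E]]; rewrite !E eW// I01E.
- by move=> j x y x01 /(step_fun_node n _ n0)[q [_ _ E]]; rewrite !E eth// I01E.
- by move=> j y /(step_fun_node n _ n0)[q [_ _ E]]; rewrite !E eQ.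
Qed.

End Sampling.

(** * Existence and convergence of solutions *)

Section Convergence.
Context {R : realType} {m : nat} (P : continuum_params R m) (l : 'I_m -> 'I_m -> R -> R).
Hypothesis JC : jointly_continuous P.
Hypothesis CA : continuum_assumption P.
Hypothesis AL : admissible_l P l.

Lemma setups_exist : exists kap eps c0 (finv : 'I_m -> 'I_m -> R -> R) Laminv zK zd, forall i,
  setup P i (kap i) (eps i) (c0 i) (finv i) (Laminv i) (zK i) (zd i).
Proof.
have /choice[F HF] (i : 'I_m) : exists d : R * R * R * ('I_m -> R -> R) * (R -> R -> R) * (R ->
  R -> R) * ('I_m -> R -> R),
    setup P i d.1.1.1.1.1.1 d.1.1.1.1.1.2 d.1.1.1.1.2 d.1.1.1.2 d.1.1.2 d.1.2 d.2.
  have [kap [eps [c0 [finv [Laminv [zK [zd SU]]]]]]] := setup_exists P JC CA i.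
  by exists (kap, eps, c0, finv, Laminv, zK, zd).
by do 7!eexists; move=> i; exact: (HF i).
Qed.

Variables (kap eps c0 : 'I_m -> R) (finv : 'I_m -> 'I_m -> R -> R)
  (Laminv zK : 'I_m -> R -> R -> R) (zd : 'I_m -> 'I_m -> R -> R).
Hypothesis SU : forall i, setup P i (kap i) (eps i) (c0 i) (finv i) (Laminv i) (zK i) (zd i).
Notation state := (@channel m * (R * R * R) -> R).
Notation KG i := (kgeo P i (kap i) (eps i) (finv i) (Laminv i) (zK i) (zd i)).
Notation KC i := (kcoefs P l i (finv i) (zK i) (zd i)).

Lemma states_exist (nu : R -> R) : measurable_fun setT nu -> (forall s, 0 <= nu s <= 1) ->
  exists U : 'I_m -> state, (forall i, regular (KG i) (U i)) /\
    forall i x, evolve (KG i) (KC i) nu (U i) x = U i x.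
Proof.
move=> mnu nu01.
have /choice[U HU] (i : 'I_m) : exists u : state, regular (KG i) u /\ forall x,
  evolve (KG i) (KC i) nu u x = u x.
  have [M CM] := kcoefs_bounded P l JC CA AL i _ _ _ _ _ _ _ (SU i).
  have GA := kgeo_axioms P JC CA _ _ _ _ _ _ _ _ (SU i).
  by have [u ru fu] := fixed_state _ _ _ GA CM nu mnu nu01; exists u.
by exists U; split => i; have [] := HU i.
Qed.

Lemma solution_exists : exists (K : kernelK R m) (L : kernelL R m), segmented_solution P l K L.
Proof.
have mcl : measurable_fun setT (@cl R) by apply: continuous_measurable_fun; exact: cont_cl.
have [U [rU fU]] := states_exist cl mcl cl01.
do 2!eexists.
exact: (state_segmented_solution P l JC CA AL _ _ _ _ _ _ _ SU cl mcl cl01 U rU fU P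
  (sampled_id P)).
Qed.

Lemma step_solution_exists (n : nat) (D : nm_params R m n) : (0 < n)%N ->
  same_mu_psi P D -> sampling_relations P D ->
  exists (k : 'I_m -> 'I_m -> 'I_n -> R -> R -> R) (Ln : kernelL R m),
    segmented_solution (step_params D) l (step_kernel k) Ln.
Proof.
move=> n0 sm sr; pose nu := step_fun (@node R n).
have mnu : measurable_fun setT nu by exact: step_fun_measurable.
have nu01 : forall s, 0 <= nu s <= 1 by exact: step_node_range.
have [U [rU fU]] := states_exist nu mnu nu01.
exists (fun i p q x xi => U i (None, (travel P i x, xi, node R q))), (state_L P U).
have -> : step_kernel (fun i p (q : 'I_n) x xi => U i (None, (travel P i x, xi,
  node R q))) = state_K P nu U.
  apply/funext => i; apply/funext => p; apply/funext => x; apply/funext => xi; apply/funext => y.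
  rewrite /step_kernel /state_K; case: ifPn => [y01|/step_fun_out ->//].
  by rewrite /nu; have [q [_ _ E]] := step_fun_node n y n0 y01; rewrite !E.
exact: (state_segmented_solution P l JC CA AL _ _ _ _ _ _ _ SU nu mnu nu01 U rU fU _
  (sampled_step P n D n0 sm sr)).
Qed.

(** By uniqueness the given kernels are the constructed states for almost every y, the first read at
    y and the second at [nu y]. Half of [delta1] pays for moving y to [nu y] in the first state, the
    other half for the distance of the two states. Both moduli are fixed before n is, so N is
    uniform in [D]. *)
Lemma step_solution_close (K : kernelK R m) (L : kernelL R m) (delta1 : R) : segmented_solution
  P l K L -> 0 < delta1 ->
  exists N : nat, forall n : nat, (0 < n)%N -> (N <= n)%N ->
    forall D : nm_params R m n, same_mu_psi P D -> sampling_relations P D ->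
    forall (Kn : kernelK R m) (Ln : kernelL R m), segmented_solution (step_params D) l Kn Ln ->
    (forall i p : 'I_m, (i <= p)%N -> forall x xi : R, Tseg (c_mu P) i p (x, xi) ->
       norm_L2_01 (fun y => K i p x xi y - Kn i p x xi y) <= delta1) /\
    (forall j i p : 'I_m, (i <= p)%N -> forall x xi : R, Tseg (c_mu P) i p (x, xi) ->
       `|L i j p x xi - Ln i j p x xi| <= delta1).
Proof.
move=> S d0; pose e := delta1 / 2; have e0 : 0 < e by rewrite divr_gt0.
have mcl : measurable_fun setT (@cl R) by apply: continuous_measurable_fun; exact: cont_cl.
have [U [rU fU]] := states_exist cl mcl cl01.
have SS := state_segmented_solution P l JC CA AL _ _ _ _ _ _ _ SU cl mcl cl01 U rU fU P
  (sampled_id P).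
have GA i := kgeo_axioms P JC CA _ _ _ _ _ _ _ _ (SU i).
have [d d0' [Hdep Hmod]] : exists2 d, 0 < d &
    (forall i, forall nu' : R -> R, measurable_fun setT nu' ->
      (forall s, 0 <= nu' s <= 1) -> (forall s, 0 <= s <= 1 -> `|nu' s - cl s| < d) ->
      forall v, regular (KG i) v -> (forall x, evolve (KG i) (KC i) nu' v x = v x) ->
        forall x, `|U i x - v x| <= e) /\
    (forall i, forall q (t xi s s' : R), 0 <= t <= horizon (KG i) -> 0 <= xi <= 1 -> 0 <= s <= 1 ->
      `|s' - s| < d -> `|U i (q, (t, xi, s')) - U i (q, (t, xi, s))| <= e).
  have [||d1 d10 H1] := fin_common 'I_m (fun i d => forall nu' : R -> R, measurable_fun setT nu' ->
      (forall s, 0 <= nu' s <= 1) -> (forall s, 0 <= s <= 1 -> `|nu' s - cl s| < d) ->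
      forall v, regular (KG i) v -> (forall x, evolve (KG i) (KC i) nu' v x = v x) ->
        forall x, `|U i x - v x| <= e).
  - move=> i; have [M CM] := kcoefs_bounded P l JC CA AL i _ _ _ _ _ _ _ (SU i).
    exact: (state_dependence _ _ _ (GA i) CM cl (U i) e mcl cl01 (rU i) (fU i) e0).
  - move=> i d d' dd H nu' mnu' nu01 Hnu; apply: H => // s s01.
    exact: lt_le_trans (Hnu s s01) dd.
  have [||d2 d20 H2] := fin_common 'I_m (fun i d => forall q (t xi s s' : R),
    0 <= t <= horizon (KG i) -> 0 <= xi <= 1 -> 0 <= s <= 1 ->
      `|s' - s| < d -> `|U i (q, (t, xi, s')) - U i (q, (t, xi, s))| <= e).
  - by move=> i; exact: state_modulus.
  - move=> i d d' dd H q t xi s s' t01 xi01 s01 ss; apply: H => //.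
    exact: lt_le_trans ss dd.
  exists (Num.min d1 d2); first by rewrite lt_min d10.
  split=> i.
    move=> nu' mnu' nu01 Hnu; apply: H1 => // s s01.
    by have := Hnu s s01; rewrite lt_min => /andP[].
  by move=> q t xi s s' t01 xi01 s01; rewrite lt_min => /andP[_ ss]; exact: H2.
have [N HN] : exists N : nat, forall n, (0 < n)%N -> (N <= n)%N -> 2 / n%:R < d :> R.
  exists (Num.truncn (2 / d)).+1 => n n0 Nn; have n0' : (0 : R) < n%:R by rewrite ltr0n.
  rewrite ltr_pdivrMr// mulrC -ltr_pdivrMr//.
  by apply: (lt_le_trans (truncnS_gt _)); rewrite ler_nat.
exists N => n n0 Nn D sm sr Kn Ln Sn.
pose nu := step_fun (@node R n).
have mnu : measurable_fun setT nu by exact: step_fun_measurable.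
have nu01 : forall s, 0 <= nu s <= 1 by exact: step_node_range.
have Hnu s : 0 <= s <= 1 -> `|nu s - cl s| < d.
  by move=> s01; exact: lt_trans (step_node_close n s n0 s01) (HN n n0 Nn).
have [V [rV fV]] := states_exist nu mnu nu01.
have PP' := sampled_step P n D n0 sm sr.
have SV := state_segmented_solution P l JC CA AL _ _ _ _ _ _ _ SU nu mnu nu01 V rV fV _ PP'.
have [uL uK] := segmented_solution_unique P l JC CA AL cl mcl cl01 P (sampled_id P) _ _ _ _ S SS.
have [vL vK] := segmented_solution_unique P l JC CA AL nu mnu nu01 _ PP' _ _ _ _ Sn SV.
have UV i := Hdep i nu mnu nu01 Hnu (V i) (rV i) (fV i).
have ed : e <= delta1 by rewrite /e; lra.
split; last first.
  move=> j i p ip x xi T; rewrite (uL i j p ip x xi T) (vL i j p ip x xi T).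
  exact: le_trans (UV i _) ed.
move=> i p ip x xi T.
have mI : measurable (@I01 R) by exact: measurable_itv.
have [[k1 _ _] [k2 _ _]] := (S, Sn).
have [[h1 _] _] := k1 i p ip; have [[h2 _] _] := k2 i p ip.
rewrite (sa_mu PP') in h2.
have a1 : L2_on leb I01 (K i p x xi) := h1 _ T.
have a2 : L2_on leb I01 (Kn i p x xi) := h2 _ T.
have a12 := L2_onB _ _ leb I01 _ _ a1 a2.
apply: (L2_norm_le _ _ leb I01 mI leb_I01 _ _ (ltW d0)).
  exact: (L2_on_measurable _ _ leb I01 mI _ a12).
have n0z : (@lebesgue_measure R).-negligible [set (0 : R)].
  by exists [set 0]; split => //; exact: lebesgue_measure_set1.
apply: negligibleS (negligibleU uK (negligibleU vK n0z)) => y /= H;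
  apply: contrapT => /not_orP[g1 /not_orP[g2 y0]].
move/contrapT: g1 => g1; move/contrapT: g2 => g2; apply: H => Iy.
rewrite (g1 Iy i p ip x xi T) (g2 Iy i p ip x xi T).
have y01 : 0 <= y <= 1 by move: Iy; rewrite I01E.
have y01' : 0 < y <= 1.
  by move: y01 => /andP[a b]; rewrite b andbT lt_neqAle a andbT; apply/eqP => h; exact: y0.
rewrite /state_K y01'.
have [[xi01 tT ft tf] x01] := in_segment_Tseg P JC CA _ _ _ _ ip T.
have t01 : 0 <= travel P i x <= horizon (KG i).
  by rewrite tT andbT -(travel0 P i) (travel_le P JC CA); case/andP: x01.
have -> : delta1 = e + e by rewrite /e; lra.
have b1 := UV i (None, (travel P i x, xi, nu y)).
have b2 := Hmod i None _ _ (cl y) (nu y) t01 xi01 (cl01 y) (Hnu y y01).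
rewrite distrC in b2.
apply: le_trans (lerD b2 b1); apply: le_trans (ler_normD _ _).
by rewrite addrA subrK.
Qed.

End Convergence.

(** * Interpolating continuum parameters *)

Section OneSided.
Context {R : realType}.

(** Makes the limit in [derive01] unique: from any point of [0, 1] there are arbitrarily small steps
    that stay inside, to the right from the left half and to the left from the right half. *)
Lemma within_I01_proper (x : R) : I01 x -> ProperFilter (within I01 x^').
Proof.
rewrite I01E => /andP[x0 x1]; split; last by apply: within_filter; exact: within_filter.
move=> H; have /nbhs_ballP[e /= e0 He] : nbhs x (fun z : R => z != x -> I01 z -> False) by exact: H.
pose h := Num.min (e / 2) (1 / 4).
have h0 : 0 < h by rewrite lt_min !divr_gt0.
have he : h < e by rewrite gt_min ltr_pdivrMr// ltr_pMr// ltr1n.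
have h4 : h <= 1 / 4 by rewrite ge_min lexx orbT.
have [xl|xl] := leP x (1 / 2).
  apply: (He (x + h)); rewrite /ball /= ?I01E; last by apply/andP; split; lra.
    by rewrite opprD addrA subrr sub0r normrN gtr0_norm.
  by rewrite -subr_eq0 addrAC subrr add0r gt_eqF.
apply: (He (x - h)); rewrite /ball /= ?I01E; last by apply/andP; split; lra.
  by rewrite opprB addrCA subrr addr0 gtr0_norm.
by rewrite -subr_eq0 addrAC subrr sub0r oppr_eq0 gt_eqF.
Qed.

Lemma derive01_eq (f : R -> R) (x v : R) : I01 x -> quot f x z @[z --> within I01 x^'] --> v ->
  derivable01 f x /\ derive01 f x = v.
Proof.
move=> Ix H; have PF := within_I01_proper x Ix; split; first by apply/cvg_ex; exists v.
exact: cvg_lim H.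
Qed.

Lemma quot_sum (n : nat) (f : 'I_n -> R -> R) (c v : 'I_n -> R) (x : R) :
  (forall k, quot (f k) x z @[z --> within I01 x^'] --> v k) ->
  quot (fun t => \sum_(k < n) f k t * c k) x z @[z --> within I01 x^'] --> \sum_(k < n) v k * c k.
Proof.
move=> H; have -> : (fun z => quot (fun t => \sum_(k < n) f k t * c k) x z) =
    (fun z => \sum_(k < n) quot (f k) x z * c k).
  apply/funext => z; rewrite /quot -sumrB mulr_suml; apply: eq_bigr => k _; ring.
apply: cvg_big => [|k _]; first exact: add_continuous.
by apply: cvgMl; exact: H.
Qed.

(** p - p(x) is divisible by X - x, and the quotient, a continuous polynomial, is the difference
    quotient. *)
Lemma quot_poly (p : {poly R}) (x : R) : quot (horner p) x z @[z --> within I01 x^'] --> p^`().[x].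
Proof.
have /factor_theorem[q qE] : root (p - p.[x]%:P) x by rewrite /root !hornerE subrr.
have pE : p = q * ('X - x%:P) + p.[x]%:P by rewrite -qE subrK.
have -> : p^`().[x] = q.[x].
  by rewrite {1}pE !poly.derivE !hornerE subrr mulr0 add0r.
have Hq : horner q @ within I01 x^' --> q.[x].
  move=> B BB; have HB : \forall z \near x, B q.[z] by exact: (@continuous_horner _ q x B BB).
  exact: (filterS (fun z (h : B q.[z]) _ _ => h) HB).
apply: cvg_trans Hq; apply: near_eq_cvg.
have : \forall z \near x, z != x -> I01 z -> q.[z] = quot (horner p) x z.
  near=> z => zx _; rewrite /quot [in RHS]pE !hornerE subrr mulr0 add0r addrK mulfK//.
  by rewrite subr_eq0.
by [].
Unshelve. all: by end_near. Qed.

Lemma within_eq (T U : topologicalType) (A : set T) (f g : T -> U) : (forall z, A z ->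
  f z = g z) -> continuous g ->
  {within A, continuous f}.
Proof.
move=> fg cg; have : {in A, g =1 f} by move=> z; rewrite inE => /fg ->.
by move=> /(@subspace_eq_continuous _ A _ g f); apply; exact: continuous_subspaceT.
Qed.

Lemma C_L2_joint (f : R -> R -> R) : cont01_2 f -> C_L2 I01 leb I01 f.
Proof.
move=> cf; have cg := cl_cont01_2 _ cf.
have mI : measurable (@I01 R) by exact: measurable_itv.
apply: C_L2_uniform => //; first exact: leb_I01.
- move=> a Ia; apply: (@eq_measurable_fun _ _ _ _ _ (fun y => f (cl a) (cl y))).
    by move=> y; rewrite inE I01E => y01; rewrite !cl_id// -I01E.
  apply: measurable_funTS; apply: continuous_measurable_fun.
  exact: (cont_comp _ _ _ (fun y : R => (a,
    y)) _ cg (cont_pair _ _ _ _ _ (@cont_cst _ _ a) (@cont_id _))).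
- move=> a Ia; have [B HB] := clamp_bounded2 _ cg; exists B => y; rewrite I01E => y01.
  by have := HB (a, y); rewrite /= !cl_id// -I01E.
- move=> a e Ia e0; have [|d d0 H] := unif_cont_compact _ (@I01 R `*` @I01 R) _ e _ cg e0.
    by apply: compact_setX; exact: segment_compact.
  exists d => // b y Ib ab Iy; have := H (a, y) (b, y) (conj Ia Iy) (conj ab (ballxx _ d0)).
  by rewrite /= !cl_id -?I01E// distrC => /ltW.
Qed.

End OneSided.

Section Interpolation.
Context {R : realType} (n : nat).
Hypothesis n0 : (0 < n)%N.

(* Squares of Lagrange polynomials: still 1 or 0 at the nodes, but nonnegative and
   without a common zero, so that interpolation preserves positivity. *)
Definition bump (i : 'I_n) : {poly R} :=
  (\prod_(k < n | k != i) ((node R i - node R k)^-1 *: ('X - (node R k)%:P))) ^+ 2.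

Lemma node_inj (i k : 'I_n) : node R i = node R k -> i = k.
Proof.
have n0' : (n%:R : R) != 0 by rewrite pnatr_eq0 -lt0n.
by move=> /(divIf n0')/eqP; rewrite eqr_nat eqSS => /eqP e; apply/val_inj.
Qed.

Lemma bump_node (i k : 'I_n) : (bump i).[node R k] = (i == k)%:R.
Proof.
rewrite /bump !hornerE horner_prod; have [<-|ik] := eqVneq i k.
  rewrite big1 ?expr1n// => j ji; rewrite !hornerE mulVf// subr_eq0; apply/eqP => e.
  by rewrite (node_inj i j e) eqxx in ji.
by rewrite (bigD1 k) 1?eq_sym//= !hornerE subrr mulr0 mul0r expr0n.
Qed.

Lemma bump_ge0 i y : 0 <= (bump i).[y].
Proof. by rewrite /bump !hornerE sqr_ge0. Qed.

(** At a node its own bump equals 1; away from all nodes no factor of a bump vanishes. *)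
Lemma bump_sum_gt0 y : 0 < \sum_(i < n) (bump i).[y].
Proof.
suff [i i0] : exists i, (bump i).[y] != 0.
  rewrite (bigD1 i)//= ltr_pwDl ?sumr_ge0//; first by rewrite lt0r i0 bump_ge0.
  by move=> k _; exact: bump_ge0.
have [/existsP[k /eqP ->]|/existsPn H] := boolP [exists k : 'I_n, y == node R k].
  by exists k; rewrite bump_node eqxx oner_eq0.
exists (Ordinal n0); rewrite /bump !hornerE horner_prod sqrf_eq0; apply/prodf_neq0 => k ki.
rewrite !hornerE mulf_neq0 ?subr_eq0 ?H// invr_eq0 subr_eq0; apply/eqP => e.
by rewrite (node_inj _ _ e) eqxx in ki.
Qed.

Definition interp (c : 'I_n -> R) (y : R) : R := \sum_(i < n) c i * (bump i).[y].

Lemma interp_node c k : interp c (node R k) = c k.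
Proof.
rewrite /interp (bigD1 k)//= bump_node eqxx mulr1 big1 ?addr0// => i ik.
by rewrite bump_node (negbTE ik) mulr0.
Qed.

Lemma interp_cont2 (f : 'I_n -> R -> R) (p : 'I_n -> {poly R}) : (forall i, cont01 (f i)) ->
  cont01_2 (fun x y => \sum_(i < n) f i x * (p i).[y]).
Proof.
move=> cf; apply: (within_eq _ _ _ _ (fun z : R * R => \sum_(i < n) f i (cl z.1) * (p i).[z.2])).
  by move=> [x y] [/= x01 y01]; apply: eq_bigr => i _; rewrite cl_id// -I01E.
apply: cont_sum => i; apply: contM.
  exact: (cont_comp _ _ _ _ _ (cl_cont01 _ (cf i)) (cont_fst _ _ _ _ (@cont_id _))).
exact: (cont_comp _ _ _ (fun z : R * R => z.2) _ (@continuous_horner _ (p i)) (cont_snd _ _ _ _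
  (@cont_id _))).
Qed.

End Interpolation.

Section ContinuousSampling.
Context {R : realType} {m : nat} (n : nat) (n0 : (0 < n)%N) (D : nm_params R m n).
Hypothesis DA : nm_assumption D.

Definition interp_params : continuum_params R m := {|
  c_lam := fun x => interp n (fun i => d_lam D i x);
  c_mu := d_mu D;
  c_sig := fun x y eta => interp n (fun i => interp n (fun k => d_sig D i k x) eta) y;
  c_W := fun j x => interp n (fun i => d_w D i j x);
  c_th := fun j x => interp n (fun i => d_th D j i x);
  c_Q := fun j => interp n (fun i => d_q D i j);
  c_psi := d_psi D |}.
Notation IP := interp_params.

Lemma interp_sampling : sampling_relations IP D.
Proof. by split=> *; rewrite /= ?interp_node. Qed.

Lemma interp_sig_cont : continuous (fun z : R * R * R => c_sig IP (cl z.1.1) z.1.2 z.2).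
Proof.
have [_ _ _ [cs _ _ _] _] := DA.
have c1 := cont_fst _ _ _ _ (@cont_id (R * R * R)%type).
apply: cont_sum => i; apply: contM; last first.
  exact: (cont_comp _ _ _ (fun z : R * R * R => z.1.2) _ (@continuous_horner _ (bump n i))
    (cont_snd _ _ _ _ c1)).
apply: cont_sum => k; apply: contM; last first.
  exact: (cont_comp _ _ _ (fun z : R * R * R => z.2) _ (@continuous_horner _ (bump n k))
    (cont_snd _ _ _ _ (@cont_id _))).
exact: (cont_comp _ _ _ _ _ (cl_cont01 _ (cs i k)) (cont_fst _ _ _ _ c1)).
Qed.

Lemma interp_jointly_continuous : jointly_continuous IP.
Proof.
have [[C1l _] _ _ [cs cw cth _] _] := DA.
split.
- by apply: interp_cont2 => i; apply: derivable01_cont; have [] := C1l i.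
- apply: (within_eq _ _ _ _ (fun z : R * R * R => c_sig IP (cl z.1.1) z.1.2 z.2));
  last exact: interp_sig_cont.
  by move=> [[x y] eta] [[/= x01 _] _]; rewrite cl_id// -I01E.
- by move=> j; apply: interp_cont2 => i; exact: cw.
- by move=> j; apply: interp_cont2 => i; exact: cth.
- move=> j; apply: continuous_subspaceT; apply: cont_sum => i; apply: contM; first exact: cont_cst.
  exact: continuous_horner.
Qed.

Lemma interp_lam_C1 : C1_01_2 (c_lam IP).
Proof.
have [[C1l _] _ _ _ _] := DA.
have cl_ i : cont01 (d_lam D i) by apply: derivable01_cont; have [] := C1l i.
have D1 x y : I01 x -> derivable01 (c_lam IP ^~ y) x /\
    derive01 (c_lam IP ^~ y) x = \sum_(i < n) derive01 (d_lam D i) x * (bump n i).[y].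
  move=> Ix; apply: derive01_eq => //; apply: quot_sum => i; have [h _] := C1l i; exact: h.
have D2 x y : I01 y -> derivable01 (c_lam IP x) y /\
    derive01 (c_lam IP x) y = \sum_(i < n) d_lam D i x * (bump n i)^`().[y].
  move=> Iy.
  have -> : c_lam IP x = (fun y => \sum_(i < n) (bump n i).[y] * d_lam D i x).
    by apply/funext => z; apply: eq_bigr => i _; rewrite mulrC.
  under eq_bigr do rewrite mulrC.
  apply: derive01_eq => //; apply: (quot_sum n (fun i => horner (bump n i))) => i; exact: quot_poly.
split.
- by move=> x y Ix Iy; have [? _] := D1 x y Ix; have [? _] := D2 x y Iy.
- exact: interp_cont2.
- have := interp_cont2 n (fun i => derive01 (d_lam D i)) (bump n) (fun i => (C1l i).2).
  apply: subspace_eq_continuous => -[x y]; rewrite inE => -[/= Ix Iy].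
  exact: esym (D1 x y Ix).2.
- have := interp_cont2 n (d_lam D) (fun i => (bump n i)^`()) cl_.
  apply: subspace_eq_continuous => -[x y]; rewrite inE => -[/= Ix Iy].
  exact: esym (D2 x y Iy).2.
Qed.

Lemma leb2_I01 : (@leb2 R (I01 `*` I01) <= 1)%E.
Proof.
have mI : measurable (@I01 R) by exact: measurable_itv.
have -> : leb2 (I01 `*` I01) = (@leb R I01 * @leb R I01)%E by exact: product_measure1E.
rewrite -[leRHS]mule1; apply: lee_pmul => //; exact: leb_I01.
Qed.

Lemma interp_sig_L2 : C_L2 I01 leb2 (I01 `*` I01) (fun x z => c_sig IP x z.1 z.2).
Proof.
have mI : measurable (@I01 R) by exact: measurable_itv.
have cg := interp_sig_cont.
have cK : compact (@I01 R `*` @I01 R `*` @I01 R) by do 2?apply: compact_setX;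
  exact: segment_compact.
apply: C_L2_uniform; [exact: measurableX|exact: leb2_I01| | |].
- move=> a Ia; apply: measurable_funTS.
  apply: measurable_sum => i; apply: measurable_funM; last first.
    apply: (measurableT_comp (f := horner (bump n i))) => //.
    by apply: continuous_measurable_fun; exact: continuous_horner.
  apply: measurable_sum => k; apply: measurable_funM => //.
  apply: (measurableT_comp (f := horner (bump n k))) => //.
  by apply: continuous_measurable_fun; exact: continuous_horner.
- move=> a Ia; have [B HB] := cont_bounded _ _ _ cK cg; exists B => -[y eta] [/= Iy Ie].
  by have := HB (a, y, eta); rewrite /= cl_id -?I01E//; apply.
- move=> a e Ia e0; have [d d0 H] := unif_cont_compact _ _ _ e cK cg e0.
  exists d => // b [y eta] Ib ab [/= Iy Ie].
  have := H (a, y, eta) (b, y, eta) (conj (conj Ia Iy) Ie) (conj (conj ab (ballxx _ d0))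
    (ballxx _ d0)).
  by rewrite /= !cl_id -?I01E// distrC => /ltW.
Qed.

(** The samples have a common lower bound [c], and the sum of the nonnegative bumps has a lower
    bound [s]. *)
Lemma interp_lam_gt0 : exists2 c : R, 0 < c & forall x y, I01 x -> I01 y -> c <= c_lam IP x y.
Proof.
have [[C1l _] [_ lam0] _ _ _] := DA.
have [||c c0 Hc] := fin_common 'I_n (fun i c => forall x, 0 <= x <= 1 -> c <= d_lam D i x).
- move=> i; have ci : cont01 (d_lam D i) by apply: derivable01_cont; have [] := C1l i.
  have [|c c0 Hc] := itv_gt0_min _ (cl_cont01 _ ci).
    by move=> x x01; rewrite cl_id//; apply: lam0; rewrite I01E.
  by exists c => // x x01; have := Hc x x01; rewrite cl_id.
- by move=> i c c' cc H x x01; exact: le_trans (H x x01).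
have [||s s0 Hs] := itv_gt0_min (fun y : R => \sum_(i < n) (bump n i).[y]).
- by apply: cont_sum => i; exact: continuous_horner.
- by move=> y _; exact: bump_sum_gt0.
exists (c * s); first exact: mulr_gt0.
move=> x y; rewrite !I01E => x01 y01; apply: (@le_trans _ _ (c * \sum_(i < n) (bump n i).[y])).
  by rewrite ler_wpM2l ?(ltW c0)// Hs.
by rewrite mulr_sumr; apply: ler_sum => i _; rewrite ler_wpM2r ?bump_ge0// Hc.
Qed.

Lemma interp_assumption : continuum_assumption IP.
Proof.
have [[C1l C1m] [mu0 lam0] ord [cs cw cth cpsi] psi0] := DA.
have [_ _ jw jth jQ] := interp_jointly_continuous.
have mI : measurable (@I01 R) by exact: measurable_itv.
split.
- by split => //; exact: interp_lam_C1.
- by move=> j; split; apply: C_L2_joint.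
- split; last exact: interp_sig_L2.
  move=> j; have cQ : continuous (c_Q IP j).
    apply: cont_sum => i; apply: contM; first exact: cont_cst.
    exact: continuous_horner.
  have [B HB] := itv_bounded _ cQ.
  apply: (L2_bounded _ _ leb I01 mI leb_I01 _ B).
    by apply: measurable_funTS; exact: continuous_measurable_fun.
  by move=> y; rewrite I01E; exact: HB.
- by [].
- split; [|exact: interp_lam_gt0|exact: ord].
  apply: fin_common.
    move=> j; have [jm|jm] := eqVneq j.+1 m; last by exists 1 => // /eqP; rewrite (negbTE jm).
    have cj : cont01 (d_mu D j) by apply: derivable01_cont; have [] := C1m j.
    have [|c c0 Hc] := itv_gt0_min _ (cl_cont01 _ cj).
      by move=> x x01; rewrite cl_id//; apply: mu0; rewrite ?I01E.
    by exists c => // _ x; rewrite I01E => x01; have := Hc x x01; rewrite cl_id.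
  by move=> j c c' cc H jm x Ix; exact: le_trans (H jm x Ix).
Qed.

End ContinuousSampling.

(** The estimates quantify over all solutions of the continuum and of the step equations, so they
    refer to no construction; the two clauses before them provide such solutions. A bound at every
    point of each segment expresses the bound on the maximum. *)
Theorem lemma5 (R : realType) (m : nat) (hm : (0 < m)%N) :
  (forall (n : nat) (hn : (0 < n)%N) (D : nm_params R m n),
     nm_assumption D ->
     exists P : continuum_params R m,
       [/\ same_mu_psi P D, jointly_continuous P,
           sampling_relations P D & continuum_assumption P])
  /\
  (forall (P : continuum_params R m) (l : 'I_m -> 'I_m -> R -> R),
     jointly_continuous P -> continuum_assumption P -> admissible_l P l ->
     [/\ exists (K : kernelK R m) (L : kernelL R m),
           segmented_solution P l K L,
         forall (n : nat) (hn : (0 < n)%N) (D : nm_params R m n),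
           same_mu_psi P D -> sampling_relations P D ->
           exists (k : 'I_m -> 'I_m -> 'I_n -> R -> R -> R)
                  (Ln : kernelL R m),
             segmented_solution (step_params D) l (step_kernel k) Ln &
         forall (K : kernelK R m) (L : kernelL R m),
           segmented_solution P l K L ->
           forall delta1 : R, 0 < delta1 ->
           exists N : nat, forall n : nat, (0 < n)%N -> (N <= n)%N ->
           forall D : nm_params R m n,
             same_mu_psi P D -> sampling_relations P D ->
           forall (Kn : kernelK R m) (Ln : kernelL R m),
             segmented_solution (step_params D) l Kn Ln ->
             (forall i p : 'I_m, (i <= p)%N ->
              forall x xi : R, Tseg (c_mu P) i p (x, xi) ->
                norm_L2_01 (fun y => K i p x xi y - Kn i p x xi y) <= delta1)
             /\
             (forall j i p : 'I_m, (i <= p)%N ->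
              forall x xi : R, Tseg (c_mu P) i p (x, xi) ->
                `|L i j p x xi - Ln i j p x xi| <= delta1)]).
Proof.
split=> [n n0 D DA|P l JC CA AL].
  exists (interp_params n D); split => //.
  - exact: interp_jointly_continuous.
  - exact: interp_sampling.
  - exact: interp_assumption.
have [kap [eps [c0 [finv [Laminv [zK [zd SU]]]]]]] := setups_exist P JC CA.
split.
- exact: solution_exists SU.
- move=> n n0 D; exact: step_solution_exists SU n D n0.
- move=> K L S delta1; exact: step_solution_close SU K L delta1 S.
Qed.
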